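(* For every $\boldsymbol{v}\in\dot H^1_{0,\sigma}(\mathbb{R}^2_+)\cap\mathcal{X}$, there exists a sequence $\{\boldsymbol{v}_n\}_{n\in\mathbb{N}}\subset C^\infty_{c,\sigma}(\mathbb{R}^2_+)$ satisfying the following properties: (i) The sequence $\{\boldsymbol{v}_n\}_{n\in\mathbb{N}}$ converges to $\boldsymbol{v}$ in $\dot H^1_{0,\sigma}(\mathbb{R}^2_+)$. (ii) For any $\boldsymbol{u}\in\dot H^1_{0,\sigma}(\mathbb{R}^2_+)$, the sequence $\{\boldsymbol{u}\otimes\boldsymbol{v}_n\}_{n\in\mathbb{N}}$ converges to $\boldsymbol{u}\otimes\boldsymbol{v}$ in $L^2(\mathbb{R}^2_+)$.
   Context: Let $\mathbb{R}^2_+=\{\boldsymbol{x}=(x_1,x_2)\in\mathbb{R}^2: x_2>0\}$. Let $C^\infty_{c,\sigma}(\mathbb{R}^2_+)$ be the set of compactly supported smooth vector fields $\boldsymbol{\varphi}:\mathbb{R}^2_+\to\mathbb{R}^2$ with $\nabla\cdot\boldsymbol{\varphi}=0$. The homogeneous Sobolev space is $\dot H^1(\mathbb{R}^2_+)=\{u\in L^1_{\mathrm{loc}}(\mathbb{R}^2_+):\nabla u\in L^2(\mathbb{R}^2_+)\}$ with semi-norm $\|\nabla u\|_{L^2(\mathbb{R}^2_+)}$. $\dot H^1_{0,\sigma}(\mathbb{R}^2_+)$ denotes the completion of $C^\infty_{c,\sigma}(\mathbb{R}^2_+)$ in $\dot H^1(\mathbb{R}^2_+)\times\dot H^1(\mathbb{R}^2_+)$;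 by Hardy's inequality the semi-norm is a norm on it, and its elements are identified with functions (limits $\boldsymbol v$ of sequences $\boldsymbol\varphi_k\in C^\infty_{c,\sigma}(\mathbb{R}^2_+)$ with $\nabla\boldsymbol\varphi_k\to\nabla\boldsymbol v$ in $L^2$ and $\boldsymbol\varphi_k\to\boldsymbol v$ in $L^2_{\mathrm{loc}}$). Its norm is $\|\nabla\boldsymbol{v}\|_{L^2(\mathbb{R}^2_+)}$. $\mathcal{X}=\big\{\boldsymbol{v}\in\dot H^1_{0,\sigma}(\mathbb{R}^2_+):\int_0^\infty x_2\|\boldsymbol{v}(\cdot,x_2)\|_{L^\infty(\mathbb{R})}^2\,dx_2<\infty\big\}$. $\boldsymbol{u}\otimes\boldsymbol{v}$ is the matrix field with entries $u_iv_j$. *)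

(* Defs.v *)
From HB Require Import structures.
From mathcomp Require Import all_boot all_order all_algebra.
From mathcomp Require Import all_classical all_reals all_analysis.

Set Implicit Arguments.
Unset Strict Implicit.
Unset Printing Implicit Defensive.

Import Order.TTheory GRing.Theory Num.Theory.
Import numFieldNormedType.Exports.

Local Open Scope classical_set_scope.
Local Open Scope ring_scope.

Section HalfPlane.
Context {R : realType}.

(* Points of R^2 are pairs (x_1, x_2); the components i = 1, 2 of fields and
   the directions of differentiation are indexed by 'I_2.  Functions and fields
   on the half-plane are total functions on R * R whose values outside the
   half-plane are never used. *)
Definition half_plane : set (R * R) := [set x | 0 < x.2].

(* The library attaches lebesgue_measure to [measurableTypeR R], i.e. R with its
   Borel sigma-algebra; [plane] is R * R with the corresponding product one. *)
Definition plane := (measurableTypeR R * measurableTypeR R)%type.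

Definition leb2 : {measure set plane -> \bar R} :=
  (lebesgue_measure \x lebesgue_measure)%E.

Definition coord_fun (v : R * R -> 'rV[R]_2) (i : 'I_2) (x : R * R) : R := v x ord0 i.

Definition basis_vec (i : 'I_2) : R * R := if i == ord0 then (1, 0) else (0, 1).

Definition partial (i : 'I_2) (f : R * R -> R) (x : R * R) : R :=
  'D_(basis_vec i) f x.

Definition smooth (f : R * R -> R) : Prop :=
  forall s : seq 'I_2,
    continuous (foldr partial f s) /\
    forall (i : 'I_2) (x : R * R), derivable (foldr partial f s) x (basis_vec i).

Definition fsupport (f : R * R -> R) : set (R * R) := closure [set x | f x != 0].

(* Elements of C_c^oo of the half-plane are extended by zero to R^2. *)
Definition test_function : set (R * R -> R) :=
  [set f | [/\ smooth f, compact (fsupport f) & fsupport f `<=` half_plane]].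

Definition divergence (phi : R * R -> 'rV[R]_2) (x : R * R) : R :=
  \sum_(i < 2) partial i (coord_fun phi i) x.

Definition Cc_sigma : set (R * R -> 'rV[R]_2) :=
  [set phi | (forall i, test_function (coord_fun phi i)) /\
             (forall x, divergence phi x = 0)].

Definition jac (phi : R * R -> 'rV[R]_2) (x : R * R) : 'M[R]_2 :=
  \matrix_(i, j) partial j (coord_fun phi i) x.

Definition frobenius m n (A : 'M[R]_(m, n)) : R :=
  Num.sqrt (\sum_i \sum_j A i j ^+ 2).

Definition L2norm m n (D : set (R * R)) (F : R * R -> 'M[R]_(m, n)) : \bar R :=
  'N[leb2]_2%:E[EFin \o ((fun x => frobenius (F x)) \_ D)]%E.

Definition L2 m n (D : set (R * R)) : set (R * R -> 'M[R]_(m, n)) :=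
  [set F : R * R -> 'M[R]_(m, n) |
     (forall i j, measurable_fun (D : set plane) (fun x : R * R => F x i j)) /\
     (L2norm D F < +oo)%E].

Definition L2_cvg m n (D : set (R * R)) (F_ : nat -> R * R -> 'M[R]_(m, n))
    (F : R * R -> 'M[R]_(m, n)) : Prop :=
  [/\ forall k, L2 D (F_ k), L2 D F &
      (fun k => L2norm D (fun x => F_ k x - F x)) @ \oo --> 0%E].

Definition L2loc_cvg m n (F_ : nat -> R * R -> 'M[R]_(m, n))
    (F : R * R -> 'M[R]_(m, n)) : Prop :=
  forall K : set (R * R), compact K -> K `<=` half_plane -> L2_cvg K F_ F.

(* Same shape as the library's [locally_integrable], which is only available
   for functions of one real variable. *)
Definition L1loc : set (R * R -> R) :=
  [set u : R * R -> R | measurable_fun (half_plane : set plane) u /\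
     forall K : set (R * R), K `<=` half_plane -> compact K ->
       (\int[leb2]_(x in K) `|u x|%:E < +oo)%E].

(* [g] is a version of the distributional gradient of [u]. *)
Definition weak_grad (u : R * R -> R) (g : R * R -> 'rV[R]_2) : Prop :=
  forall j : 'I_2, L1loc (coord_fun g j) /\
    forall psi, test_function psi ->
      \int[leb2]_(x in half_plane) (u x * partial j psi x) =
      - \int[leb2]_(x in half_plane) (coord_fun g j x * psi x).

Definition dotH1 : set (R * R -> R) :=
  [set u | L1loc u /\ exists2 g, weak_grad u g & L2 half_plane g].

Definition weak_jac (v : R * R -> 'rV[R]_2) (G : R * R -> 'M[R]_2) : Prop :=
  forall i : 'I_2, weak_grad (coord_fun v i) (fun x => row i (G x)).

(* Convergence of smooth fields [phi_] to [v] in the norm |grad . |_{L^2}.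
   Weak gradients are unique up to a.e. equality on the half-plane, so the
   choice of [G] is immaterial. *)
Definition dotH1_cvg (phi_ : nat -> R * R -> 'rV[R]_2) (v : R * R -> 'rV[R]_2) :
    Prop :=
  exists2 G, weak_jac v G & L2_cvg half_plane (fun k => jac (phi_ k)) G.

(* The completion of [Cc_sigma], realised as a space of functions: the limits
   of sequences converging both in |grad . |_{L^2} and in L^2_loc. *)
Definition dotH1_0sigma : set (R * R -> 'rV[R]_2) :=
  [set v | (forall i, dotH1 (coord_fun v i)) /\
     exists phi_ : nat -> R * R -> 'rV[R]_2,
       [/\ forall k, Cc_sigma (phi_ k), dotH1_cvg phi_ v & L2loc_cvg phi_ v]].

Definition slice_Loo (v : R * R -> 'rV[R]_2) (x2 : R) : \bar R :=
  'N[lebesgue_measure]_+oo[(fun x1 : R => (frobenius (v (x1, x2)))%:E)]%E.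

Definition space_X : set (R * R -> 'rV[R]_2) :=
  [set v | dotH1_0sigma v /\
     (\int[lebesgue_measure]_(x2 in `]0%R, +oo[)
        (x2%:E * slice_Loo v x2 ^+ 2) < +oo)%E].

Definition tensor (u v : R * R -> 'rV[R]_2) (x : R * R) : 'M[R]_2 :=
  \matrix_(i, j) (coord_fun u i x * coord_fun v j x).

End HalfPlane.

(* Main.v *)
Require Import Defs.
From HB Require Import structures.
From mathcomp Require Import all_boot all_order all_algebra.
From mathcomp Require Import all_classical all_reals all_analysis.
From mathcomp Require Import measurable_realfun ess_sup_inf ring lra.
Import Order.TTheory GRing.Theory Num.Theory.
Import numFieldNormedType.Exports.
Local Open Scope classical_set_scope.
Local Open Scope ring_scope.
Set Implicit Arguments.
Unset Strict Implicit.
Unset Printing Implicit Defensive.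

(** Let phi_k be test fields converging to v.  A divergence free test field is the
    rotated gradient (d2 psi, - d1 psi) of a compactly supported stream function psi_k
    ([exists_stream]).  The approximating fields are the rotated gradients of
    cut e_n (x2) psi_k (x), where k = kap n is chosen large in terms of n, e_n = 1/(n+1), and
    cut e y = exp (- (e ln (1 + y^2))^2) is a cutoff in the logarithm of the height.
    Truncating psi_k rather than phi_k keeps the divergence zero.

    Everything rests on integrals along slices.  A function w vanishing on the boundary
    satisfies int w(x, y)^2 dx <= y |d2 w|^2_{L2} ([slice_le]), hence
    int g(x2) u^2 <= C int y g(y) dy for all u in the completion ([weight_le]).  With
    g = F^2, where F y is the supremum norm of v on the slice of height y, this shows that
    u (x) v is in L2.  A product of u with a general field phi of finite energy is only
    controlled with a decaying weight ([weight2_le]), which says nothing about the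
    convergence of u (x) phi_k; this is why a cutoff is needed.

    The difference of the truncated field and v consists of cut (phi_k - v),
    - (1 - cut) v, and the term (cut' psi_k, 0) from the derivative of the cutoff.  For the first,
    multiplied by u, [weight2_le] with weight cut^2 gives 1/(k+1) times a constant that may
    blow up with n, and the choice of k compensates it.  The second tends to 0 by dominated
    convergence, with F as before.  The third is the heart of the matter.  A general stream
    function satisfies psi^2 <= (y + y^3) E, and the cubic growth would be too much for cut'.
    But psi_k is close to a stream function of v, whose vertical derivative v_1 is
    bounded by F: above any height a, integrating v_1 along vertical lines yields
    psi_k^2 <= 8 delta ln (1 + y^2) + (terms bounded in y for fixed a) + (y + y^3) O(1/(k+1)) with
    delta = int_a^oo y F(y)^2 dy ([stream_growth], [stream_le]).  The logarithmic cutoff is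
    such that int y cut'^2 = O(e) while int y cut'^2 ln (1 + y^2) = O(1); the third term is
    therefore O(delta) in the limit, for all a, and delta tends to 0 as a grows
    ([trunc_tensor_le], [tensor_cvg]).

    For the gradients, the commutator with the cutoff involves cut' phi_k and
    cut'' psi_k, and int y cut'^2 + int y^3 cut''^2 = O(e) ([trunc_grad_le], [grad_cvg]). *)

(** * Smooth functions of two variables *)

Section Smooth.
Context {R : realType}.
Implicit Types (f g : R * R -> R) (h : R -> R) (x y : R) (z : R * R) (i : 'I_2).

Lemma quot1E f x y t :
  (fun h : R => h^-1 *: ((f \o shift (x, y)) (h *: ((1, 0) : R * R)) - f (x, y))) t =
  t^-1 *: (((fun s => f (s, y)) \o shift x) (t *: (1 : R)) - f (x, y)).
Proof. by congr (_ *: (f _ - _)); congr pair; rewrite /= scaler0 add0r. Qed.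

Lemma quot2E f x y t :
  (fun h : R => h^-1 *: ((f \o shift (x, y)) (h *: ((0, 1) : R * R)) - f (x, y))) t =
  t^-1 *: (((fun s => f (x, s)) \o shift y) (t *: (1 : R)) - f (x, y)).
Proof. by congr (_ *: (f _ - _)); congr pair; rewrite /= scaler0 add0r. Qed.

Lemma derivable1E f x y :
  derivable f (x, y) (basis_vec 0) = derivable (fun s => f (s, y)) x 1.
Proof. by rewrite /derivable /basis_vec eqxx (funext (quot1E f x y)). Qed.

Lemma derivable2E f x y :
  derivable f (x, y) (basis_vec 1) = derivable (fun s => f (x, s)) y 1.
Proof. by rewrite /derivable /basis_vec /= (funext (quot2E f x y)). Qed.

Lemma partial1E f x y : partial 0 f (x, y) = 'D_1 (fun s => f (s, y)) x.
Proof. by rewrite /partial /derive /basis_vec eqxx (funext (quot1E f x y)). Qed.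

Lemma partial2E f x y : partial 1 f (x, y) = 'D_1 (fun s => f (x, s)) y.
Proof. by rewrite /partial /derive /basis_vec /= (funext (quot2E f x y)). Qed.

Lemma I2P i : i = 0 \/ i = 1.
Proof. by case: i => -[|[|//]] hi; [left|right]; apply: val_inj. Qed.

(** Smoothness speaks of all words of partial derivatives; products are more easily
    handled by induction on the order of differentiation, for which this is the matching
    notion. *)
Fixpoint Cn (n : nat) f : Prop :=
  continuous f /\ (if n is m.+1 then
    forall i, (forall z, derivable f z (basis_vec i)) /\ Cn m (partial i f)
  else True).

Lemma Cn_continuous n f : Cn n f -> continuous f.
Proof. by case: n => [|n] []. Qed.

Lemma Cn_pred n f : Cn n.+1 f -> Cn n f.
Proof.
elim: n f => [|n IH] f; first by case.
by case=> cf df; split=> // i; case: (df i) => d1 d2; split=> //; apply: IH.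
Qed.

Lemma smooth_partial i f : smooth f -> smooth (partial i f).
Proof. by move=> sf s; have := sf (rcons s i); rewrite foldr_rcons. Qed.

Lemma smoothP f : smooth f <-> forall n, Cn n f.
Proof.
split=> [sf n|Cf s].
  elim: n f sf => [|n IH] f sf; first by have [] := sf [::].
  split; first by have [] := sf [::].
  move=> i; split; first by move=> z; have [_] := sf [::]; apply.
  exact/IH/smooth_partial.
elim/last_ind: s f Cf => [|s i IH] f Cf /=.
  by split=> [|i z]; [case: (Cf 0%N)|case: (Cf 1%N) => _ /(_ i)[+ _]; apply].
rewrite foldr_rcons; apply: IH => n.
by case: (Cf n.+1) => _ /(_ i)[].
Qed.

Lemma CnD n f g : Cn n f -> Cn n g -> Cn n (f + g).
Proof.
elim: n f g => [|n IH] f g [cf df] [cg dg]; split=> //; try by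
  move=> z; apply: continuousD; [exact: cf|exact: cg].
move=> i; have [df1 df2] := df i; have [dg1 dg2] := dg i; split.
  by move=> z; exact: derivableD.
rewrite (_ : partial i _ = partial i f + partial i g); first exact: IH.
by apply/funext => z; rewrite /partial deriveD.
Qed.

Lemma CnM n f g : Cn n f -> Cn n g -> Cn n (f * g).
Proof.
elim: n f g => [|n IH] f g Cf Cg; split=> //; try by
  move=> z; apply: continuousM; apply: Cn_continuous; eassumption.
move=> i; case: (Cf) => cf /(_ i)[df1 df2]; case: (Cg) => cg /(_ i)[dg1 dg2]; split.
  by move=> z; exact: derivableM.
rewrite (_ : partial i _ = f * partial i g + g * partial i f).
  by apply: CnD; apply: IH => //; apply: Cn_pred.
by apply/funext => z; rewrite /partial deriveM.
Qed.

Lemma Cn_cst n (c : R) : Cn n (fun=> c).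
Proof.
elim: n c => [|n IH] c; split=> //; try by move=> z; exact: cst_continuous.
move=> i; split; first by move=> z; exact: derivable_cst.
rewrite (_ : partial i _ = fun=> 0) //.
by apply/funext => z; rewrite /partial derive_cst.
Qed.

Lemma smoothD f g : smooth f -> smooth g -> smooth (f + g).
Proof. by move=> /smoothP sf /smoothP sg; apply/smoothP => n; apply: CnD. Qed.

Lemma smoothM f g : smooth f -> smooth g -> smooth (f * g).
Proof. by move=> /smoothP sf /smoothP sg; apply/smoothP => n; apply: CnM. Qed.

Lemma smooth_cst (c : R) : smooth (fun=> c : R).
Proof. by apply/smoothP => n; exact: Cn_cst. Qed.

Lemma smoothN f : smooth f -> smooth (- f).
Proof.
move=> sf; rewrite (_ : - f = (fun=> -1 : R) * f).
  exact: (@smoothM (fun=> -1) f (smooth_cst _) sf).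
by apply/funext => z; exact/esym/mulN1r.
Qed.

Lemma smoothB f g : smooth f -> smooth g -> smooth (f - g).
Proof. move=> sf sg; exact: (@smoothD f (- g) sf (smoothN sg)). Qed.

Lemma smooth_continuous f : smooth f -> continuous f.
Proof. by move/(_ [::]) => []. Qed.

Lemma smooth_derivable i z f : smooth f -> derivable f z (basis_vec i).
Proof. by move/(_ [::]) => [_]; apply. Qed.

Lemma smooth_of_partials f : continuous f ->
  (forall i z, derivable f z (basis_vec i)) ->
  (forall i, smooth (partial i f)) -> smooth f.
Proof.
move=> cf df spf s; case/lastP: s => [|s i]; first by split.
by rewrite foldr_rcons; exact: spf.
Qed.

Fixpoint Cn1 (n : nat) h : Prop :=
  continuous h /\ (if n is m.+1 then
    (forall x, derivable h x 1) /\ Cn1 m h^`()%classic else True).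

Lemma Cn_snd n h : Cn1 n h -> Cn n (fun z => h z.2).
Proof.
elim: n h => [|n IH] h [ch dh]; split=> //; try by
  move=> z; apply: (@continuous_comp _ _ _ snd h); [exact: cvg_snd|exact: ch].
move: dh => [dh Ch] i; case: (I2P i) => -> {i}; split.
- move=> [x y]; rewrite derivable1E /=; exact: (@derivable_cst _ _ _ (h y) x).
- rewrite (_ : partial 0 _ = fun=> 0); first exact: Cn_cst.
  by apply/funext => -[x y]; rewrite partial1E /= derive_cst.
- move=> [x y]; rewrite derivable2E /=; exact: dh.
- rewrite (_ : partial 1 _ = fun z => h^`()%classic z.2); first exact: IH.
  by apply/funext => -[x y]; rewrite partial2E /= derive1E.
Qed.

End Smooth.

(** * Slicing integrals over the half-plane *)

Section Measure.
Context {R : realType}.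
Local Notation mu := (@lebesgue_measure R).
Local Notation T := (measurableTypeR R).
Local Notation hp := (@half_plane R : set (@plane R)).
Local Notation pos := (`]0%R, +oo[%classic : set T).
Implicit Types (h : @plane R -> \bar R).

(** The plane carries the product of two Borel sigma-algebras; an open set belongs to it
    as a countable union of products of balls with rational centres. *)
Lemma open_measurable_plane (U : set (R * R)) :
  open U -> measurable (U : set (@plane R)).
Proof.
move=> oU.
pose bx (q : rat * rat * nat) : set (R * R) :=
  ball (ratr q.1.1 : R) (q.2.+1%:R^-1) `*` ball (ratr q.1.2 : R) (q.2.+1%:R^-1).
have -> : U = \bigcup_(q in [set q | bx q `<=` U]) bx q.
  apply/seteqP; split; last by move=> z [q qU /qU].
  move=> [x y] Uxy; have /nbhs_ballP[e /= e0 eU] := open_nbhs_nbhs (conj oU Uxy).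
  have [n _ ne] : \forall n \near \oo, n.+1%:R^-1 < e / 2.
    exact: (near_infty_natSinv_lt (PosNum (divr_gt0 e0 (ltr0n R 2)))).
  have {}ne := ne n (leqnn _).
  set d := n.+1%:R^-1 in ne.
  have d0 : 0 < d by rewrite invr_gt0.
  have [p px] := @rat_in_itvoo R (x - d) (x + d) ltac:(lra).
  have [q qy] := @rat_in_itvoo R (y - d) (y + d) ltac:(lra).
  move: px qy; rewrite !in_itv /= => /andP[p1 p2] /andP[q1 q2].
  exists (p, q, n) => /=.
    move=> [a b] [/=]; rewrite /ball /= -/d => H1 H2; apply: eU.
    by split => /=; rewrite /ball /=; move: H1 H2; rewrite !ltr_distl;
      move=> /andP[? ?] /andP[? ?]; apply/andP; split; lra.
  by split => /=; rewrite /ball /= -/d ltr_distl; apply/andP; split; lra.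
rewrite bigcup_mkcond; apply: countable_bigcupT_measurable => [|q]; first exact: countableP.
by case: ifP => // _; apply: measurableX; apply: open_measurable; exact: ball_open.
Qed.

Lemma continuous_measurable_plane (f : R * R -> R) :
  continuous f -> measurable_fun (setT : set (@plane R)) f.
Proof.
move=> /continuousP cf; apply: (measurability _ (RGenOpens.measurableE R)).
by move=> _ [_ [a [b ->]] <-]; rewrite setTI; apply: open_measurable_plane; exact: cf.
Qed.

Lemma half_planeE : hp = setT `*` pos.
Proof. by apply/seteqP; split => [[x y]|[x y] []]; rewrite /half_plane /= in_itv /= andbT. Qed.

Lemma measurable_half_plane : measurable hp.
Proof. by rewrite half_planeE; exact: measurableX. Qed.

Lemma patch_hp h y (x : R) : 0 < y -> (h \_ hp) (x, y) = h (x, y).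
Proof. by move=> y0; rewrite patchE mem_set. Qed.

Lemma patch_hp_meas h : measurable_fun hp h -> measurable_fun setT (h \_ hp).
Proof. by move=> mh; apply/(measurable_restrictT _ measurable_half_plane). Qed.

Lemma patch_hp_ge0 h : (forall z, hp z -> (0 <= h z)%E) ->
  forall z, (0 <= (h \_ hp) z)%E.
Proof. by move=> h0 z; apply: erestrict_ge0. Qed.

Lemma int_rect_swap (A D : set T) h : measurable A -> measurable D ->
  measurable_fun (A `*` D) h -> (forall z, (A `*` D) z -> (0 <= h z)%E) ->
  (\int[leb2]_(z in A `*` D) h z = \int[mu]_(y in D) \int[mu]_(x in A) h (x, y))%E /\
  (\int[leb2]_(z in A `*` D) h z = \int[mu]_(x in A) \int[mu]_(y in D) h (x, y))%E.
Proof.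
move=> mA mD mh h0.
have mp : measurable_fun setT (h \_ (A `*` D)).
  by apply/(measurable_restrictT _ (measurableX mA mD)).
have p0 z : (0 <= (h \_ (A `*` D)) z)%E by apply: erestrict_ge0.
split; rewrite [LHS]integral_mkcond /leb2.
  rewrite (fubini_tonelli2 _ mp p0) [RHS]integral_mkcond; apply: eq_integral => y _.
  rewrite /fubini_G [RHS]patchE; case: ifPn => yD.
    rewrite [RHS]integral_mkcond; apply: eq_integral => x _.
    by rewrite !patchE in_setX yD andbT.
  by apply: integral0_eq => x _; rewrite patchE in_setX (negbTE yD) andbF.
rewrite (fubini_tonelli1 _ mp p0) [RHS]integral_mkcond; apply: eq_integral => x _.
rewrite /fubini_F [RHS]patchE; case: ifPn => xA.
  rewrite [RHS]integral_mkcond; apply: eq_integral => y _.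
  by rewrite !patchE in_setX xA.
by apply: integral0_eq => y _; rewrite patchE in_setX (negbTE xA).
Qed.

Lemma int_hp h : measurable_fun hp h -> (forall z, hp z -> (0 <= h z)%E) ->
  (\int[leb2]_(z in hp) h z = \int[mu]_(y in pos) \int[mu]_x h (x, y))%E.
Proof. by rewrite half_planeE => mh h0; case: (int_rect_swap measurableT _ mh h0). Qed.

Lemma measurable_slice_int h : measurable_fun hp h ->
  (forall z, hp z -> (0 <= h z)%E) ->
  measurable_fun pos (fun y => \int[mu]_x h (x, y))%E.
Proof.
move=> mh h0.
have := @measurable_fun_fubini_tonelli_G _ _ T T R mu (h \_ hp)
  (patch_hp_meas mh) (patch_hp_ge0 h0).
move/(measurable_funS measurableT (@subsetT _ pos)).
apply: eq_measurable_fun => y; rewrite inE /= in_itv /= andbT => y0.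
by apply: eq_integral => x _; rewrite patch_hp.
Qed.

Lemma measurable_vslice_int (D : set T) h : measurable D ->
  measurable_fun (setT `*` D) h -> (forall z, (setT `*` D) z -> (0 <= h z)%E) ->
  measurable_fun (setT : set T) (fun x => \int[mu]_(y in D) h (x, y))%E.
Proof.
move=> mD mh h0.
have mp : measurable_fun setT (h \_ (setT `*` D)).
  by apply/(measurable_restrictT _ (measurableX measurableT mD)).
have p0 z : (0 <= (h \_ (setT `*` D)) z)%E by apply: erestrict_ge0.
have := @measurable_fun_fubini_tonelli_F _ _ T T R mu _ mp p0.
apply: eq_measurable_fun => x _; rewrite /fubini_F [RHS]integral_mkcond.
by apply: eq_integral => y _; rewrite !patchE in_setX in_setT.
Qed.

Lemma measurable_hslice h y : 0 < y -> measurable_fun hp h ->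
  measurable_fun (setT : set T) (fun x => h (x, y)).
Proof.
move=> y0 /patch_hp_meas mh.
have := measurableT_comp mh (@pair2_measurable _ _ T T y).
by apply: eq_measurable_fun => x _ /=; rewrite patch_hp.
Qed.

Lemma measurable_snd_hp (g : R -> \bar R) :
  measurable_fun pos g -> measurable_fun hp (fun z => g z.2).
Proof.
move=> mg; rewrite -[X in measurable_fun _ X]/(g \o snd).
apply: (@measurable_comp _ _ _ _ _ _ pos) => //.
- by move=> _ [[x y] /= y0 <-]; rewrite /= in_itv /= andbT.
- exact: (measurable_funS measurableT (@subsetT _ hp) (@measurable_snd _ _ T T)).
Qed.

End Measure.

(** * Inequalities in one variable *)

Section OneDim.
Context {R : realType}.
Local Notation mu := (@lebesgue_measure R).
Local Notation T := (measurableTypeR R).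
Local Notation pos := (`]0%R, +oo[%classic : set T).
Implicit Types (h : R -> \bar R) (H dH g dg : R -> R) (a b x y : R).

Lemma continuous_sqr (U : topologicalType) (f : U -> R) (z : U) :
  {for z, continuous f} -> {for z, continuous (fun s => f s ^+ 2)}.
Proof. by move=> cf; apply: continuousM. Qed.

(** Integration of a pointwise inequality between H' and h. It stands in for the
    Cauchy-Schwarz inequality in the next lemmas: a square t^2 is the largest of the
    affine expressions 2 c t - c^2, each of which is linear in the derivative, and the
    best c is inserted after integration. *)
Lemma ftc_le H dH h a b : a <= b ->
  (forall x, a <= x <= b -> is_derive x 1 H (dH x)) ->
  (forall x, a <= x <= b -> {for x, continuous dH}) ->
  measurable_fun (`[a, b]%classic : set T) h ->
  (forall x, a <= x <= b -> ((dH x)%:E <= h x)%E) ->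
  (forall x, a <= x <= b -> (0 <= h x)%E) ->
  ((H b - H a)%:E <= \int[mu]_(x in `[a, b]) h x)%E.
Proof.
rewrite le_eqVlt => /predU1P[->|ab] Hd cd mh dh h0.
  by rewrite subrr; apply: integral_ge0 => x /=; rewrite in_itv; exact: h0.
have cw : {within `[a, b], continuous dH}.
  by apply: continuous_in_subspaceT => x; rewrite inE /= in_itv; exact: cd.
have Hc x : a <= x <= b -> {for x, continuous H}.
  by move=> /Hd[Hx _]; exact/differentiable_continuous/derivable1_diffP.
rewrite EFinB -(@continuous_FTC2 R dH H a b ab cw).
- rewrite integralE; set A := (X in (X - _)%E); set B := (X in (_ - X)%E).
  have B0 : (0 <= B)%E by apply: integral_ge0.
  apply: (@le_trans _ _ A).
    by rewrite -[leRHS]sube0; exact: leeB.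
  apply: ge0_le_integral => //.
  + apply: measurable_funepos; apply/measurable_EFinP.
    exact: (subspace_continuous_measurable_fun _ cw).
  + move=> x /=; rewrite in_itv /= => xab.
    by rewrite funeposE ge_max dh ?h0.
- split.
  + by move=> x; rewrite in_itv /= => /andP[/ltW ax /ltW xb]; have [] := Hd x ltac:(by rewrite ax).
  + by apply/cvg_at_right_filter/Hc; rewrite lexx ltW.
  + by apply/cvg_at_left_filter/Hc; rewrite lexx ltW.
- move=> x; rewrite in_itv /= => /andP[/ltW ax /ltW xb].
  by have [_ <-] := Hd x ltac:(by rewrite ax); rewrite derive1E.
Qed.

Lemma integral_ftc_le H dH h (M : R) :
  (forall x, is_derive x 1 H (dH x)) -> continuous dH ->
  measurable_fun pos h -> (forall x, 0 < x -> (0 <= h x)%E) ->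
  (forall x, 0 < x -> (h x <= (dH x)%:E)%E) -> (forall x, 0 <= x -> H x <= M) ->
  (\int[mu]_(x in pos) h x <= (M - H 0)%:E)%E.
Proof.
move=> Hd cd mh h0 hd HM.
have Hc : continuous H.
  by move=> x; have [Hx _] := Hd x; exact/differentiable_continuous/derivable1_diffP.
pose F (n : nat) := `]0%R, (n%:R : R)]%classic.
have FE : \bigcup_n F n = pos.
  apply/seteqP; split => [x [n _]|x]; rewrite /F /= !in_itv /= ?andbT; first by case/andP.
  move=> x0; exists (Num.trunc x).+1 => //=; rewrite in_itv /= x0 /=.
  by rewrite ltW // truncnS_gt.
have mFi i : measurable (F i : set T) by rewrite /F.
have mF i : measurable_fun (F i : set T) h.
  by apply: measurable_funS mh => // x; rewrite /F /= !in_itv /= andbT => /andP[].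
have Fh0 i x : F i x -> (0 <= h x)%E by rewrite /F /= in_itv /= => /andP[x0 _]; exact: h0.
have /cvg_lim <- // : (\int[mu]_(x in F i) h x)%E @[i --> \oo] --> (\int[mu]_(x in pos) h x)%E.
  rewrite -FE; apply: ge0_nondecreasing_set_cvg_integral => //.
  move=> n m nm; apply/subsetPset => x; rewrite /F /= !in_itv /= => /andP[-> xn].
  by rewrite (le_trans xn)// ler_nat.
apply: lime_le.
  apply: ereal_nondecreasing_is_cvgn => n m nm; apply: ge0_subset_integral => //; first exact: Fh0.
  by move=> x; rewrite /F /= !in_itv /= => /andP[-> xn]; rewrite (le_trans xn)// ler_nat.
near=> n.
have n0 : (0 : R) < n%:R by rewrite ltr0n; near: n; exists 1%N.
apply: (@le_trans _ _ (\int[mu]_(x in `[0%R, n%:R]) (dH x)%:E)%E).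
  rewrite -integral_itv_obnd_cbnd; last first.
    apply/measurable_EFinP; apply: measurable_funS (continuous_measurable_fun cd) => //.
  apply: ge0_le_integral => //.
  - exact: Fh0.
  - by apply/measurable_EFinP; apply: measurable_funS (continuous_measurable_fun cd).
  - by move=> x; rewrite /F /= in_itv /= => /andP[x0 _]; exact: hd.
rewrite (@continuous_FTC2 R dH H 0 n%:R n0).
- by rewrite -EFinB lee_fin lerD2r HM // ltW.
- exact: continuous_subspaceT.
- by split; [move=> x _; have [] := Hd x|apply/cvg_at_right_filter/Hc|apply/cvg_at_left_filter/Hc].
- by move=> x _; have [_ <-] := Hd x; rewrite derive1E.
Unshelve. all: by end_near.
Qed.

Lemma is_derive_continuous g dg : (forall x, is_derive x 1 g (dg x)) -> continuous g.
Proof.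
by move=> gd x; have [Hx _] := gd x; exact/differentiable_continuous/derivable1_diffP.
Qed.

Lemma measurable_EFin_continuous (D : set R) g : measurable (D : set T) -> continuous g ->
  measurable_fun (D : set T) (EFin \o g).
Proof.
move=> mD cg; apply/measurable_EFinP.
by apply: measurable_funS (continuous_measurable_fun cg).
Qed.

(** Integrate 2 c g' - c^2 <= g'^2 over [0, y], with c = g(y) / y. *)
Lemma sqr_le_integral_deriv g dg y : (forall x, is_derive x 1 g (dg x)) -> continuous dg ->
  g 0 = 0 -> 0 < y ->
  ((g y ^+ 2)%:E <= y%:E * \int[mu]_(s in `]0%R, y]) (dg s ^+ 2)%:E)%E.
Proof.
move=> gd cdg g0 y0; set c := g y / y.
have cd2 : continuous (fun s => dg s ^+ 2) by move=> s; apply: continuous_sqr; exact: cdg.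
have h1 : ((y^-1 * g y ^+ 2)%:E <= \int[mu]_(s in `[0%R, y]) (dg s ^+ 2)%:E)%E.
  have -> : y^-1 * g y ^+ 2 = (2 * c * g y - c ^+ 2 * y) - (2 * c * g 0 - c ^+ 2 * 0).
    by rewrite g0 /c; field; rewrite gt_eqF.
  apply: (@ftc_le (fun s => 2 * c * g s - c ^+ 2 * s) (fun s => 2 * c * dg s - c ^+ 2)).
  - exact: ltW.
  - by move=> x _; apply: is_derive_eq; rewrite /GRing.scale /=; ring.
  - move=> x _; apply: continuousB; last exact: cst_continuous.
    by apply: continuousM; [exact: cst_continuous|exact: cdg].
  - by apply: measurable_EFin_continuous.
  - move=> x _; rewrite lee_fin -subr_ge0.
    by rewrite (_ : _ - _ = (dg x - c) ^+ 2) ?sqr_ge0//; ring.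
  - by move=> x _; rewrite lee_fin sqr_ge0.
have {h1} h2 : ((y^-1 * g y ^+ 2)%:E <= \int[mu]_(s in `]0%R, y]) (dg s ^+ 2)%:E)%E.
  by rewrite integral_itv_obnd_cbnd//; exact: measurable_EFin_continuous.
have -> : (g y ^+ 2)%:E = (y%:E * (y^-1 * g y ^+ 2)%:E)%E.
  by rewrite -EFinM mulrA divff ?mul1r// gt_eqF.
by apply: lee_wpmul2l => //; rewrite lee_fin ltW.
Qed.

(** Integrate 2 c g' - c^2 / s <= s g'^2 over [a, y], with c = (g(y) - g(a)) / (ln y -
    ln a). The weight s makes the growth of g logarithmic. *)
Lemma sqrB_le_integral_deriv g dg a y : (forall x, is_derive x 1 g (dg x)) -> continuous dg ->
  0 < a -> a < y ->
  (((g y - g a) ^+ 2)%:E <=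
     (ln y - ln a)%:E * \int[mu]_(s in `[a, y]) (s * dg s ^+ 2)%:E)%E.
Proof.
move=> gd cdg a0 ay.
have l0 : 0 < ln y - ln a by rewrite subr_gt0 ltr_ln// posrE (lt_trans a0).
set l := ln y - ln a in l0 *; set c := (g y - g a) / l.
have h1 : ((l^-1 * (g y - g a) ^+ 2)%:E <= \int[mu]_(s in `[a, y]) (s * dg s ^+ 2)%:E)%E.
  have -> : l^-1 * (g y - g a) ^+ 2 =
      (2 * c * g y - c ^+ 2 * ln y) - (2 * c * g a - c ^+ 2 * ln a).
    rewrite (_ : ln y = l + ln a); last by rewrite /l subrK.
    by rewrite /c; field; rewrite gt_eqF.
  apply: (@ftc_le (fun s => 2 * c * g s - c ^+ 2 * ln s) (fun s => 2 * c * dg s - c ^+ 2 * s^-1)).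
  - exact: ltW.
  - move=> x /andP[ax xy]; have x0 : 0 < x by apply: lt_le_trans ax.
    have := is_derive1_ln x0 => ?.
    by apply: is_derive_eq; rewrite /GRing.scale /=; ring.
  - move=> x /andP[ax xy]; have x0 : x != 0 by rewrite gt_eqF// (lt_le_trans a0).
    apply: continuousB; apply: continuousM; try exact: cst_continuous; first exact: cdg.
    exact: inv_continuous.
  - have cm : continuous (fun s : R => s * dg s ^+ 2).
      by move=> x; apply: (@continuousM _ _ (id : R -> R) (fun s => dg s ^+ 2));
        [exact: cvg_id|exact/continuous_sqr/cdg].
    exact: measurable_EFin_continuous cm.
  - move=> x /andP[ax xy]; have x0 : 0 < x by apply: lt_le_trans ax.
    rewrite lee_fin -subr_ge0.
    rewrite (_ : _ - _ = x * (dg x - c / x) ^+ 2); first by rewrite mulr_ge0 ?sqr_ge0// ltW.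
    by field; rewrite gt_eqF.
  - by move=> x /andP[ax xy]; rewrite lee_fin mulr_ge0 ?sqr_ge0// (le_trans _ ax)// ltW.
have -> : ((g y - g a) ^+ 2)%:E = (l%:E * (l^-1 * (g y - g a) ^+ 2)%:E)%E.
  by rewrite -EFinM mulrA divff ?mul1r// gt_eqF.
by apply: lee_wpmul2l => //; rewrite lee_fin ltW.
Qed.

(** The derivative 2 g g' of g^2 is at most g^2 + g'^2, and g vanishes at p. *)
Lemma sqr_le_integral_sobolev g dg p x : (forall x, is_derive x 1 g (dg x)) -> continuous dg ->
  (forall t, t <= p -> g t = 0) ->
  ((g x ^+ 2)%:E <= \int[mu]_s (g s ^+ 2)%:E + \int[mu]_s (dg s ^+ 2)%:E)%E.
Proof.
move=> gd cdg gp; have cg := is_derive_continuous gd.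
have c2 : continuous (fun s => g s ^+ 2) by move=> s; apply: continuous_sqr; exact: cg.
have cd2 : continuous (fun s => dg s ^+ 2) by move=> s; apply: continuous_sqr; exact: cdg.
rewrite -ge0_integralD//; first last.
- exact: measurable_EFin_continuous.
- by move=> s _; rewrite lee_fin sqr_ge0.
- exact: measurable_EFin_continuous.
- by move=> s _; rewrite lee_fin sqr_ge0.
under eq_integral do rewrite -EFinD.
have [xp|px] := leP x p.
  by rewrite (gp _ xp) expr0n /=; apply: integral_ge0 => s _; rewrite lee_fin addr_ge0 ?sqr_ge0.
have ms : continuous (fun s => g s ^+ 2 + dg s ^+ 2).
  by move=> s; apply: cvgD; [exact: c2|exact: cd2].
apply: (@le_trans _ _ (\int[mu]_(s in `[p, x]) (g s ^+ 2 + dg s ^+ 2)%:E)%E).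
  rewrite (_ : g x ^+ 2 = g x ^+ 2 - g p ^+ 2); last by rewrite (gp p)// expr0n subr0.
  apply: (@ftc_le (fun s => g s ^+ 2) (fun s => 2 * g s * dg s)).
  - exact: ltW.
  - by move=> t _; apply: is_derive_eq; rewrite /GRing.scale /=; ring.
  - move=> t _; apply: continuousM; last exact: cdg.
    by apply: continuousM; [exact: cst_continuous|exact: cg].
  - by apply: measurable_EFin_continuous.
  - move=> t _; rewrite lee_fin -subr_ge0.
    by rewrite (_ : _ - _ = (g t - dg t) ^+ 2) ?sqr_ge0//; ring.
  - by move=> t _; rewrite lee_fin addr_ge0 ?sqr_ge0.
apply: ge0_subset_integral => //.
  exact: measurable_EFin_continuous.
by move=> t _; rewrite lee_fin addr_ge0 ?sqr_ge0.
Qed.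

(** Were g x > C, the mean of g over a small interval around x would exceed C. *)
Lemma le_of_mean_le g (C : R) x : continuous g ->
  (forall p q, p < q -> (\int[mu]_(t in `[p, q]) (g t)%:E <= (C * (q - p))%:E)%E) -> g x <= C.
Proof.
move=> cg gC; rewrite leNgt; apply/negP => Cx.
set m := (g x + C) / 2.
have [Cm mg] : C < m /\ m < g x by rewrite /m; split; lra.
have /nbhs_ballP[e /= e0 eb] : \forall t \near x, m < g t.
  by have /cvgrPdist_lt /(_ (g x - m)) := cg x; rewrite subr_gt0 => /(_ mg);
    apply: filterS => t; rewrite ltr_distl => /andP[]; lra.
have := gC (x - e / 2) (x + e / 2) ltac:(lra).
apply/negP; rewrite -ltNge.
apply: (@lt_le_trans _ _ (m * (x + e / 2 - (x - e / 2)))%:E).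
  by rewrite lte_fin ltr_pM2r//; lra.
set a := x - _; set b := x + _.
have -> : (m * (b - a))%:E = (\int[mu]_(t in `[a, b]) m%:E)%E.
  rewrite integral_cst//= lebesgue_measure_itv /= lte_fin.
  by rewrite ifT /a /b; [rewrite -EFinB -EFinM|lra].
apply: le_integral => //.
- apply/integrableP; split; first exact: measurable_EFin_continuous _ (@cst_continuous _ _ m).
  under eq_integral do rewrite /=.
  by rewrite integral_cst//= lebesgue_measure_itv /=; case: ifP => _; rewrite ?mule0 ?ltry// -EFinB -EFinM ltry.
- apply: continuous_compact_integrable; first exact: segment_compact.
  exact: continuous_subspaceT.
- move=> t; rewrite inE /= in_itv /= => /andP[at_ tb].
  rewrite lee_fin ltW// eb// /ball /= ltr_distl; apply/andP; rewrite /a /b in at_ tb; split; lra.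
Qed.

End OneDim.

(** * Test functions on horizontal slices *)

Section Slices.
Context {R : realType}.
Local Notation mu := (@lebesgue_measure R).
Local Notation T := (measurableTypeR R).
Local Notation hp := (@half_plane R : set (@plane R)).
Local Notation pos := (`]0%R, +oo[%classic : set T).
Local Notation d1 := (partial 0%R).
Local Notation d2 := (partial 1%R).
Implicit Types (f g w psi : R * R -> R) (x y B : R) (z : R * R).

Definition sqint w : \bar R := (\int[leb2]_(z in hp) (w z ^+ 2)%:E)%E.

(** Boxes with a single parameter, increasing in B, which exhaust the half-plane by
    compact sets. *)
Definition box B : set (R * R) := `[- B, B]%classic `*` `[B^-1, B]%classic.

Definition boxed f := exists2 B, 0 < B & forall z, ~ box B z -> f z = 0.

Definition csmooth f := smooth f /\ boxed f.

Lemma box_compact B : compact (box B).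
Proof. by apply: compact_setX; exact: segment_compact. Qed.

Lemma box_closed B : closed (box B).
Proof.
apply: compact_closed; last exact: box_compact.
exact: norm_hausdorff.
Qed.

Lemma box_hp B : 0 < B -> box B `<=` hp.
Proof.
move=> B0 [x y] [_ /=]; rewrite in_itv /= => /andP[By _].
by rewrite /half_plane /=; apply: lt_le_trans By; rewrite invr_gt0.
Qed.

Lemma le_box B B' : 0 < B -> B <= B' -> box B `<=` box B'.
Proof.
move=> B0 BB [x y] [/=]; rewrite !in_itv /= => /andP[x1 x2] /andP[y1 y2].
split; rewrite /= in_itv /=; apply/andP; split; try lra.
by apply: le_trans y1; rewrite lef_pV2 ?posrE//; apply: lt_le_trans BB.
Qed.

Lemma compact_sub_box (K : set (R * R)) : compact K -> K `<=` half_plane ->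
  exists2 B, 0 < B & K `<=` box B.
Proof.
move=> cK Khp.
have /compact_bounded/pinfty_ex_gt0[M M0 KM] := cK.
have /compact_bounded/pinfty_ex_gt0[N N0 KN] : compact ((fun z : R * R => z.2^-1) @` K).
  apply: continuous_compact => //; apply: continuous_in_subspaceT => z; rewrite inE => /Khp z0.
  by apply: cvgV; [rewrite gt_eqF|exact: cvg_snd].
exists (Num.max M N); first by rewrite lt_max M0.
move=> [x y] Kz; have y0 : 0 < y := Khp _ Kz.
have := KM _ Kz; rewrite /= prod_normE /= ge_max => /andP[xM yM].
have := KN y^-1 ltac:(by exists (x, y)); rewrite /= ger0_norm ?invr_ge0 ?(ltW y0)// => yN.
split; rewrite /= in_itv /=.
  by rewrite -ler_norml le_max xM.
rewrite (le_trans (ler_norm y)) ?le_max ?yM// andbT.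
by rewrite -[leRHS]invrK lef_pV2 ?posrE ?invr_gt0 ?lt_max ?M0// le_max yN orbT.
Qed.

Lemma test_functionP f : test_function f <-> csmooth f.
Proof.
split=> [[sf cf /(compact_sub_box cf)[B B0 fB]]|[sf [B B0 fB]]].
  split=> //; exists B => // z zB; apply/eqP/negPn/negP => fz.
  by apply/zB/fB/subset_closure.
have fsB : fsupport f `<=` box B.
  rewrite [X in _ `<=` X](closure_id _).1; last exact: box_closed.
  by apply: closure_subset => z /eqP fz; apply: contrapT => /fB.
split=> //; last exact: subset_trans (box_hp B0).
by apply: subclosed_compact fsB; [exact: closed_closure|exact: box_compact].
Qed.

Lemma boxed_partial i f : boxed f -> boxed (partial i f).
Proof.
move=> [B B0 fB]; exists B => // z zB.
rewrite /partial (@near_eq_derive _ _ _ f (fun=> 0)) ?derive_cst//.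
have : open (~` box B) by rewrite openC; exact: box_closed.
rewrite openE => /(_ z zB); rewrite /interior; apply: filterS => t; exact: fB.
Qed.

Lemma csmooth_partial i f : csmooth f -> csmooth (partial i f).
Proof. by move=> [sf bf]; split; [exact: smooth_partial|exact: boxed_partial]. Qed.

Lemma csmoothB f g : csmooth f -> csmooth g -> csmooth (f - g).
Proof.
move=> [sf [B B0 fB]] [sg [C C0 gC]]; split; first exact: smoothB.
exists (Num.max B C); first by rewrite lt_max B0.
move=> z zBC; rewrite /GRing.add /GRing.opp /= fB ?gC ?subrr//.
  by apply: contra_not zBC; apply: le_box; rewrite ?le_max ?lexx ?orbT.
by apply: contra_not zBC; apply: le_box; rewrite ?le_max ?lexx ?orbT.
Qed.

Lemma csmooth_mul f g : smooth f -> csmooth g -> csmooth (f * g).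
Proof.
move=> sf [sg [B B0 gB]]; split; first exact: smoothM.
by exists B => // z zB; rewrite /GRing.mul /= gB ?mulr0.
Qed.

Lemma continuous_hslice f y : continuous f -> continuous (fun t => f (t, y)).
Proof.
move=> cf x; apply: (@continuous_comp _ _ _ (fun t => (t, y)) f); last exact: cf.
exact: (@cvg_pair _ _ _ (nbhs x) (nbhs x) (nbhs y) _ _ _ id (fun=> y) cvg_id (cvg_cst _)).
Qed.

Lemma continuous_vslice f x : continuous f -> continuous (fun t => f (x, t)).
Proof.
move=> cf y; apply: (@continuous_comp _ _ _ (fun t => (x, t)) f); last exact: cf.
exact: (@cvg_pair _ _ _ (nbhs y) (nbhs x) (nbhs y) _ _ _ (fun=> x) id (cvg_cst _) cvg_id).
Qed.

Lemma is_derive_hslice f y x : smooth f ->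
  is_derive x 1 (fun t => f (t, y)) (d1 f (x, y)).
Proof.
move=> sf; rewrite partial1E; apply: derivableP.
by rewrite -derivable1E; exact: smooth_derivable.
Qed.

Lemma is_derive_vslice f x y : smooth f ->
  is_derive y 1 (fun t => f (x, t)) (d2 f (x, y)).
Proof.
move=> sf; rewrite partial2E; apply: derivableP.
by rewrite -derivable2E; exact: smooth_derivable.
Qed.

Lemma measurable_sqr (D : set (@plane R)) f : measurable_fun D f ->
  measurable_fun D (fun z => (f z ^+ 2)%:E).
Proof. by move=> mf; apply/measurable_EFinP; exact: measurable_funX. Qed.

Lemma measurable_continuous_hp f : continuous f -> measurable_fun hp f.
Proof.
move=> cf; apply: (measurable_funS measurableT (@subsetT _ hp)).
exact: continuous_measurable_plane.
Qed.

Lemma measurable_sqr_hp f : continuous f -> measurable_fun hp (fun z => (f z ^+ 2)%:E).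
Proof. by move=> cf; apply: measurable_sqr; exact: measurable_continuous_hp. Qed.

Lemma boxed_bottom f x y : boxed f -> y <= 0 -> f (x, y) = 0.
Proof. by move=> [B B0 fB] y0; apply: fB => /(box_hp B0); rewrite /half_plane /= ltNge y0. Qed.

Lemma sqr_ge0E (c : R) : (0 <= (c ^+ 2)%:E)%E.
Proof. by rewrite lee_fin sqr_ge0. Qed.

(** Vertical lines start from the value 0 at the boundary, so that sqr_le_integral_deriv
    holds on each of them; the integrals in the two variables are then exchanged. *)
Lemma slice_sqr_le w y : csmooth w -> 0 < y ->
  (\int[mu]_x (w (x, y) ^+ 2)%:E <=
   y%:E * \int[mu]_(s in `]0%R, y]) \int[mu]_x (d2 w (x, s) ^+ 2)%:E)%E.
Proof.
move=> cw y0; have sw := cw.1; have cpw := smooth_continuous (smooth_partial 1 sw).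
have mp : measurable_fun hp (fun z => (d2 w z ^+ 2)%:E).
  exact: measurable_sqr_hp.
have sub : setT `*` `]0%R, y]%classic `<=` hp.
  by move=> [a b] [_ /=]; rewrite in_itv /= => /andP[].
have mp' := measurable_funS measurable_half_plane sub mp.
have [<- ->] := int_rect_swap measurableT (measurable_itv `]0, y]) mp' (fun z _ => sqr_ge0E _).
have mc : measurable_fun (setT : set T)
    (fun x => \int[mu]_(s in `]0%R, y]) (d2 w (x, s) ^+ 2)%:E)%E.
  exact: (measurable_vslice_int (measurable_itv `]0, y]) mp' (fun z _ => sqr_ge0E _)).
rewrite -ge0_integralZl//; first last.
- by rewrite lee_fin ltW.
- by move=> x _; apply: integral_ge0 => s _; exact: sqr_ge0E.
apply: ge0_le_integral => //.
- by move=> x _; exact: sqr_ge0E.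
- apply: (@measurable_hslice _ (fun z => (w z ^+ 2)%:E)) => //.
  exact: (measurable_sqr_hp (smooth_continuous cw.1)).
- exact: measurable_funeM.
move=> x _.
apply: (@sqr_le_integral_deriv _ (fun s => w (x, s)) (fun s => d2 w (x, s))) => //.
- by move=> s; exact: is_derive_vslice.
- exact: continuous_vslice.
- exact: (boxed_bottom _ cw.2).
Qed.

(** The substitute for Hardy's inequality: every slice is controlled, with a factor
    linear in its height, by the vertical part of the Dirichlet norm. *)
Lemma slice_le w y : csmooth w -> 0 < y ->
  (\int[mu]_x (w (x, y) ^+ 2)%:E <= y%:E * sqint (d2 w))%E.
Proof.
move=> cw y0; apply: (le_trans (slice_sqr_le cw y0)).
have mp : measurable_fun hp (fun z => (d2 w z ^+ 2)%:E).
  exact: (measurable_sqr_hp (smooth_continuous (smooth_partial 1 cw.1))).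
apply: lee_wpmul2l => //; first by rewrite lee_fin ltW.
rewrite /sqint (int_hp mp) => [|z _]; last exact: sqr_ge0E.
apply: ge0_subset_integral => //.
- exact: (measurable_slice_int mp (fun z _ => sqr_ge0E _)).
- by move=> s _; apply: integral_ge0 => x _; exact: sqr_ge0E.
- by move=> s /=; rewrite !in_itv /= andbT => /andP[].
Qed.

Lemma sup_slice_le w x y : csmooth w ->
  ((w (x, y) ^+ 2)%:E <=
   \int[mu]_t (w (t, y) ^+ 2)%:E + \int[mu]_t (d1 w (t, y) ^+ 2)%:E)%E.
Proof.
move=> [sw [B B0 wB]].
apply: (@sqr_le_integral_sobolev _ (fun t => w (t, y)) (fun t => d1 w (t, y)) (- B - 1)).
- by move=> t; exact: is_derive_hslice.
- exact/continuous_hslice/smooth_continuous/smooth_partial.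
- move=> t tB; apply: wB => -[/=]; rewrite in_itv /= => /andP[]; lra.
Qed.

(** slice_le for the velocity d2 psi, integrated once more in height by slice_sqr_le. *)
Lemma stream_slice_le psi y (E : R) : csmooth psi -> 0 < y ->
  (sqint (d2 (d2 psi)) <= E%:E)%E ->
  (\int[mu]_x (psi (x, y) ^+ 2)%:E <= (E * y ^+ 3)%:E)%E.
Proof.
move=> cp y0 E1; apply: (le_trans (slice_sqr_le cp y0)).
have E_ge0 : 0 <= E by rewrite -lee_fin; apply: le_trans E1; apply: integral_ge0 => z _; exact: sqr_ge0E.
rewrite [E * _]mulrC exprS -mulrA EFinM; apply: lee_wpmul2l => //; first by rewrite lee_fin ltW.
apply: (@le_trans _ _ (\int[mu]_(s in `]0%R, y]) (y * E)%:E)%E).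
  apply: ge0_le_integral => //.
  - by move=> s _; apply: integral_ge0 => t _; exact: sqr_ge0E.
  - have sub : `]0%R, y]%classic `<=` pos.
      by move=> s /=; rewrite !in_itv /= andbT => /andP[].
    apply: (measurable_funS _ sub) => //.
    apply: (@measurable_slice_int _ (fun z => (d2 psi z ^+ 2)%:E)) => [|z _]; last exact: sqr_ge0E.
    exact: (measurable_sqr_hp (smooth_continuous (smooth_partial 1 cp.1))).
  - move=> s /=; rewrite in_itv /= => /andP[s0 sy].
    apply: (le_trans (slice_le (csmooth_partial 1 cp) s0)).
    rewrite EFinM; apply: (@le_trans _ _ (s%:E * E%:E)%E).
      by apply: (lee_wpmul2l _ E1); rewrite lee_fin (ltW s0).
    by rewrite -!EFinM lee_fin ler_wpM2r.
rewrite integral_cst//= lebesgue_measure_itv /= lte_fin y0 -EFinB -EFinM lee_fin.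
by rewrite expr2 subr0; lra.
Qed.

(** The one-dimensional Sobolev inequality on the slice, where psi costs y^3 and d1 psi
    costs y. *)
Lemma stream_sup_le psi x y (E : R) : csmooth psi -> 0 < y ->
  (sqint (d2 (d2 psi)) <= E%:E)%E ->
  (sqint (d2 (d1 psi)) <= E%:E)%E ->
  psi (x, y) ^+ 2 <= (y + y ^+ 3) * E.
Proof.
move=> cp y0 E1 E0; rewrite -lee_fin.
apply: (le_trans (sup_slice_le x y cp)).
rewrite [y + _]addrC mulrDl EFinD; apply: leeD.
  by rewrite mulrC; exact: stream_slice_le.
apply: (le_trans (slice_le (csmooth_partial 0 cp) y0)).
by rewrite EFinM; apply: (lee_wpmul2l _ E0); rewrite lee_fin ltW.
Qed.

End Slices.

(** * Weighted bounds in terms of the gradient *)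

Section Weights.
Context {R : realType}.
Local Notation mu := (@lebesgue_measure R).
Local Notation T := (measurableTypeR R).
Local Notation hp := (@half_plane R : set (@plane R)).
Local Notation pos := (`]0%R, +oo[%classic : set T).
Local Notation d1 := (partial 0%R).
Local Notation d2 := (partial 1%R).
Implicit Types (G f w u phi psi : R * R -> R) (g : R -> R) (x y B : R) (z : R * R).

Definition loc_cvg (w : nat -> R * R -> R) u := forall B e, 0 < B -> 0 < e ->
  \forall k \near \oo, (\int[leb2]_(z in box B) ((w k z - u z) ^+ 2)%:E <= e%:E)%E.

Lemma csmooth_meas f : csmooth f -> measurable_fun hp f.
Proof. by move=> [sf _]; exact: (measurable_continuous_hp (smooth_continuous sf)). Qed.

Lemma measurable_box B : measurable (box B : set (@plane R)).
Proof. by apply: measurableX. Qed.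

(** Lower semicontinuity of weighted L2 norms under L2_loc convergence. On the part F n
    of a box where G <= n, one has u^2 <= (1 + eta) w^2 + (1 + 1/eta) (w - u)^2, where
    the last term has a small integral for late w; the sets F n exhaust the half-plane.
    *)
Lemma integral_le_of_loc_cvg G (w : nat -> R * R -> R) u (c : nat -> R) (c0 : R) :
  measurable_fun hp G -> (forall z, hp z -> 0 <= G z) ->
  (forall k, measurable_fun hp (w k)) -> measurable_fun hp u -> loc_cvg w u ->
  (forall k, (\int[leb2]_(z in hp) (G z * w k z ^+ 2)%:E <= (c k)%:E)%E) ->
  c @ \oo --> c0 ->
  (\int[leb2]_(z in hp) (G z * u z ^+ 2)%:E <= c0%:E)%E.
Proof.
move=> mG G0 mw muu wu Gc cc0.
have mGu f : measurable_fun hp f -> measurable_fun hp (fun z => (G z * f z ^+ 2)%:E).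
  by move=> mf; apply/measurable_EFinP; apply: measurable_funM => //; exact: measurable_funX.
have Gu0 f z : hp z -> (0 <= (G z * f z ^+ 2)%:E)%E.
  by move=> /G0 Gz; rewrite lee_fin mulr_ge0// sqr_ge0.
pose F (n : nat) : set (@plane R) := box n.+1%:R `&` [set z | G z <= n%:R].
have Fhp n : F n `<=` hp by move=> z [Bz _]; exact: (box_hp (ltr0Sn R n) Bz).
have FE : \bigcup_n F n = hp.
  apply/seteqP; split => [z [n _ /Fhp]//|z z0].
  have [B B0 Bz] : exists2 B, 0 < B & box B z.
    have [|B B0 /(_ z erefl) Bz] := @compact_sub_box R [set z] (@compact_set1 _ _); last by exists B.
    by move=> _ ->.
  exists (maxn (Num.trunc B).+1 (Num.trunc (G z)).+1) => //; split.
    apply: (le_box B0 _ Bz); apply: (le_trans (ltW (truncnS_gt B))).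
    by rewrite ler_nat ltnW// ltnS leq_max leqnn.
  by apply: (le_trans (ltW (truncnS_gt (G z)))); rewrite ler_nat leq_max leqnn orbT.
have mF n : measurable (F n).
  have -> : F n = box n.+1%:R `&` (hp `&` [set z | G z <= n%:R]).
    apply/seteqP; split => [z [Bz Gz]|z [Bz [_ Gz]]] //; split => //; split => //.
    exact: (box_hp (ltr0Sn R n) Bz).
  apply: measurableI; first exact: measurable_box.
  have := mG measurable_half_plane `]-oo, n%:R]%classic (measurable_itv _).
  by congr (measurable (_ `&` _)); apply/seteqP; split => z /=; rewrite in_itv.
have -> : (\int[leb2]_(z in hp) (G z * u z ^+ 2)%:E =
    limn (fun n => \int[leb2]_(z in F n) (G z * u z ^+ 2)%:E))%E.
  apply/esym/cvg_lim => //; rewrite -FE; apply: ge0_nondecreasing_set_cvg_integral => //.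
  - move=> n m nm; apply/subsetPset => z [Bz Gz]; split.
      by apply: (le_box _ _ Bz); rewrite ?ltr0n// ler_nat.
    by apply: le_trans Gz _; rewrite ler_nat.
  - by move=> n; exact: (measurable_funS measurable_half_plane (Fhp n) (mGu _ muu)).
  - by move=> n z /Fhp; exact: Gu0.
have c0_ge0 : 0 <= c0.
  have c_ge0 k : 0 <= c k.
    by rewrite -lee_fin; apply: le_trans (Gc k); apply: integral_ge0 => z; exact: Gu0.
  rewrite -(cvg_lim _ cc0)//; apply: limr_ge; first by apply/cvg_ex; exists c0.
  exact: nearW.
apply: lime_le.
  apply: ereal_nondecreasing_is_cvgn => n m nm; apply: ge0_subset_integral => //.
  - exact: (measurable_funS measurable_half_plane (Fhp m) (mGu _ muu)).
  - by move=> z /Fhp; exact: Gu0.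
  - move=> z [Bz Gz]; split; first by apply: (le_box _ _ Bz); rewrite ?ltr0n// ler_nat.
    by apply: le_trans Gz _; rewrite ler_nat.
apply: nearW => n; apply/lee_addgt0Pr => d d0; rewrite -EFinD.
(* The excess d is shared between the three errors: that of c k, the factor 1 + eta, and
   the distance of w k to u. *)
set d' := Num.min 1 (d / 3); set eta := d / (3 * (c0 + 1)).
have d'0 : 0 < d' by rewrite lt_min ltr01 divr_gt0.
have eta0 : 0 < eta by rewrite divr_gt0// mulr_gt0// ltr_wpDl.
set e := d / 3 / ((1 + eta^-1) * n.+1%:R).
have i0 : 0 < 1 + eta^-1 by rewrite addr_gt0// invr_gt0.
have e0 : 0 < e by rewrite divr_gt0 ?divr_gt0 ?mulr_gt0.
have [k [ck wk]] : exists k, c k <= c0 + d' /\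
    (\int[leb2]_(z in box n.+1%:R) ((w k z - u z) ^+ 2)%:E <= e%:E)%E.
  have H1 : \forall k \near \oo, c k <= c0 + d'.
    move/cvgrPdist_le : cc0 => /(_ _ d'0); apply: filterS => k.
    by rewrite ler_distlC => /andP[].
  have H2 := wu n.+1%:R e (ltr0Sn _ _) e0.
  by have [k _ H] := filterI H1 H2; exists k; exact: (H k (leqnn k)).
have mwu : measurable_fun hp (fun z => ((w k z - u z) ^+ 2)%:E).
  by apply: measurable_sqr; exact: measurable_funB.
have wk' : (\int[leb2]_(z in F n) ((w k z - u z) ^+ 2)%:E <= e%:E)%E.
  apply: le_trans wk; apply: ge0_subset_integral => //; first exact: measurable_box.
  - by apply: measurable_funS mwu => //; [exact: measurable_half_plane|exact: (box_hp (ltr0Sn R n))].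
  - by move=> z _; exact: sqr_ge0E.
  - by move=> z [].
have Gk' : (\int[leb2]_(z in F n) (G z * w k z ^+ 2)%:E <= (c k)%:E)%E.
  apply: le_trans (Gc k); apply: ge0_subset_integral => //; first exact: measurable_half_plane.
  - exact: mGu.
  - by move=> z; exact: Gu0.
apply: (@le_trans _ _ ((1 + eta)%:E * \int[leb2]_(z in F n) (G z * w k z ^+ 2)%:E +
    ((1 + eta^-1) * n.+1%:R)%:E * \int[leb2]_(z in F n) ((w k z - u z) ^+ 2)%:E)%E).
  have mF1 := measurable_funS measurable_half_plane (Fhp n) (mGu _ (mw k)).
  have mF2 := measurable_funS measurable_half_plane (Fhp n) mwu.
  rewrite -ge0_integralZl//; last 2 first.
  - by move=> z /Fhp; exact: Gu0.
  - by rewrite lee_fin addr_ge0// ltW.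
  rewrite -ge0_integralZl//; last 2 first.
  - by move=> z _; exact: sqr_ge0E.
  - by rewrite lee_fin mulr_ge0// ltW.
  rewrite -ge0_integralD//; last 4 first.
  - by move=> z /Fhp zh; rewrite mule_ge0 ?Gu0// lee_fin addr_ge0// ltW.
  - exact: measurable_funeM.
  - by move=> z _; rewrite mule_ge0 ?sqr_ge0E// lee_fin mulr_ge0// ltW.
  - exact: measurable_funeM.
  apply: ge0_le_integral => //.
  - by move=> z /Fhp; exact: Gu0.
  - exact: (measurable_funS measurable_half_plane (Fhp n) (mGu _ muu)).
  - by apply: emeasurable_funD; exact: measurable_funeM.
  move=> z Fz; have Gz := G0 _ (Fhp _ _ Fz); case: Fz => _ /= Gn.
  rewrite -!EFinM -EFinD lee_fin.
  set a := w k z; set b := u z.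
  have ab : b ^+ 2 <= (1 + eta) * a ^+ 2 + (1 + eta^-1) * (a - b) ^+ 2.
    rewrite -subr_ge0 (_ : _ - _ = eta^-1 * (eta * a + (a - b)) ^+ 2); last first.
      by field; rewrite gt_eqF.
    by rewrite mulr_ge0 ?sqr_ge0// invr_ge0 ltW.
  apply: (le_trans (ler_wpM2l Gz ab)); rewrite mulrDr.
  apply: lerD; first by rewrite mulrCA.
  rewrite mulrA; apply: ler_wpM2r; first exact: sqr_ge0.
  rewrite mulrC; apply: ler_wpM2l; first exact: ltW.
  by apply: (le_trans Gn); rewrite ler_nat.
apply: (@le_trans _ _ ((1 + eta)%:E * (c k)%:E + ((1 + eta^-1) * n.+1%:R)%:E * e%:E)%E).
  apply: leeD; first by apply: (lee_wpmul2l _ Gk'); rewrite lee_fin addr_ge0// ltW.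
  by apply: (lee_wpmul2l _ wk'); rewrite lee_fin mulr_ge0// ltW.
rewrite -!EFinM -EFinD lee_fin.
have -> : (1 + eta^-1) * n.+1%:R * e = d / 3.
  by rewrite /e mulrC divfK// gt_eqF// mulr_gt0.
have H1 : (1 + eta) * c k <= (1 + eta) * (c0 + d') by rewrite ler_wpM2l// addr_ge0// ltW.
have H2 : eta * (c0 + d') <= eta * (c0 + 1).
  by rewrite ler_wpM2l ?(ltW eta0)// lerD2l ge_min lexx.
have H3 : eta * (c0 + 1) = d / 3.
  by rewrite /eta; field; rewrite gt_eqF// ltr_wpDl.
have H4 : d' <= d / 3 by rewrite ge_min lexx orbT.
lra.
Qed.

Lemma measurable_weight g f : measurable_fun pos g -> measurable_fun hp f ->
  measurable_fun hp (fun z => g z.2 * f z).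
Proof.
move=> /measurable_EFinP mg mf; apply: measurable_funM => //.
by apply/measurable_EFinP; exact: (measurable_snd_hp mg).
Qed.

Lemma int_weight g f : measurable_fun pos g -> (forall y, 0 < y -> 0 <= g y) ->
  measurable_fun hp f -> (forall z, hp z -> 0 <= f z) ->
  (\int[leb2]_(z in hp) (g z.2 * f z)%:E =
   \int[mu]_(y in pos) ((g y)%:E * \int[mu]_x (f (x, y))%:E))%E.
Proof.
move=> mg g0 mf f0; rewrite int_hp; last 2 first.
- by apply/measurable_EFinP; exact: measurable_weight.
- by move=> z z0; rewrite lee_fin mulr_ge0 ?g0 ?f0.
apply: eq_integral => y; rewrite inE /= in_itv /= andbT => y0.
under eq_integral do rewrite EFinM.
rewrite ge0_integralZl//.
- apply: (@measurable_hslice _ (fun z => (f z)%:E)) => //; exact/measurable_EFinP.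
- by move=> x _; rewrite lee_fin f0.
- by rewrite lee_fin g0.
Qed.

(** Fubini: a weight depending on the height is integrated against the masses of the
    slices. *)
Lemma weight_le_slice f g (m : R -> R) (C I : R) : 0 <= C -> measurable_fun hp f ->
  (forall y, 0 < y -> 0 <= m y) -> measurable_fun pos m ->
  (forall y, 0 < y -> (\int[mu]_x (f (x, y) ^+ 2)%:E <= (C * m y)%:E)%E) ->
  measurable_fun pos g -> (forall y, 0 < y -> 0 <= g y) ->
  (\int[mu]_(y in pos) (m y * g y)%:E <= I%:E)%E ->
  (\int[leb2]_(z in hp) (g z.2 * f z ^+ 2)%:E <= (C * I)%:E)%E.
Proof.
move=> C0 mf m0 mm fm mg g0 gI.
have mf2 : measurable_fun hp (fun z => f z ^+ 2) by exact: measurable_funX.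
have mmg : measurable_fun pos (fun y => (m y * g y)%:E).
  by apply/measurable_EFinP; apply: measurable_funM => //.
rewrite int_weight//; last by move=> z _; exact: sqr_ge0.
apply: (@le_trans _ _ (C%:E * \int[mu]_(y in pos) (m y * g y)%:E)%E); last first.
  by rewrite EFinM; apply: (lee_wpmul2l _ gI); rewrite lee_fin.
rewrite -ge0_integralZl//; last first.
  by move=> y /=; rewrite in_itv /= andbT => y0; rewrite lee_fin mulr_ge0 ?g0 ?m0.
apply: ge0_le_integral => //.
- move=> y /=; rewrite in_itv /= andbT => y0; rewrite mule_ge0 ?lee_fin ?g0//.
  by apply: integral_ge0 => x _; exact: sqr_ge0E.
- apply: emeasurable_funM; first exact/measurable_EFinP.
  by apply: (@measurable_slice_int _ (fun z => (f z ^+ 2)%:E)) => [|z _]; [exact/measurable_EFinP|exact: sqr_ge0E].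
- exact: measurable_funeM.
move=> y /=; rewrite in_itv /= andbT => y0.
apply: (@le_trans _ _ ((g y)%:E * (C * m y)%:E)%E).
  by apply: lee_wpmul2l; [rewrite lee_fin g0|exact: fm].
by rewrite -!EFinM lee_fin mulrCA [g y * m y]mulrC.
Qed.

Lemma sqint_bound_ge0 f (C : R) : (sqint f <= C%:E)%E -> 0 <= C.
Proof.
by move=> fC; rewrite -lee_fin; apply: le_trans fC; apply: integral_ge0 => z _; exact: sqr_ge0E.
Qed.

Lemma weight_le_csmooth w g (C I : R) : csmooth w -> (sqint (d2 w) <= C%:E)%E ->
  measurable_fun pos g -> (forall y, 0 < y -> 0 <= g y) ->
  (\int[mu]_(y in pos) (y * g y)%:E <= I%:E)%E ->
  (\int[leb2]_(z in hp) (g z.2 * w z ^+ 2)%:E <= (C * I)%:E)%E.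
Proof.
move=> cw wC mg g0 gI; have C0 := sqint_bound_ge0 wC.
apply: (@weight_le_slice w g (fun y => y)) => //; first exact: csmooth_meas.
  by move=> y /ltW.
move=> y y0; apply: (le_trans (slice_le cw y0)).
by rewrite mulrC EFinM; apply: (lee_wpmul2l _ wC); rewrite lee_fin ltW.
Qed.

Lemma weight_le_stream psi g (C I : R) : csmooth psi -> (sqint (d2 (d2 psi)) <= C%:E)%E ->
  measurable_fun pos g -> (forall y, 0 < y -> 0 <= g y) ->
  (\int[mu]_(y in pos) (y ^+ 3 * g y)%:E <= I%:E)%E ->
  (\int[leb2]_(z in hp) (g z.2 * psi z ^+ 2)%:E <= (C * I)%:E)%E.
Proof.
move=> cp pC mg g0 gI; have C0 := sqint_bound_ge0 pC.
apply: (@weight_le_slice psi g (fun y => y ^+ 3)) => //; first exact: csmooth_meas.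
  by move=> y /ltW; exact: exprn_ge0.
by move=> y y0; exact: stream_slice_le.
Qed.

(** The vertical energy bound is what slice_le turns into bounds of the slices of w k
    that are uniform in k. *)
Definition approx (C : R) (w : nat -> R * R -> R) u :=
  [/\ forall k, csmooth (w k), forall k, (sqint (d2 (w k)) <= C%:E)%E,
      measurable_fun hp u & loc_cvg w u].

Lemma approx_meas C (w : nat -> R * R -> R) u k : approx C w u -> measurable_fun hp (w k).
Proof. by case=> cw _ _ _; exact: csmooth_meas. Qed.

Lemma weight_le C (w : nat -> R * R -> R) u g (I : R) : approx C w u ->
  measurable_fun pos g -> (forall y, 0 < y -> 0 <= g y) ->
  (\int[mu]_(y in pos) (y * g y)%:E <= I%:E)%E ->
  (\int[leb2]_(z in hp) (g z.2 * u z ^+ 2)%:E <= (C * I)%:E)%E.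
Proof.
move=> au mg g0 gI; have [cw wC mu_ wu] := au.
apply: (@integral_le_of_loc_cvg (fun z => g z.2) w u (fun=> C * I)) => //.
- by apply/measurable_EFinP; apply: (@measurable_snd_hp _ (EFin \o g)); exact/measurable_EFinP.
- by move=> z; exact: g0.
- by move=> k; exact: (approx_meas k au).
- by move=> k; exact: weight_le_csmooth.
- exact: cvg_cst.
Qed.

(** On the slice of height y, phi^2 is at most the Sobolev bound S y, the integral of
    phi^2 + (d1 phi)^2 over the slice, and the integral of w^2 is at most C y. There
    remains the integral of y g(y) S y: its part with phi costs y^2 g by slice_le, its
    part with d1 phi the supremum of y g. *)
Lemma weight2_le_csmooth w phi g (C E I M : R) : csmooth w -> (sqint (d2 w) <= C%:E)%E ->
  csmooth phi -> (sqint (d1 phi) <= E%:E)%E -> (sqint (d2 phi) <= E%:E)%E ->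
  measurable_fun pos g -> (forall y, 0 < y -> 0 <= g y) ->
  (\int[mu]_(y in pos) (y ^+ 2 * g y)%:E <= I%:E)%E ->
  (forall y, 0 < y -> y * g y <= M) ->
  (\int[leb2]_(z in hp) (g z.2 * phi z ^+ 2 * w z ^+ 2)%:E <= (C * (E * I + E * M))%:E)%E.
Proof.
move=> cw wC cp E1 E2 mg g0 gI gM.
have C0 : 0 <= C by rewrite -lee_fin; apply: le_trans wC; apply: integral_ge0 => z _; exact: sqr_ge0E.
have M0 : 0 <= M by apply: le_trans (gM 1 ltr01); rewrite mul1r g0.
have mw2 : measurable_fun hp (fun z => w z ^+ 2).
  exact: (measurable_funX _ (csmooth_meas cw)).
have mp2 : measurable_fun hp (fun z => phi z ^+ 2).
  exact: (measurable_funX _ (csmooth_meas cp)).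
have mdp2 : measurable_fun hp (fun z => d1 phi z ^+ 2).
  exact: (measurable_funX _ (csmooth_meas (csmooth_partial 0 cp))).
have msl f : measurable_fun hp (fun z => f z ^+ 2) ->
    measurable_fun pos (fun y => \int[mu]_x (f (x, y) ^+ 2)%:E)%E.
  move=> mf; apply: (@measurable_slice_int _ (fun z => (f z ^+ 2)%:E)) => [|z _]; last exact: sqr_ge0E.
  exact/measurable_EFinP.
have sl0 f y : (0 <= \int[mu]_x (f (x, y) ^+ 2)%:E)%E.
  by apply: integral_ge0 => x _; exact: sqr_ge0E.
pose S y := (\int[mu]_t (phi (t, y) ^+ 2)%:E + \int[mu]_t (d1 phi (t, y) ^+ 2)%:E)%E.
have S0 y : (0 <= S y)%E by apply: adde_ge0.
have mS : measurable_fun pos S by apply: emeasurable_funD; exact: msl.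
have myg : measurable_fun pos (fun y => y * g y) by apply: measurable_funM.
have yg0 y : 0 < y -> 0 <= y * g y by move=> y0; rewrite mulr_ge0 ?g0// ltW.
apply: (@le_trans _ _ (C%:E * \int[mu]_(y in pos) ((y * g y)%:E * S y))%E); last first.
  rewrite EFinM; apply: lee_wpmul2l; first by rewrite lee_fin.
  have -> : (\int[mu]_(y in pos) ((y * g y)%:E * S y) =
     \int[leb2]_(z in hp) (z.2 * g z.2 * phi z ^+ 2)%:E +
     \int[leb2]_(z in hp) (z.2 * g z.2 * d1 phi z ^+ 2)%:E)%E.
    rewrite (@int_weight (fun y => y * g y) (fun z => phi z ^+ 2))//; last by move=> z _; exact: sqr_ge0.
    rewrite (@int_weight (fun y => y * g y) (fun z => d1 phi z ^+ 2))//; last by move=> z _; exact: sqr_ge0.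
    rewrite -ge0_integralD//.
    - apply: eq_integral => y _; rewrite ge0_muleDr//.
    - by move=> y /=; rewrite in_itv /= andbT => y0; rewrite mule_ge0// lee_fin yg0.
    - by apply: emeasurable_funM; [exact/measurable_EFinP|exact: msl].
    - by move=> y /=; rewrite in_itv /= andbT => y0; rewrite mule_ge0// lee_fin yg0.
    - by apply: emeasurable_funM; [exact/measurable_EFinP|exact: msl].
  rewrite EFinD; apply: leeD.
    apply: (@weight_le_csmooth phi (fun y => y * g y)) => //.
    by under eq_integral do rewrite mulrA -expr2.
  rewrite mulrC; apply: (@le_trans _ _ (M%:E * sqint (d1 phi))%E); last first.
    by rewrite EFinM; apply: (lee_wpmul2l _ E1); rewrite lee_fin.
  rewrite /sqint -ge0_integralZl//; last 3 first.
  - exact: measurable_half_plane.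
  - exact/measurable_EFinP.
  - by move=> z _; exact: sqr_ge0E.
  apply: ge0_le_integral => //.
  - exact: measurable_half_plane.
  - by move=> z z0; rewrite lee_fin mulr_ge0 ?yg0 ?sqr_ge0.
  - by apply/measurable_EFinP; exact: (measurable_weight myg mdp2).
  - by apply: measurable_funeM; exact/measurable_EFinP.
  - by move=> z z0; rewrite -EFinM lee_fin ler_wpM2r ?sqr_ge0 ?gM.
under eq_integral do rewrite -mulrA.
rewrite (@int_weight g (fun z => phi z ^+ 2 * w z ^+ 2))//; last 2 first.
- exact: measurable_funM.
- by move=> z _; rewrite mulr_ge0 ?sqr_ge0.
rewrite -ge0_integralZl//; last 2 first.
- by apply: emeasurable_funM => //; exact/measurable_EFinP.
- by move=> y /=; rewrite in_itv /= andbT => y0; rewrite mule_ge0// lee_fin yg0.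
apply: ge0_le_integral => //.
- move=> y /=; rewrite in_itv /= andbT => y0; rewrite mule_ge0 ?lee_fin ?g0//.
  by apply: integral_ge0 => x _; rewrite lee_fin mulr_ge0 ?sqr_ge0.
- apply: emeasurable_funM; first exact/measurable_EFinP.
  apply: (@measurable_slice_int _ (fun z => (phi z ^+ 2 * w z ^+ 2)%:E)) => [|z _].
    by apply/measurable_EFinP; exact: measurable_funM.
  by rewrite lee_fin mulr_ge0 ?sqr_ge0.
- by apply: measurable_funeM; apply: emeasurable_funM => //; exact/measurable_EFinP.
move=> y /=; rewrite in_itv /= andbT => y0.
have mwy : measurable_fun setT (fun x => (w (x, y) ^+ 2)%:E).
  by apply: (@measurable_hslice _ (fun z => (w z ^+ 2)%:E)) => //; exact/measurable_EFinP.
apply: (@le_trans _ _ ((g y)%:E * (S y * (y * C)%:E))%E).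
  apply: lee_wpmul2l; first by rewrite lee_fin g0.
  apply: (@le_trans _ _ (\int[mu]_x (S y * (w (x, y) ^+ 2)%:E))%E).
    apply: ge0_le_integral => //.
    - by move=> x _; rewrite lee_fin mulr_ge0 ?sqr_ge0.
    - apply: (@measurable_hslice _ (fun z => (phi z ^+ 2 * w z ^+ 2)%:E)) => //.
      by apply/measurable_EFinP; exact: measurable_funM.
    - exact: measurable_funeM.
    - move=> x _; rewrite EFinM; apply: lee_wpmul2r; first exact: sqr_ge0E.
      exact: sup_slice_le.
  rewrite ge0_integralZl//; last by move=> x _; exact: sqr_ge0E.
  apply: lee_wpmul2l => //; apply: (le_trans (slice_le cw y0)).
  by rewrite EFinM; apply: (lee_wpmul2l _ wC); rewrite lee_fin (ltW y0).
rewrite [(S y * _)%E]muleC !muleA -!EFinM (_ : g y * (y * C) = C * (y * g y)); last by ring.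
by [].
Qed.

Lemma weight2_le C (w : nat -> R * R -> R) u phi g (E I M : R) : approx C w u ->
  csmooth phi -> (sqint (d1 phi) <= E%:E)%E -> (sqint (d2 phi) <= E%:E)%E ->
  measurable_fun pos g -> (forall y, 0 < y -> 0 <= g y) ->
  (\int[mu]_(y in pos) (y ^+ 2 * g y)%:E <= I%:E)%E ->
  (forall y, 0 < y -> y * g y <= M) ->
  (\int[leb2]_(z in hp) (g z.2 * phi z ^+ 2 * u z ^+ 2)%:E <= (C * (E * I + E * M))%:E)%E.
Proof.
move=> au cp E1 E2 mg g0 gI gM; have [cw wC mu_ wu] := au.
apply: (@integral_le_of_loc_cvg (fun z => g z.2 * phi z ^+ 2) w u (fun=> C * (E * I + E * M))) => //.
- apply: measurable_weight => //.
  exact: (measurable_funX _ (csmooth_meas cp)).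
- by move=> z z0; rewrite mulr_ge0 ?sqr_ge0 ?g0.
- by move=> k; exact: (approx_meas k au).
- by move=> k; exact: weight2_le_csmooth.
- exact: cvg_cst.
Qed.

End Weights.

(** * Stream functions *)

Section Stream.
Context {R : realType}.
Local Notation mu := (@lebesgue_measure R).
Local Notation T := (measurableTypeR R).
Local Notation d1 := (partial 0%R).
Local Notation d2 := (partial 1%R).
Implicit Types (a b f psi : R * R -> R) (g H dH : R -> R) (x y B : R) (z : R * R).

Lemma le_norm_deriv H dH (C : R) x y : (forall x, is_derive x 1 H (dH x)) ->
  (forall x, `|dH x| <= C) -> `|H y - H x| <= C * `|y - x|.
Proof.
move=> Hd HC.
wlog xy : x y / x < y.
  move=> wl; have [xy|yx|->] := ltgtP x y; first exact: wl.
    by rewrite distrC [`|y - x|]distrC; exact: wl.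
  by rewrite !subrr normr0 mulr0.
have [|c _ ->] := @MVT R H dH x y xy (fun t _ => Hd t).
  exact/continuous_subspaceT/is_derive_continuous.
by rewrite normrM ler_wpM2r.
Qed.

Lemma primitive_is_derive g (p q : R) : continuous g ->
  (forall t, t < p -> g t = 0) -> (forall t, q < t -> g t = 0) ->
  forall y, is_derive y 1 (fun s => \int[mu]_(t in `]-oo, s]) g t) (g y).
Proof.
move=> cg gp gq y.
have gE : EFin \o g = (EFin \o g) \_ `[p, q].
  apply/funext => t /=; rewrite patchE; case: ifPn => //.
  rewrite notin_setE /= in_itv /= => /negP; rewrite negb_and -!ltNge.
  by case/orP => [/gp ->|/gq ->].
have ig : mu.-integrable (`]-oo, y + 1]%classic : set T) (EFin \o g).
  apply: (@integrableS _ _ _ _ setT) => //; rewrite gE.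
  apply/(@integrable_mkcond _ _ _ mu `[p, q]%classic (EFin \o g) (measurable_itv _)).
  apply: continuous_compact_integrable; first exact: segment_compact.
  exact: continuous_subspaceT.
have yy1 : y < y + 1 by rewrite ltrDl.
have [dF FE] := @continuous_FTC1 R g -oo%O y (y + 1) yy1 ig (ltNyr y) (cg y).
split; first exact: dF.
by rewrite -FE derive1E.
Qed.

Lemma primitive_eq0 g (p : R) y : (forall t, t < p -> g t = 0) -> y < p ->
  \int[mu]_(t in `]-oo, y]) g t = 0.
Proof.
move=> gp yp; rewrite /Rintegral (eq_integral (fun=> 0%E)) ?integral0// => t.
by rewrite inE /= in_itv /= => ty; rewrite gp// (le_lt_trans ty).
Qed.

Lemma csmooth_bounded f : csmooth f -> exists2 C : R, 0 < C & forall z, `|f z| <= C.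
Proof.
move=> [sf [B B0 fB]].
have /compact_bounded/pinfty_ex_gt0[M M0 KM] : compact (f @` box B).
  apply: continuous_compact; last exact: box_compact.
  exact/continuous_subspaceT/smooth_continuous.
exists M => // z; have [zB|zB] := pselect (box B z); first by apply: KM; exists z.
by rewrite fB// normr0 ltW.
Qed.

(** The integral psi of a along vertical lines has d2 psi = a. To compute d1 psi, fix h
    and let D s = psi (x + h, s) - psi (x, s) + h b (x, s): since b has vertical
    derivative - d1 a, the derivative of D is the Taylor remainder of a in the first
    variable, at most C h^2, and D vanishes at the boundary. Outside a box containing
    the supports of a and b, psi is constant along a half-line leading to points where
    it is 0. *)
Lemma exists_stream a b : csmooth a -> csmooth b -> (forall z, d1 a z + d2 b z = 0) ->
  exists psi, [/\ csmooth psi, d2 psi = a & d1 psi = - b].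
Proof.
move=> ca cb div0.
have [sa sb] := (ca.1, cb.1).
have [Ba Ba0 aB] := ca.2; have [Bb Bb0 bB] := cb.2.
set B := Num.max Ba Bb.
have B0 : 0 < B by rewrite lt_max Ba0.
have {}aB z : ~ box B z -> a z = 0.
  by move=> zB; apply: aB; apply: contra_not zB; apply: le_box => //; rewrite le_max lexx.
have {}bB z : ~ box B z -> b z = 0.
  by move=> zB; apply: bB; apply: contra_not zB; apply: le_box => //; rewrite le_max lexx orbT.
have nlow x t : t < B^-1 -> ~ box B (x, t).
  by move=> tB [_ /=]; rewrite in_itv /= leNgt tB.
have nup x t : B < t -> ~ box B (x, t).
  by move=> tB [_ /=]; rewrite in_itv /= andbC leNgt tB.
pose psi z := \int[mu]_(t in `]-oo, z.2]) a (z.1, t).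
have psi2 x y : is_derive y 1 (fun s => psi (x, s)) (a (x, y)).
  apply: (@primitive_is_derive (fun t => a (x, t)) B^-1 B).
  - exact/continuous_vslice/smooth_continuous.
  - by move=> t /(nlow x); exact: aB.
  - by move=> t /(nup x); exact: aB.
have psi0 x y : y < B^-1 -> psi (x, y) = 0.
  by apply: primitive_eq0 => t /(nlow x); exact: aB.
have Bi0 : 0 < B^-1 by rewrite invr_gt0.
have [Ca Ca0 aC] := csmooth_bounded ca.
have [Cb Cb0 bC] := csmooth_bounded cb.
have [C C0 daC] := csmooth_bounded (csmooth_partial 0 (csmooth_partial 0 ca)).
(* The mean value theorem, applied twice: first to d1 a, then to F. *)
have taylor x y (h : R) : `|a (x + h, y) - a (x, y) - h * d1 a (x, y)| <= C * h ^+ 2.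
  pose F t := a (t, y) - (t - x) * d1 a (x, y).
  pose dF t := d1 a (t, y) - d1 a (x, y).
  have Fd (t : R) : is_derive t 1 F (dF t).
    have := is_derive_hslice y t sa => ?.
    by apply: is_derive_eq; rewrite /dF /GRing.scale /=; ring.
  have dFC (t : R) : `|dF t| <= C * `|t - x|.
    exact: (@le_norm_deriv (fun t => d1 a (t, y)) (fun t => d1 (d1 a) (t, y)) C x t
      (fun s => is_derive_hslice y s (smooth_partial 0 sa)) (fun s => daC _)).
  have -> : a (x + h, y) - a (x, y) - h * d1 a (x, y) = F (x + h) - F x.
    by rewrite /F; ring.
  have [->|h0] := eqVneq h 0; first by rewrite addr0 subrr normr0 expr0n mulr0.
  have mvt (p q : R) : p < q -> (forall t, p <= t <= q -> `|t - x| <= `|h|) ->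
      `|F q - F p| <= C * `|h| * (q - p).
    move=> pq th; have [|c cpq ->] := @MVT R F dF p q pq (fun t _ => Fd t).
      exact/continuous_subspaceT/is_derive_continuous.
    rewrite normrM [`|q - p|]gtr0_norm ?subr_gt0// ler_wpM2r ?subr_ge0 ?(ltW pq)//.
    apply: (le_trans (dFC c)); rewrite ler_wpM2l ?(ltW C0)// th//.
    by move: cpq; rewrite in_itv /= => /andP[/ltW -> /ltW ->].
  rewrite -[h ^+ 2]ger0_norm ?sqr_ge0// normrX expr2 mulrA.
  have [hn|hp0|/eqP] := ltgtP h 0; last by rewrite (negbTE h0).
    rewrite distrC [X in _ * X](ltr0_norm hn) (_ : - h = x - (x + h)); last by ring.
    apply: mvt; first by lra.
    by move=> t /andP[t1 t2]; rewrite (ltr0_norm hn) ler_norml; apply/andP; split; lra.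
  rewrite [X in _ * X](gtr0_norm hp0) (_ : C * `|h| * h = C * `|h| * (x + h - x)); last by ring.
  apply: mvt; first by lra.
  by move=> t /andP[t1 t2]; rewrite (gtr0_norm hp0) ler_norml; apply/andP; split; lra.
have psi1 x y : is_derive x 1 (fun s => psi (s, y)) (- b (x, y)).
  have Dle (h : R) : `|psi (x + h, y) - psi (x, y) + h * b (x, y)| <= C * h ^+ 2 * `|y|.
    pose D s := psi (x + h, s) - psi (x, s) + h * b (x, s).
    pose dD s := a (x + h, s) - a (x, s) - h * d1 a (x, s).
    have Dd (s : R) : is_derive s 1 D (dD s).
      have := is_derive_vslice x s sb => ?.
      apply: is_derive_eq; rewrite /dD /GRing.scale /=.
      by have := div0 (x, s); move=> /eqP; rewrite addr_eq0 => /eqP ->; ring.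
    have D0 : D 0 = 0 by rewrite /D !psi0// bB ?mulr0 ?subrr ?addr0//; exact: nlow.
    have := @le_norm_deriv D dD (C * h ^+ 2) 0 y Dd (fun s => taylor x s h).
    by rewrite D0 !subr0.
  have cv : h^-1 *: (((fun s => psi (s, y)) \o shift x) (h *: (1 : R)) - psi (x, y)) @[h --> 0^'] --> - b (x, y).
    apply/cvgrPdist_lt => e e0; near=> h.
    have h0 : h != 0 by near: h; exact: nbhs_dnbhs_neq.
    rewrite /= /GRing.scale /= mulr1 [h + x]addrC distrC.
    rewrite (_ : _ - _ = h^-1 * (psi (x + h, y) - psi (x, y) + h * b (x, y))); last by field.
    rewrite normrM normfV ltr_pdivrMl ?normr_gt0//.
    apply: (le_lt_trans (Dle h)).
    rewrite -[h ^+ 2]ger0_norm ?sqr_ge0// normrX expr2 [ltRHS]mulrC.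
    rewrite (_ : _ * _ = (C * `|y| * `|h|) * `|h|); last by ring.
    rewrite ltr_pM2r ?normr_gt0//.
    apply: (@le_lt_trans _ _ ((C * `|y| + 1) * `|h|)).
      by rewrite ler_wpM2r// lerDl.
    rewrite mulrC -ltr_pdivlMr; last by rewrite ltr_wpDl// mulr_ge0// ltW.
    near: h; apply: dnbhs0_lt.
    by rewrite divr_gt0// ltr_wpDl// mulr_ge0// ltW.
  by apply: DeriveDef; [apply/cvg_ex; eexists; exact: cv|exact/cvg_lim/cv].
have d2E : d2 psi = a by apply/funext => -[x y]; rewrite partial2E; have [_] := psi2 x y.
have d1E : d1 psi = - b by apply/funext => -[x y]; rewrite partial1E; have [_] := psi1 x y.
(* psi is Lipschitz in each variable, hence continuous; its partial derivatives are
   already smooth. *)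
exists psi; split => //; split.
  apply: smooth_of_partials.
  - move=> [x y]; apply/cvgrPdist_lt => e e0.
    have d0 : 0 < e / (Ca + Cb) by rewrite divr_gt0// addr_gt0.
    exists (ball (x : R) (e / (Ca + Cb)), ball (y : R) (e / (Ca + Cb))).
      by split; exact: nbhsx_ballx.
    move=> [x' y'] [/= xx yy]; rewrite /ball /= in xx yy.
    rewrite (_ : _ - _ = (psi (x, y) - psi (x', y)) + (psi (x', y) - psi (x', y'))); last by ring.
    apply: (le_lt_trans (ler_normD _ _)).
    have H1 : `|psi (x, y) - psi (x', y)| <= Cb * `|x - x'|.
      apply: (@le_norm_deriv (fun s => psi (s, y)) (fun s => - b (s, y)) Cb x' x (psi1^~ y)).
      by move=> s; rewrite normrN.
    have H2 : `|psi (x', y) - psi (x', y')| <= Ca * `|y - y'|.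
      exact: (@le_norm_deriv (fun s => psi (x', s)) (fun s => a (x', s)) Ca y' y (psi2 x')).
    apply: (le_lt_trans (lerD H1 H2)).
    rewrite -(ltr_pM2l Cb0) in xx; rewrite -(ltr_pM2l Ca0) in yy.
    apply: (lt_le_trans (ltrD xx yy)); rewrite -mulrDl addrC mulrC divfK//.
    by rewrite gt_eqF// addr_gt0.
  - move=> i [x y]; case: (I2P i) => ->.
      by rewrite derivable1E; have [] := psi1 x y.
    by rewrite derivable2E; have [] := psi2 x y.
  - by move=> i; case: (I2P i) => ->; rewrite ?d1E ?d2E//; exact: smoothN.
exists B => // -[x y].
(* Below the box psi is 0 by construction; beside it, a vanishes on the whole vertical
   line; above it, b vanishes on the whole horizontal line, which leads to points beside
   the box. *)
have [yl _|yl] := ltP y B^-1; first exact: psi0.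
have farx (s t : R) : B < `|s| -> ~ box B (s, t).
  by move=> sB [/=]; rewrite in_itv /= -ler_norml leNgt sB.
have psifar (s t : R) : B < `|s| -> psi (s, t) = 0.
  move=> sB; have := @le_norm_deriv (fun r => psi (s, r)) (fun r => a (s, r)) 0 0 t (psi2 s).
  rewrite (psi0 s 0)// subr0 mul0r normr_le0 => H; apply/eqP/H => r.
  by rewrite aB ?normr0//; exact: farx.
have [yu _|yu nb] := ltP B y.
  have := @le_norm_deriv (fun r => psi (r, y)) (fun r => - b (r, y)) 0 (B + 1) x (psi1^~ y).
  rewrite (psifar (B + 1)) ?subr0 ?mul0r ?normr_le0; last by rewrite ger0_norm; lra.
  by move=> H; apply/eqP/H => r; rewrite bB ?oppr0 ?normr0//; exact: nup.
apply: psifar; rewrite ltNge; apply/negP => xB; apply: nb; split => /=; rewrite in_itv /=.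
  by rewrite -ler_norml.
by rewrite yl.
Unshelve. all: by end_near.
Qed.

End Stream.

(** * The logarithmic cutoff *)

Section Cutoff.
Context {R : realType}.
Local Notation mu := (@lebesgue_measure R).
Local Notation T := (measurableTypeR R).
Local Notation pos := (`]0%R, +oo[%classic : set T).
Implicit Types (f g h H df dg : R -> R) (e x y s : R).

Lemma Cn1_continuous n f : Cn1 n f -> continuous f.
Proof. by case: n => [|n] []. Qed.

Lemma Cn1_deriv n f df : (forall x, is_derive x 1 f (df x)) -> Cn1 n df -> Cn1 n.+1 f.
Proof.
move=> fd Cdf; split; first exact: is_derive_continuous fd.
split; first by move=> x; have [] := fd x.
rewrite (_ : f^`()%classic = df)//.
by apply/funext => x; rewrite derive1E; have [_] := fd x.
Qed.

Lemma Cn1_is_derive n f x : Cn1 n.+1 f -> is_derive x 1 f (f^`()%classic x).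
Proof. by move=> [_ [fd _]]; split; [exact: fd|rewrite derive1E]. Qed.

Lemma Cn1_derive1 n f : Cn1 n.+1 f -> Cn1 n f^`()%classic.
Proof. by move=> [_ [_ ?]]. Qed.

Lemma Cn1W n f : Cn1 n.+1 f -> Cn1 n f.
Proof.
elim: n f => [|n IH] f; first by case.
by case=> cf [df Cf]; split=> //; split=> //; exact: IH.
Qed.

Lemma Cn1D n f g : Cn1 n f -> Cn1 n g -> Cn1 n (fun x => f x + g x).
Proof.
elim: n f g => [|n IH] f g Cf Cg.
  by split=> // x; apply: cvgD; [exact: Cn1_continuous Cf x|exact: Cn1_continuous Cg x].
apply: (@Cn1_deriv n _ (fun x => f^`()%classic x + g^`()%classic x)).
  by move=> x; have := Cn1_is_derive x Cf; have := Cn1_is_derive x Cg => ? ?; exact: is_deriveD.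
exact: IH (Cn1_derive1 Cf) (Cn1_derive1 Cg).
Qed.

Lemma Cn1M n f g : Cn1 n f -> Cn1 n g -> Cn1 n (fun x => f x * g x).
Proof.
elim: n f g => [|n IH] f g Cf Cg.
  by split=> // x; apply: cvgM; [exact: Cn1_continuous Cf x|exact: Cn1_continuous Cg x].
apply: (@Cn1_deriv n _ (fun x => f x * g^`()%classic x + g x * f^`()%classic x)).
  move=> x; have := Cn1_is_derive x Cf; have := Cn1_is_derive x Cg => ? ?.
  exact: is_deriveM.
by apply: Cn1D; apply: IH; (exact: Cn1W || exact: Cn1_derive1).
Qed.

Lemma Cn1_cst n (c : R) : Cn1 n (fun=> c).
Proof.
elim: n c => [|n IH] c; first by split=> // x; exact: cst_continuous.
by apply: (@Cn1_deriv n _ (fun=> 0)) => //; exact: IH.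
Qed.

Lemma Cn1_id n : Cn1 n (fun x : R => x).
Proof.
case: n => [|n]; first by split=> // x; exact: cvg_id.
by apply: (@Cn1_deriv n _ (fun=> 1)); exact: Cn1_cst.
Qed.

Lemma Cn1_expR n f : Cn1 n f -> Cn1 n (fun x => expR (f x)).
Proof.
elim: n f => [|n IH] f Cf.
  split=> // x; apply: continuous_comp; first exact: Cn1_continuous Cf x.
  exact: continuous_expR.
apply: (@Cn1_deriv n _ (fun x => expR (f x) * f^`()%classic x)).
  move=> x; have := Cn1_is_derive x Cf => ?.
  exact: (@is_derive1_comp R expR f).
by apply: Cn1M; [exact/IH/Cn1W|exact: Cn1_derive1].
Qed.

Definition bracket y : R := 1 + y ^+ 2.

Lemma bracket_ge1 y : 1 <= bracket y. Proof. by rewrite lerDl sqr_ge0. Qed.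

Lemma bracket_gt0 y : 0 < bracket y. Proof. exact: lt_le_trans (bracket_ge1 y). Qed.

Lemma is_derive_bracketV y :
  is_derive y 1 (fun x => (bracket x)^-1) (- (2 * y * ((bracket y)^-1 * (bracket y)^-1))).
Proof.
have b0 : bracket y != 0 by rewrite gt_eqF// bracket_gt0.
have ? : is_derive y 1 bracket (2 * y).
  by apply: is_derive_eq; rewrite /GRing.scale /=; ring.
rewrite (_ : - _ = - bracket y ^- 2 *: (2 * y)); first exact: is_deriveV.
by rewrite /GRing.scale /=; field.
Qed.

Lemma Cn1_bracketV n : Cn1 n (fun y => (bracket y)^-1).
Proof.
elim: n => [|n IH].
  by split=> //; apply: is_derive_continuous => y; exact: is_derive_bracketV.
apply: (Cn1_deriv is_derive_bracketV).
have C2 := @Cn1_cst n (- 2).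
have := Cn1M (Cn1M C2 (Cn1_id n)) (Cn1M IH IH).
by congr (Cn1 _ _); apply/funext => y /=; ring.
Qed.

(** The square keeps the logarithm, and with it the cutoff, smooth on the whole line. *)
Definition lg y : R := ln (bracket y).

Lemma is_derive_lg y : is_derive y 1 lg (2 * y * (bracket y)^-1).
Proof.
have ? : is_derive y 1 bracket (2 * y).
  by apply: is_derive_eq; rewrite /GRing.scale /=; ring.
have ? := is_derive1_ln (bracket_gt0 y).
rewrite mulrC; exact: (@is_derive1_comp R (@ln R) bracket).
Qed.

Lemma Cn1_lg n : Cn1 n lg.
Proof.
apply: Cn1W; apply: (Cn1_deriv is_derive_lg).
exact: (Cn1M (Cn1M (Cn1_cst n 2) (Cn1_id n)) (Cn1_bracketV n)).
Qed.

Lemma lg_ge0 y : 0 <= lg y. Proof. exact/ln_ge0/bracket_ge1. Qed.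

(** Constant in the limit e -> 0, and varying so slowly that the integral of y cut'^2
    tends to 0, while for fixed e it decays faster than any power of y. *)
Definition cut e y : R := expR (- (e * lg y) ^+ 2).

Definition dcut e y : R :=
  - (2 * e ^+ 2 * lg y * (2 * y * (bracket y)^-1) * cut e y).

Definition ddcut e y : R :=
  - (2 * e ^+ 2 * ((2 * y * (bracket y)^-1) ^+ 2 * cut e y +
     lg y * (2 * (1 - y ^+ 2) * (bracket y)^-1 ^+ 2) * cut e y +
     lg y * (2 * y * (bracket y)^-1) * dcut e y)).

Lemma Cn1_cut n e : Cn1 n (cut e).
Proof.
apply: Cn1_expR.
have C1 := Cn1M (Cn1_cst n e) (Cn1_lg n).
have := Cn1M (Cn1_cst n (-1)) (Cn1M C1 C1).
by congr (Cn1 _ _); apply/funext => y /=; ring.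
Qed.

Lemma is_derive_cut e y : is_derive y 1 (cut e) (dcut e y).
Proof.
have ? := is_derive_lg y.
have ? : is_derive y 1 (fun y => - (e * lg y) ^+ 2)
    (- (2 * e ^+ 2 * lg y * (2 * y * (bracket y)^-1))).
  by apply: is_derive_eq; rewrite /GRing.scale /=; ring.
have ? := is_derive_expR (- (e * lg y) ^+ 2).
rewrite (_ : dcut e y = cut e y * - (2 * e ^+ 2 * lg y * (2 * y * (bracket y)^-1))).
  exact: (@is_derive1_comp R expR (fun y => - (e * lg y) ^+ 2)).
by rewrite /dcut mulrN mulrC.
Qed.

Lemma is_derive_dcut e y : is_derive y 1 (dcut e) (ddcut e y).
Proof.
have b0 : bracket y != 0 by rewrite gt_eqF// bracket_gt0.
have ? := is_derive_lg y; have ? := is_derive_cut e y; have ? := is_derive_bracketV y.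
apply: is_derive_eq; rewrite /ddcut /GRing.scale /=.
set r := (bracket y)^-1.
have -> : 1 - y ^+ 2 = bracket y - 2 * y ^+ 2 by rewrite /bracket; ring.
have E : bracket y * r = 1 by rewrite mulfV.
rewrite (_ : 2 * (bracket y - 2 * y ^+ 2) * r ^+ 2 = 2 * (r * (bracket y * r) - 2 * y ^+ 2 * r ^+ 2)); last by ring.
by rewrite E; ring.
Qed.

Lemma Cn1_dcut n e : Cn1 n (dcut e).
Proof.
have := Cn1_derive1 (Cn1_cut n.+1 e); congr (Cn1 _ _).
by apply/funext => y; rewrite derive1E; have [_] := is_derive_cut e y.
Qed.

Lemma Cn1_ddcut n e : Cn1 n (ddcut e).
Proof.
have := Cn1_derive1 (Cn1_dcut n.+1 e); congr (Cn1 _ _).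
by apply/funext => y; rewrite derive1E; have [_] := is_derive_dcut e y.
Qed.

Lemma cut_gt0 e y : 0 < cut e y. Proof. exact: expR_gt0. Qed.

Lemma cut_le1 e y : cut e y <= 1.
Proof. by rewrite /cut -expR0 ler_expR oppr_le0 sqr_ge0. Qed.

Lemma one_sub_cut_le e y : 1 - cut e y <= (e * lg y) ^+ 2.
Proof. by have := expR_ge1Dx (- (e * lg y) ^+ 2); rewrite /cut; lra. Qed.

(** With t = (e lg y)^2, this is exp (t / 2) >= 1 + t / 2 to the fourth power. *)
Lemma cut_poly_le e y : (1 + (e * lg y) ^+ 2) ^+ 4 * cut e y ^+ 2 <= 16.
Proof.
set t := (e * lg y) ^+ 2; have t0 : 0 <= t by exact: sqr_ge0.
have h : (1 + t / 2) ^+ 4 * cut e y ^+ 2 <= 1.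
  have E : expR (t / 2) ^+ 4 * expR (- t) ^+ 2 = 1.
    by rewrite -!expRM_natl -expRD (_ : _ + _ = 0) ?expR0//; field.
  rewrite /cut -/t -[leRHS]E ler_wpM2r ?exprn_ge0 ?expR_ge0//.
  by rewrite lerXn2r ?nnegrE ?expR_ge0 ?expR_ge1Dx//; lra.
have h2 : (1 + t) ^+ 4 <= (2 * (1 + t / 2)) ^+ 4 by rewrite lerXn2r ?nnegrE; lra.
apply: (@le_trans _ _ ((2 * (1 + t / 2)) ^+ 4 * cut e y ^+ 2)).
  by rewrite ler_wpM2r// sqr_ge0.
by rewrite exprMn -mulrA; lra.
Qed.

(** The power (bracket y)^-m is exp (- m lg y), and m L - (e L)^2 is largest at L = m /
    (2 e^2). *)
Lemma cut_decay e (m : nat) : 0 < e ->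
  exists2 C : R, 0 < C & forall y, cut e y <= C * (bracket y)^-1 ^+ m.
Proof.
move=> e0; exists (expR ((m%:R / (2 * e)) ^+ 2)); first exact: expR_gt0.
move=> y; have -> : (bracket y)^-1 ^+ m = expR (- (m%:R * lg y)).
  by rewrite expRN expRM_natl /lg lnK ?posrE ?bracket_gt0// exprVn.
rewrite /cut -expRD ler_expR -subr_ge0.
rewrite (_ : _ - _ = (e * lg y - m%:R / (2 * e)) ^+ 2) ?sqr_ge0//.
by field; rewrite gt_eqF.
Qed.

Lemma bracketV_gt0 y : 0 < (bracket y)^-1. Proof. by rewrite invr_gt0 bracket_gt0. Qed.

Lemma bracketV_le1 y : (bracket y)^-1 <= 1.
Proof. by rewrite invf_le1 ?bracket_gt0// bracket_ge1. Qed.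

Lemma bracketVE y : bracket y * (bracket y)^-1 = 1.
Proof. by rewrite mulfV// gt_eqF// bracket_gt0. Qed.

Lemma sqr_bracketV_le1 y : y ^+ 2 * (bracket y)^-1 <= 1.
Proof. by have := bracketVE y; have := bracketV_gt0 y; rewrite {2}/bracket; lra. Qed.

(** The function 1 / (1 + e lg y) decreases from 1, and minus its derivative is the
    kernel e lg' / (1 + e lg)^2. *)
Lemma integral_le_log_kernel e h (K : R) : 0 < e -> 0 <= K -> measurable_fun pos h ->
  (forall y, 0 < y -> 0 <= h y) ->
  (forall y, 0 < y -> h y * (1 + e * lg y) ^+ 2 <= K * (e * (2 * y * (bracket y)^-1))) ->
  (\int[mu]_(y in pos) (h y)%:E <= K%:E)%E.
Proof.
move=> e0 K0 mh h0 hK.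
have p0 y : 0 < 1 + e * lg y by rewrite ltr_pwDl// mulr_ge0 ?lg_ge0// ltW.
pose dH y := K * (e * (2 * y * (bracket y)^-1)) * (1 + e * lg y)^-1 ^+ 2.
have Hd y : is_derive y 1 (fun y => - (K * (1 + e * lg y)^-1)) (dH y).
  have p1 : 1 + e * lg y != 0 by rewrite gt_eqF.
  have ? := is_derive_lg y.
  have ? : is_derive y 1 (fun y => 1 + e * lg y) (e * (2 * y * (bracket y)^-1)).
    by apply: is_derive_eq; rewrite /GRing.scale /=; ring.
  have ? : is_derive y 1 (fun y => (1 + e * lg y)^-1)
     (- (1 + e * lg y) ^- 2 *: (e * (2 * y * (bracket y)^-1))) by exact: is_deriveV.
  by apply: is_derive_eq; rewrite /dH /GRing.scale /= exprVn; ring.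
have cdH : continuous dH.
  have cp : continuous (fun y : R => (1 + e * lg y)^-1).
    move=> y; apply: cvgV; first by rewrite gt_eqF.
    apply: cvgD; first exact: cvg_cst.
    by apply: cvgM; [exact: cvg_cst|exact: (Cn1_continuous (Cn1_lg 0))].
  move=> y; apply: cvgM; last by apply: cvgM; exact: cp.
  apply: cvgM; first exact: cvg_cst.
  apply: cvgM; first exact: cvg_cst.
  apply: cvgM; last exact: (Cn1_continuous (Cn1_bracketV 0)).
  by apply: cvgM; [exact: cvg_cst|exact: cvg_id].
apply: (le_trans (@integral_ftc_le _ _ dH _ 0 Hd cdH _ _ _ _)).
- exact/measurable_EFinP.
- by move=> y y0; rewrite lee_fin h0.
- move=> y y0; rewrite lee_fin /dH exprVn ler_pdivlMr ?exprn_gt0//; exact: hK.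
- by move=> y y0; rewrite oppr_le0 mulr_ge0// invr_ge0 ltW.
- by rewrite lee_fin /lg /bracket expr0n addr0 ln1 mulr0 addr0 invr1; lra.
Qed.

(** The same, with the decreasing function 1 / (1 + y^2). *)
Lemma integral_le_poly_kernel h (K : R) : 0 <= K -> measurable_fun pos h ->
  (forall y, 0 < y -> 0 <= h y) ->
  (forall y, 0 < y -> h y <= K * (2 * y * ((bracket y)^-1 * (bracket y)^-1))) ->
  (\int[mu]_(y in pos) (h y)%:E <= K%:E)%E.
Proof.
move=> K0 mh h0 hK.
pose dH y := K * (2 * y * ((bracket y)^-1 * (bracket y)^-1)).
have Hd y : is_derive y 1 (fun y => - (K * (bracket y)^-1)) (dH y).
  have ? := is_derive_bracketV y.
  by apply: is_derive_eq; rewrite /dH /GRing.scale /=; ring.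
have cdH : continuous dH.
  have cp := Cn1_continuous (Cn1_bracketV 0).
  move=> y; apply: cvgM; first exact: cvg_cst.
  apply: cvgM; last by apply: cvgM; exact: cp.
  by apply: cvgM; [exact: cvg_cst|exact: cvg_id].
apply: (le_trans (@integral_ftc_le _ _ dH _ 0 Hd cdH _ _ _ _)).
- exact/measurable_EFinP.
- by move=> y y0; rewrite lee_fin h0.
- by move=> y y0; rewrite lee_fin /dH hK.
- by move=> y y0; rewrite oppr_le0 mulr_ge0// invr_ge0 ltW// bracket_gt0.
- by rewrite lee_fin /bracket expr0n addr0 invr1; lra.
Qed.

Lemma measurable_cts f : continuous f -> measurable_fun pos f.
Proof.
by move=> cf; apply: (measurable_funS measurableT (@subsetT _ pos)); exact: continuous_measurable_fun.
Qed.

Lemma continuous_dcut e : continuous (dcut e).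
Proof. exact: Cn1_continuous (Cn1_dcut 0 e). Qed.

Lemma continuous_ddcut e : continuous (ddcut e).
Proof. exact: Cn1_continuous (Cn1_ddcut 0 e). Qed.

Lemma continuous_cut e : continuous (cut e).
Proof. exact: Cn1_continuous (Cn1_cut 0 e). Qed.

(** With s = e lg y, the polynomials in s met in the next integrals are at most 648 (1 +
    s^2)^4, where 648 = 2 * 18^2 is the value needed for the second derivative; the
    factor 16 is that of cut_poly_le. It is locked to remain an atom in arithmetic. *)
Definition absorb_const : R := locked (648 * 16).

Lemma absorb_const_gt0 : 0 < absorb_const.
Proof. rewrite /absorb_const -lock; apply: mulr_gt0; rewrite ltr0n; exact: isT. Qed.

Lemma cut_absorb (p s c : R) : p <= 648 * (1 + s ^+ 2) ^+ 4 ->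
  (1 + s ^+ 2) ^+ 4 * c ^+ 2 <= 16 -> p * c ^+ 2 <= absorb_const.
Proof.
move=> ps h; apply: (@le_trans _ _ (648 * (1 + s ^+ 2) ^+ 4 * c ^+ 2)).
  by rewrite ler_wpM2r// sqr_ge0.
rewrite /absorb_const -lock -mulrA; apply: ler_wpM2l h; exact: ler0n.
Qed.

Let A0 := absorb_const_gt0.

(** With s = e lg y, the integrand is at most a multiple of e, times the kernel e lg' /
    (1 + s)^2, times s^2 (1 + s)^2 cut^2, and the square of the cutoff absorbs the
    polynomial. *)
Lemma integral_dcut_sqr e : 0 < e ->
  (\int[mu]_(y in pos) (y * dcut e y ^+ 2)%:E <= (absorb_const * 8 * e)%:E)%E.
Proof.
move=> e0; apply: (@integral_le_log_kernel e) => //.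
- by rewrite !mulr_ge0// ltW.
- apply: measurable_cts => y; apply: cvgM; first exact: cvg_id.
  by apply: continuous_sqr; exact: continuous_dcut.
- by move=> y y0; rewrite mulr_ge0 ?sqr_ge0// ltW.
move=> y y0; have l0 := lg_ge0 y; have r0 := bracketV_gt0 y; have c0 := cut_gt0 e y.
rewrite /dcut; set r := (bracket y)^-1 in r0 *; set L := lg y in l0 *; set c := cut e y in c0 *.
have s0 : 0 <= e * L by rewrite mulr_ge0// ltW.
have h : (e * L) ^+ 2 * (1 + e * L) ^+ 2 * c ^+ 2 <= absorb_const.
  by apply: (cut_absorb _ (cut_poly_le e y)); rewrite -/L; nra.
have q1 : y ^+ 2 * r <= 1 by exact: sqr_bracketV_le1.
have k0 : 0 <= 16 * e ^+ 2 * y * r by rewrite !mulr_ge0// ltW// exprn_gt0.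
rewrite (_ : _ * _ * _ = (16 * e ^+ 2 * y * r) *
  (((e * L) ^+ 2 * (1 + e * L) ^+ 2 * c ^+ 2) * (y ^+ 2 * r))); last by ring.
rewrite (_ : absorb_const * 8 * e * _ = (16 * e ^+ 2 * y * r) * (absorb_const * 1)); last by ring.
apply: ler_wpM2l => //; apply: ler_pM => //.
- by rewrite -!exprMn sqr_ge0.
- by rewrite mulr_ge0 ?sqr_ge0// ltW.
Qed.

(** The factor lg y = s / e uses up the gain e of integral_dcut_sqr: the integral stays
    bounded but does not become small. *)
Lemma integral_dcut_sqr_lg e : 0 < e ->
  (\int[mu]_(y in pos) (y * (dcut e y ^+ 2 * lg y))%:E <= (absorb_const * 8)%:E)%E.
Proof.
move=> e0; apply: (@integral_le_log_kernel e) => //.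
- by rewrite mulr_ge0// ltW.
- apply: measurable_cts => y; apply: cvgM; first exact: cvg_id.
  apply: cvgM; last exact: Cn1_continuous (Cn1_lg 0) y.
  by apply: continuous_sqr; exact: continuous_dcut.
- move=> y y0; apply: mulr_ge0; first exact: ltW.
  by apply: mulr_ge0; [exact: sqr_ge0|exact: lg_ge0].
move=> y y0; have l0 := lg_ge0 y; have r0 := bracketV_gt0 y; have c0 := cut_gt0 e y.
rewrite /dcut; set r := (bracket y)^-1 in r0 *; set L := lg y in l0 *; set c := cut e y in c0 *.
have s0 : 0 <= e * L by rewrite mulr_ge0// ltW.
have h : (e * L) ^+ 3 * (1 + e * L) ^+ 2 * c ^+ 2 <= absorb_const.
  apply: (cut_absorb _ (cut_poly_le e y)); rewrite -/L; move: (e * L) s0 => s s0.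
  have h1 : (1 + s) ^+ 2 <= 2 * (1 + s ^+ 2) by have := sqr_ge0 (1 - s); lra.
  have h2 : s ^+ 3 <= (1 + s ^+ 2) ^+ 2.
    by have := sqr_ge0 (s * (s - 1)); have := sqr_ge0 (s ^+ 2); have := sqr_ge0 s; lra.
  have h3 : s ^+ 3 * (1 + s) ^+ 2 <= (1 + s ^+ 2) ^+ 2 * (2 * (1 + s ^+ 2)).
    by apply: ler_pM => //; [exact: exprn_ge0|exact: sqr_ge0].
  apply: (le_trans h3); set t := 1 + s ^+ 2.
  have t1 : 1 <= t by rewrite lerDl sqr_ge0.
  have t3 : 0 <= t ^+ 3 by apply: exprn_ge0; lra.
  rewrite (_ : t ^+ 2 * _ = 2 * t ^+ 3); last by ring.
  by rewrite (_ : t ^+ 4 = t ^+ 3 * t); [nra|ring].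
have q1 : y ^+ 2 * r <= 1 by exact: sqr_bracketV_le1.
have k0 : 0 <= 16 * e * y * r by rewrite !mulr_ge0// ltW// exprn_gt0.
rewrite (_ : _ * _ * _ = (16 * e * y * r) *
  (((e * L) ^+ 3 * (1 + e * L) ^+ 2 * c ^+ 2) * (y ^+ 2 * r))); last by ring.
rewrite (_ : absorb_const * 8 * _ = (16 * e * y * r) * (absorb_const * 1)); last by ring.
apply: ler_wpM2l => //; apply: ler_pM => //.
- by apply: mulr_ge0; [apply: mulr_ge0; [exact: exprn_ge0|exact: sqr_ge0]|exact: sqr_ge0].
- by rewrite mulr_ge0 ?sqr_ge0// ltW.
Qed.

(** Up to the common factor e cut / bracket y, the terms of cut'' are multiples of e q,
    e L (r - q) and (e L)^2 (e q), where L = lg y, r = 1 / bracket y and q = y^2 r <= 1.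
    *)
Lemma ddcut_sqr_le e y : 0 < e <= 1 ->
  ddcut e y ^+ 2 <= (e * (bracket y)^-1 * (8 + 4 * (e * lg y) + 16 * (e * lg y) ^+ 2)) ^+ 2
                    * cut e y ^+ 2.
Proof.
move=> /andP[e0 e1]; have l0 := lg_ge0 y; have r0 := bracketV_gt0 y.
rewrite /ddcut /dcut; set r := (bracket y)^-1 in r0 *; set L := lg y in l0 *; set c := cut e y.
have q1 : y ^+ 2 * r <= 1 by exact: sqr_bracketV_le1.
have q0 : 0 <= y ^+ 2 * r by rewrite mulr_ge0 ?sqr_ge0// ltW.
have r1 : r <= 1 by exact: bracketV_le1.
pose q := y ^+ 2 * r.
pose p := 2 * e * (4 * q + 2 * L * (r - q) - 8 * (e * L) ^+ 2 * q).
have E : - (2 * e ^+ 2 * ((2 * y * r) ^+ 2 * c + L * (2 * (1 - y ^+ 2) * r ^+ 2) * c +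
    L * (2 * y * r) * - (2 * e ^+ 2 * L * (2 * y * r) * c))) = - (e * r * p * c).
  by rewrite /p /q; ring.
rewrite E sqrrN exprMn ler_wpM2r ?sqr_ge0//.
rewrite [leLHS]exprMn [leRHS]exprMn; apply: ler_wpM2l; first exact: sqr_ge0.
rewrite -[leLHS]real_normK ?num_real// lerXn2r ?nnegrE ?normr_ge0//.
  by have := sqr_ge0 (e * L); have := mulr_ge0 (ltW e0) l0; lra.
have s0 : 0 <= e * L by rewrite mulr_ge0// ltW.
rewrite -/q in q0 q1.
have a1 : e * q <= 1 by apply: mulr_ile1 => //; exact: ltW.
have a0 : 0 <= e * q by rewrite mulr_ge0// ltW.
have b1 : - (e * L) <= e * L * (r - q) <= e * L.
  have d1 : r - q <= 1 by lra.
  have d0 : -1 <= r - q by lra.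
  by apply/andP; split; nra.
have c1 : 0 <= (e * L) ^+ 2 * (e * q) <= (e * L) ^+ 2.
  by rewrite mulr_ge0 ?sqr_ge0//= ler_piMr ?sqr_ge0.
have -> : p = 8 * (e * q) + 4 * (e * L * (r - q)) - 16 * ((e * L) ^+ 2 * (e * q)).
  by rewrite /p; ring.
move: b1 c1 => /andP[b1 b2] /andP[c0 c1].
by rewrite ler_norml; apply/andP; split; lra.
Qed.

Lemma integral_ddcut_sqr e : 0 < e <= 1 ->
  (\int[mu]_(y in pos) (y * (y ^+ 2 * ddcut e y ^+ 2))%:E <= (absorb_const * 8 * e)%:E)%E.
Proof.
move=> e01; have /andP[e0 e1] := e01; apply: (@integral_le_log_kernel e) => //.
- by rewrite !mulr_ge0// ltW.
- apply: measurable_cts => y; apply: cvgM; first exact: cvg_id.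
  apply: cvgM; first by apply: cvgM; exact: cvg_id.
  by apply: continuous_sqr; exact: continuous_ddcut.
- by move=> y y0; apply: mulr_ge0; [exact: ltW|rewrite -exprMn sqr_ge0].
move=> y y0; have l0 := lg_ge0 y; have r0 := bracketV_gt0 y; have := ddcut_sqr_le y e01.
set r := (bracket y)^-1 in r0 *; set L := lg y in l0 *; set c := cut e y => hdd.
have s0 : 0 <= e * L by rewrite mulr_ge0// ltW.
set q := 8 + _ + _ in hdd.
have h : q ^+ 2 * (1 + e * L) ^+ 2 * c ^+ 2 <= absorb_const.
  apply: (cut_absorb _ (cut_poly_le e y)); rewrite -/L /q; move: (e * L) s0 => s s0.
  have h1 : (1 + s) ^+ 2 <= 2 * (1 + s ^+ 2) by have := sqr_ge0 (1 - s); lra.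
  have h2 : 8 + 4 * s + 16 * s ^+ 2 <= 18 * (1 + s ^+ 2) by have := sqr_ge0 (1 - s); lra.
  have h3 : (8 + 4 * s + 16 * s ^+ 2) ^+ 2 <= (18 * (1 + s ^+ 2)) ^+ 2.
    by rewrite lerXn2r ?nnegrE//; have := sqr_ge0 s; lra.
  have h4 : (8 + 4 * s + 16 * s ^+ 2) ^+ 2 * (1 + s) ^+ 2 <= (18 * (1 + s ^+ 2)) ^+ 2 * (2 * (1 + s ^+ 2)).
    by apply: ler_pM => //; exact: sqr_ge0.
  apply: (le_trans h4); set t := 1 + s ^+ 2.
  have t1 : 1 <= t by rewrite lerDl sqr_ge0.
  have t3 : 0 <= t ^+ 3 by apply: exprn_ge0; lra.
  rewrite (_ : (18 * t) ^+ 2 * _ = 648 * t ^+ 3); last by ring.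
  by rewrite (_ : t ^+ 4 = t ^+ 3 * t); [nra|ring].
have q1 : y ^+ 2 * r <= 1 by exact: sqr_bracketV_le1.
have k0 : 0 <= e ^+ 2 * y * r by rewrite !mulr_ge0 ?sqr_ge0// ltW.
apply: (@le_trans _ _ (e ^+ 2 * y * r * ((q ^+ 2 * (1 + e * L) ^+ 2 * c ^+ 2) * (y ^+ 2 * r)))).
  rewrite (_ : e ^+ 2 * y * r * _ = y * (y ^+ 2 * ((e * r * q) ^+ 2 * c ^+ 2)) * (1 + e * L) ^+ 2); last by ring.
  rewrite ler_wpM2r ?sqr_ge0// ler_wpM2l ?(ltW y0)// ler_wpM2l ?sqr_ge0//.
apply: (@le_trans _ _ (e ^+ 2 * y * r * (absorb_const * 1))).
  apply: ler_wpM2l => //; apply: ler_pM => //.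
  - by rewrite -!exprMn sqr_ge0.
  - by rewrite mulr_ge0 ?sqr_ge0// ltW.
have -> : absorb_const * 8 * e * (e * (2 * y * r)) = e ^+ 2 * y * r * (absorb_const * 16) by ring.
by apply: ler_wpM2l => //; have := A0; lra.
Qed.

(** Finiteness for each e, from cut_decay, without uniformity in e: these constants are
    beaten later by the choice of the stream function. *)
Lemma cut_tail e : 0 < e -> exists2 I : R, 0 <= I &
  [/\ (\int[mu]_(y in pos) (y ^+ 2 * cut e y ^+ 2)%:E <= I%:E)%E,
      forall y, 0 < y -> y * cut e y ^+ 2 <= I &
      (\int[mu]_(y in pos) (y * (dcut e y ^+ 2 * (y + y ^+ 3)))%:E <= I%:E)%E].
Proof.
move=> e0; have [C C0 hC] := cut_decay 3 e0.
exists (16 * e ^+ 2 * C + C); first by rewrite addr_ge0 ?mulr_ge0 ?sqr_ge0// ltW.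
have key y : 0 < y -> y * cut e y <= C * (bracket y)^-1 * (bracket y)^-1.
  move=> y0; apply: (le_trans (ler_wpM2l (ltW y0) (hC y))).
  have r0 := bracketV_gt0 y.
  set r := (bracket y)^-1 in r0 *.
  rewrite [leLHS](_ : _ = C * r * r * (y * r)); last by ring.
  rewrite ler_piMr//; first by rewrite !mulr_ge0// ltW.
  have := bracketVE y; rewrite {1}/bracket -/r; have := sqr_ge0 (1 - y); nra.
have key2 y : 0 < y -> y * cut e y ^+ 2 <= C * (bracket y)^-1 * (bracket y)^-1.
  move=> y0; apply: le_trans (key _ y0); rewrite ler_wpM2l ?(ltW y0)//.
  by rewrite expr2 ler_piMr ?cut_le1// ltW// cut_gt0.
split.
- apply: integral_le_poly_kernel.
  + by rewrite addr_ge0 ?mulr_ge0 ?sqr_ge0// ltW.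
  + apply: measurable_cts => y; apply: cvgM; first by apply: cvgM; exact: cvg_id.
    by apply: continuous_sqr; exact: continuous_cut.
  + by move=> y y0; rewrite mulr_ge0 ?sqr_ge0.
  + move=> y y0; have r0 := bracketV_gt0 y.
    rewrite expr2 -mulrA; apply: (le_trans (ler_wpM2l (ltW y0) (key2 _ y0))).
    have : 0 <= y * (bracket y)^-1 * (bracket y)^-1 by rewrite !mulr_ge0// ltW.
    have : 0 <= e ^+ 2 by exact: sqr_ge0.
    set r := (bracket y)^-1; set a := e ^+ 2; move=> a0 yr0.
    rewrite [leLHS](_ : _ = C * (y * r * r)); last by ring.
    rewrite [leRHS](_ : _ = (16 * a * C + C) * 2 * (y * r * r)); last by ring.
    rewrite ler_wpM2r//; nra.
- move=> y y0; apply: (le_trans (key2 _ y0)); have r0 := bracketV_gt0 y.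
  have r1 := bracketV_le1 y.
  apply: (@le_trans _ _ C); last by rewrite lerDr mulr_ge0 ?mulr_ge0 ?sqr_ge0// ltW.
  rewrite -mulrA ler_piMr ?(ltW C0)// mulr_ile1// ltW//.
apply: integral_le_poly_kernel.
- by rewrite addr_ge0 ?mulr_ge0 ?sqr_ge0// ltW.
- apply: measurable_cts => y; apply: cvgM; first exact: cvg_id.
  apply: cvgM; first by apply: continuous_sqr; exact: continuous_dcut.
  apply: cvgD; first exact: cvg_id.
  by apply: cvgM; [exact: cvg_id|apply: cvgM; exact: cvg_id].
- move=> y y0; apply: mulr_ge0; first exact: ltW.
  by apply: mulr_ge0; [exact: sqr_ge0|apply: addr_ge0; [exact: ltW|exact/exprn_ge0/ltW]].
move=> y y0; have l0 := lg_ge0 y; have r0 := bracketV_gt0 y; have c0 := cut_gt0 e y.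
have sc : (e * lg y) ^+ 2 * cut e y <= 1.
  rewrite /cut expRN ler_pdivrMr ?expR_gt0// mul1r.
  by apply: le_trans (expR_ge1Dx _); rewrite lerDr.
have ky := key _ y0; have br := bracketVE y.
rewrite /dcut; set r := (bracket y)^-1 in r0 ky br *; set L := lg y in l0 sc *.
set c := cut e y in c0 sc ky *.
rewrite [leLHS](_ : _ = 16 * e ^+ 2 * (y * (y * c)) * (((e * L) ^+ 2 * c) * (y ^+ 2 * r) * (bracket y * r))); last first.
  by rewrite [in RHS]/bracket; ring.
have q1 : y ^+ 2 * r <= 1 by exact: sqr_bracketV_le1.
have q0 : 0 <= y ^+ 2 * r by rewrite mulr_ge0 ?sqr_ge0// ltW.
have e2 : 0 <= e ^+ 2 by exact: sqr_ge0.
have yc0 : 0 <= y * c by rewrite mulr_ge0// ltW.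
apply: (@le_trans _ _ (16 * e ^+ 2 * (y * (y * c)))).
  rewrite ler_piMr//; first by rewrite !mulr_ge0// ltW.
  rewrite br mulr1 mulr_ile1//.
  by rewrite mulr_ge0 ?sqr_ge0// ltW.
apply: (@le_trans _ _ (16 * e ^+ 2 * (y * (C * r * r)))).
  by rewrite !ler_wpM2l ?mulr_ge0// ltW.
have z0 : 0 <= y * r * r by rewrite !mulr_ge0// ltW.
rewrite [leLHS](_ : _ = 16 * e ^+ 2 * C * (y * r * r)); last by ring.
rewrite [leRHS](_ : _ = (16 * e ^+ 2 * C + C) * 2 * (y * r * r)); last by ring.
by rewrite ler_wpM2r//; nra.
Qed.

End Cutoff.

(** * Supremum norms on slices *)

Section SliceSup.
Context {R : realType}.
Local Notation mu := (@lebesgue_measure R).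
Local Notation T := (measurableTypeR R).
Local Notation hp := (@half_plane R : set (@plane R)).
Local Notation pos := (`]0%R, +oo[%classic : set T).
Implicit Types (G f w u psi : R * R -> R) (F : R -> R) (x y : R) (z : R * R).

(** The essential supremum of a slice exceeds r when the section of the set h > r has
    positive measure, and the measure of a section is measurable in y. *)
Lemma measurable_ess_sup_slice (h : @plane R -> \bar R) : measurable_fun hp h ->
  measurable_fun pos (fun y => ess_sup mu (fun x => h (x, y))).
Proof.
move=> mh; apply: (measurability _ (ErealGenOInfty.measurableE R)) => //.
move=> _ [_ [r ->] <-].
pose A : set (@plane R) := hp `&` [set z | (r%:E < h z)%E].
have mA : measurable A.
  have := mh measurable_half_plane `]r%:E, +oo[%classic (emeasurable_itv _).
  by congr (measurable (_ `&` _)); apply/seteqP; split => z /=; rewrite in_itv /= andbT.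
have mS := measurable_fun_ysection mu mA.
have := mS measurableT `]0%E, +oo[%classic (emeasurable_itv _).
rewrite setTI => /(measurableI _ _ (measurable_itv `]0%R, +oo[)); congr (measurable _).
apply/seteqP; split => y [y0] /=; rewrite !in_itv /= !andbT; rewrite /= in_itv /= andbT in y0.
- move=> my; split => //.
  rewrite ltNge; apply/negP => /ess_supP[N [mN N0 sub]].
  move: my; apply/negP; rewrite -leNgt -N0.
  apply: le_measure; rewrite ?inE//.
    exact: measurable_ysection.
  move=> x; rewrite /ysection /= inE => -[_ /= rx]; apply: sub => /=.
  by apply/negP; rewrite -ltNge.
- move=> rs; split => //.
  rewrite lt_neqAle measure_ge0 andbT eq_sym; apply/negP => /eqP A0.
  move: rs; apply/negP; rewrite -leNgt; apply/ess_supP.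
  exists (ysection A y); split => //; first exact: measurable_ysection.
  move=> x /= /negP; rewrite -ltNge => rx; rewrite /ysection /= inE; split => //.
Qed.

(** F t stands for the supremum norm of f on the slice of height t; squares match the L2
    bounds. *)
Definition slice_dominated f F :=
  {ae mu, forall t : T, 0 < t -> {ae mu, forall s : T, f (s, t) ^+ 2 <= F t ^+ 2}}.

Lemma integral_slice_dominated G f F : measurable_fun hp G -> (forall z, hp z -> 0 <= G z) ->
  measurable_fun hp f -> measurable_fun pos F -> slice_dominated f F ->
  (\int[leb2]_(z in hp) (G z * f z ^+ 2)%:E <=
   \int[leb2]_(z in hp) (G z * F z.2 ^+ 2)%:E)%E.
Proof.
move=> mG G0 mf mF fF.
have m1 : measurable_fun hp (fun z => (G z * f z ^+ 2)%:E).
  by apply/measurable_EFinP; apply: measurable_funM => //; exact: measurable_funX.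
have mF2 : measurable_fun hp (fun z => F z.2).
  by apply/measurable_EFinP; apply: (@measurable_snd_hp _ (EFin \o F)); exact/measurable_EFinP.
have m2 : measurable_fun hp (fun z => (G z * F z.2 ^+ 2)%:E).
  by apply/measurable_EFinP; apply: measurable_funM => //; exact: measurable_funX.
have p1 z : hp z -> (0 <= (G z * f z ^+ 2)%:E)%E.
  by move=> z0; rewrite lee_fin mulr_ge0 ?G0 ?sqr_ge0.
have p2 z : hp z -> (0 <= (G z * F z.2 ^+ 2)%:E)%E.
  by move=> z0; rewrite lee_fin mulr_ge0 ?G0 ?sqr_ge0.
rewrite (int_hp m1 p1) (int_hp m2 p2); apply: ae_ge0_le_integral => //.
- by move=> y /=; rewrite in_itv /= andbT => y0; apply: integral_ge0 => x _; exact: p1.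
- exact: measurable_slice_int m1 p1.
- by move=> y /=; rewrite in_itv /= andbT => y0; apply: integral_ge0 => x _; exact: p2.
- exact: measurable_slice_int m2 p2.
apply: (filterS _ fF) => y fy /=; rewrite in_itv /= andbT => y0; apply: ae_ge0_le_integral => //.
- by move=> x _; exact: p1.
- exact: measurable_hslice m1.
- by move=> x _; exact: p2.
- exact: measurable_hslice m2.
apply: filterS (fy y0) => x fx _; rewrite lee_fin ler_wpM2l//.
by apply: G0; rewrite /half_plane.
Qed.

Lemma frobenius_row_ge (r : 'rV[R]_2) j : r ord0 j ^+ 2 <= frobenius r ^+ 2.
Proof.
rewrite /frobenius sqr_sqrtr; last by apply: sumr_ge0 => a _; apply: sumr_ge0 => b _; exact: sqr_ge0.
rewrite big_ord1 (bigD1 j)//= lerDl; apply: sumr_ge0 => b _; exact: sqr_ge0.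
Qed.

(** F is the supremum norm of the slice, which the integrability of y F^2 makes finite
    for almost every y; elsewhere fine replaces it by 0. *)
Lemma exists_slice_bound (v : R * R -> 'rV[R]_2) :
  (forall i, measurable_fun hp (coord_fun v i)) ->
  (\int[mu]_(y in `]0%R, +oo[) (y%:E * slice_Loo v y ^+ 2) < +oo)%E ->
  exists F, [/\ measurable_fun pos F,
    exists S : R, (\int[mu]_(y in pos) (y * F y ^+ 2)%:E <= S%:E)%E &
    forall i, slice_dominated (coord_fun v i) F].
Proof.
move=> mv vX.
have mfr : measurable_fun hp (fun z => (frobenius (v z))%:E).
  apply/measurable_EFinP.
  have : measurable_fun hp (fun z => coord_fun v 0 z ^+ 2 + coord_fun v 1 z ^+ 2).
    by apply: measurable_funD; exact: measurable_funX.
  move/(measurableT_comp (continuous_measurable_fun (@sqrt_continuous R))).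
  apply: eq_measurable_fun => z _ /=.
  by rewrite /frobenius big_ord1 big_ord_recl big_ord1 /coord_fun; congr (Num.sqrt (_ + v z _ _ ^+ 2)); apply: val_inj.
have muT : (0 < mu [set: R])%E.
  by rewrite -set_itvE lebesgue_measure_itv /= ltry.
have sE y : slice_Loo v y = ess_sup mu (fun x => (frobenius (v (x, y)))%:E).
  rewrite /slice_Loo unlock muT; congr ess_sup; apply/funext => x /=.
  by rewrite ger0_norm ?sqrtr_ge0.
have ms : measurable_fun pos (slice_Loo v).
  have := measurable_ess_sup_slice mfr.
  by apply: eq_measurable_fun => y _; rewrite sE.
have s0 y : (0 <= slice_Loo v y)%E by exact: Lnorm_ge0.
have e2 y : (slice_Loo v y ^+ 2 = slice_Loo v y * slice_Loo v y)%E by [].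
have mF : measurable_fun pos (fun y => fine (slice_Loo v y)).
  by apply: measurableT_comp => //; exact: fine_measurable.
have ms2 : measurable_fun pos (fun y => y%:E * slice_Loo v y ^+ 2)%E.
  apply: emeasurable_funM; first by apply/measurable_EFinP.
  exact: (emeasurable_funM ms ms).
have p2 y : pos y -> (0 <= y%:E * slice_Loo v y ^+ 2)%E.
  by rewrite /= in_itv /= andbT => y0; apply: mule_ge0; [rewrite lee_fin ltW|exact: mule_ge0].
have I0 : (0 <= \int[mu]_(y in pos) (y%:E * slice_Loo v y ^+ 2))%E by exact: integral_ge0.
exists (fun y => fine (slice_Loo v y)); split => //.
  exists (fine (\int[mu]_(y in pos) (y%:E * slice_Loo v y ^+ 2))).
  rewrite fineK ?ge0_fin_numE//; apply: ge0_le_integral => //.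
  - by move=> y; rewrite /= in_itv /= andbT => y0; rewrite lee_fin mulr_ge0 ?sqr_ge0// ltW.
  - by apply/measurable_EFinP; apply: measurable_funM => //; exact: measurable_funX.
  move=> y; rewrite /= in_itv /= andbT => y0; rewrite EFinM; apply: lee_wpmul2l.
    by rewrite lee_fin ltW.
  by case: (slice_Loo v y) (s0 y) => [r||] //= _; rewrite ?expr0n ?mulyy ?leey// -EFinM expr2.
move=> i.
have /integrable_ae : mu.-integrable pos (fun y => y%:E * slice_Loo v y ^+ 2)%E.
  apply/integrableP; split => //; under eq_integral => y yp.
    by rewrite gee0_abs; [over|apply: p2; rewrite inE in yp].
  exact: vX.
move=> /(_ (measurable_itv _)); apply: filterS => y; rewrite /= in_itv /= andbT => yfin y0.
have {}yfin : slice_Loo v y \is a fin_num.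
  move: (yfin y0) (s0 y); case: (slice_Loo v y) => [r||] //.
  by rewrite /= mulyy gt0_muley ?lte_fin.
have := @ess_sup_ge _ _ _ mu (fun x => (frobenius (v (x, y)))%:E).
apply: filterS => x; rewrite -sE => h.
apply: (le_trans (frobenius_row_ge _ i)).
rewrite lerXn2r ?nnegrE ?fine_ge0 ?sqrtr_ge0//.
by rewrite -lee_fin fineK.
Qed.

End SliceSup.

(** * Logarithmic growth of the stream functions *)

Section Growth.
Context {R : realType}.
Local Notation mu := (@lebesgue_measure R).
Local Notation T := (measurableTypeR R).
Local Notation hp := (@half_plane R : set (@plane R)).
Local Notation pos := (`]0%R, +oo[%classic : set T).
Local Notation d2 := (partial 1%R).
Implicit Types (f w u psi : R * R -> R) (F : R -> R) (x y : R) (z : R * R).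

Lemma partialB i f w : smooth f -> smooth w -> partial i (f - w) = partial i f - partial i w.
Proof.
move=> sf sw; apply/funext => z; rewrite /partial deriveB//; exact: smooth_derivable.
Qed.

(** For a stream function, the second derivatives are, up to sign, the entries of the
    gradient of its velocity field. *)
Definition energy_le f (E : R) :=
  forall i j, (sqint (partial j (partial i f)) <= E%:E)%E.

Lemma integral_rect_dominated f F (p q a y : R) (delta : R) : p < q -> 0 < a -> a < y ->
  measurable_fun hp f -> measurable_fun pos F -> slice_dominated f F ->
  (\int[mu]_(s in `[a, +oo[) (s * F s ^+ 2)%:E <= delta%:E)%E ->
  (\int[leb2]_(z in (`[p, q] `*` `[a, y] : set (@plane R))) (z.2 * f z ^+ 2)%:E
     <= ((q - p) * delta)%:E)%E.
Proof.
move=> pq a0 ay mf mF fF hd.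
set D : set (@plane R) := `[p, q] `*` `[a, y].
have mD : measurable D by exact: measurableX.
have Dhp : D `<=` hp.
  by move=> [s t] [_ /=]; rewrite in_itv /= => /andP[at_ _]; apply: lt_le_trans at_.
have D0 z : D z -> 0 <= z.2 by move=> /Dhp /ltW.
have mz : measurable_fun hp (fun z : plane => z.2).
  exact: (measurable_funS measurableT (@subsetT _ hp) (@measurable_snd _ _ T T)).
have mF2 : measurable_fun hp (fun z => F z.2).
  by apply/measurable_EFinP; apply: (@measurable_snd_hp _ (EFin \o F)); exact/measurable_EFinP.
pose G : R * R -> R := fun z => z.2 * \1_D z.
have GE g : (\int[leb2]_(z in D) (z.2 * g z ^+ 2)%:E =
             \int[leb2]_(z in hp) (G z * g z ^+ 2)%:E)%E.
  rewrite -[in LHS](setIidr Dhp) integral_mkcondr; apply: eq_integral => z _.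
  rewrite patchE /G indicE; case: ifPn => _; rewrite ?mulr1 ?mulr0 ?mul0r//.
have mG : measurable_fun hp G.
  apply: measurable_funM => //; exact: (measurable_funS measurableT (@subsetT _ hp) (measurable_indic mD)).
have G0 z : hp z -> 0 <= G z by move=> z0; rewrite mulr_ge0 ?(ltW z0)// indicE.
rewrite GE; apply: (le_trans (integral_slice_dominated mG G0 mf mF fF)).
rewrite -(GE (fun z => F z.2)).
have mh : measurable_fun D (fun z => (z.2 * F z.2 ^+ 2)%:E).
  apply: (measurable_funS measurable_half_plane Dhp).
  by apply/measurable_EFinP; apply: measurable_funM => //; exact: measurable_funX.
have h0 z : D z -> (0 <= (z.2 * F z.2 ^+ 2)%:E)%E.
  by move=> /D0 z0; rewrite lee_fin mulr_ge0 ?sqr_ge0.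
have [-> _] := int_rect_swap (measurable_itv `[p, q]) (measurable_itv `[a, y]) mh h0.
have apos : `[a, +oo[%classic `<=` pos.
  by move=> s /=; rewrite !in_itv /= !andbT; apply: lt_le_trans.
have mF3 : measurable_fun pos (fun s => (s * F s ^+ 2)%:E).
  by apply/measurable_EFinP; apply: measurable_funM => //; exact: measurable_funX.
have aay : `[a, y]%classic `<=` `[a, +oo[%classic.
  by move=> s /=; rewrite !in_itv /= andbT => /andP[].
have F0 s : `[a, +oo[%classic s -> (0 <= (s * F s ^+ 2)%:E)%E.
  by move=> /apos /=; rewrite in_itv /= andbT => s0; rewrite lee_fin mulr_ge0 ?sqr_ge0// ltW.
rewrite (eq_integral (fun s : T => (q - p)%:E * (s * F s ^+ 2)%:E))%E; last first.
  by move=> s _; rewrite /= integral_cst//= lebesgue_measure_itv /= lte_fin pq -EFinB muleC.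
rewrite ge0_integralZl//; last 3 first.
- by apply: (measurable_funS _ (subset_trans aay apos)).
- by move=> s /aay; exact: F0.
- by rewrite lee_fin subr_ge0 ltW.
rewrite EFinM; apply: lee_wpmul2l; first by rewrite lee_fin subr_ge0 ltW.
apply: le_trans hd; apply: ge0_subset_integral => //.
exact: (measurable_funS _ apos).
Qed.

(** Write psi_k (y) = (psi_k - psi_j) (y) + psi_j (a) + (psi_j (y) - psi_j (a)) on a
    vertical line. The first two terms are bounded by stream_sup_le. By
    sqrB_le_integral_deriv the square of the last is at most ln y - ln a times the
    integral of s (d2 psi_j)^2 over [a, y], in which d2 psi_j may be replaced by v1,
    hence by F, when j tends to infinity. The convergence to v1 being in L2_loc, this is
    done in the mean over x in [p, q]; continuity of psi_k in x gives back the pointwise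
    bound. *)
Lemma stream_growth (psi : nat -> R * R -> R) (v1 : R * R -> R) F (C delta a : R) (r : nat -> R) k x y :
  (forall j, csmooth (psi j)) -> (forall j, energy_le (psi j) C) ->
  (forall k j, energy_le (psi k - psi j) (2 * r k + 2 * r j)) -> r @ \oo --> (0 : R) ->
  measurable_fun hp v1 -> loc_cvg (fun j => d2 (psi j)) v1 ->
  measurable_fun pos F -> slice_dominated v1 F ->
  0 < a -> a < y -> (\int[mu]_(s in `[a, +oo[) (s * F s ^+ 2)%:E <= delta%:E)%E ->
  psi k (x, y) ^+ 2 <=
    4 * ((y + y ^+ 3) * (2 * r k) + (a + a ^+ 3) * C + (ln y - ln a) * (2 * delta)).
Proof.
move=> cp eC er r0 mv pv mF vF a0 ay hd.
have y0 := lt_trans a0 ay.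
set l := ln y - ln a; have l0 : 0 < l by rewrite subr_gt0 ltr_ln.
apply: (@le_of_mean_le _ (fun x => psi k (x, y) ^+ 2)).
  by move=> t; apply: continuous_sqr; exact/continuous_hslice/smooth_continuous/(cp k).1.
move=> p q pq; apply/lee_addgt0Pr => d d0.
have qp : 0 < q - p by rewrite subr_gt0.
have y3 : 0 < y + y ^+ 3 by rewrite addr_gt0// exprn_gt0.
set D : set (@plane R) := `[p, q] `*` `[a, y].
have mD : measurable D by exact: measurableX.
have Dhp : D `<=` hp.
  by move=> [s t] [_ /=]; rewrite in_itv /= => /andP[at_ _]; apply: lt_le_trans at_.
set B := Num.max (Num.max `|p| `|q|) (Num.max y a^-1).
have B0 : 0 < B by rewrite !lt_max y0 !orbT.
have DB : D `<=` box B.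
  move=> [s t] [/=]; rewrite !in_itv /= => /andP[ps sq] /andP[at_ ty].
  have pB : `|p| <= B by rewrite !le_max lexx.
  have qB : `|q| <= B by rewrite !le_max lexx !orbT.
  have yB : y <= B by rewrite !le_max lexx !orbT.
  have aB : a^-1 <= B by rewrite !le_max lexx !orbT.
  move: pB qB; rewrite !ler_norml => /andP[p1 p2] /andP[q1 q2].
  split; rewrite /= in_itv /=; apply/andP; split; try lra.
  by apply: le_trans at_; rewrite -[leRHS]invrK lef_pV2 ?posrE ?invr_gt0.
(* The errors of d2 psi_j and of r j that each contribute d / 2 to the final bound. *)
set e := d / 2 / (8 * l * y).
have e0 : 0 < e by rewrite !divr_gt0// !mulr_gt0.
set e' := d / 2 / (8 * (q - p) * (y + y ^+ 3)).
have e'0 : 0 < e' by rewrite !divr_gt0// !mulr_gt0.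
have [j [rj pvj]] : exists j, r j <= e' /\
    (\int[leb2]_(z in box B) ((d2 (psi j) z - v1 z) ^+ 2)%:E <= e%:E)%E.
  have H1 : \forall k \near \oo, r k <= e'.
    move/cvgrPdist_le : r0 => /(_ _ e'0); apply: filterS => n.
    by rewrite sub0r normrN => h; apply: le_trans (ler_norm _) h.
  have H2 := pv B e B0 e0.
  by have [n _ H] := filterI H1 H2; exists n; exact: (H n (leqnn n)).
have md2 : measurable_fun hp (d2 (psi j)).
  exact: (csmooth_meas (csmooth_partial 1 (cp j))).
have mdiff : measurable_fun D (fun z => ((d2 (psi j) z - v1 z) ^+ 2)%:E).
  apply: (measurable_funS measurable_half_plane Dhp).
  by apply: measurable_sqr; exact: measurable_funB.
have pvD : (\int[leb2]_(z in D) ((d2 (psi j) z - v1 z) ^+ 2)%:E <= e%:E)%E.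
  apply: le_trans pvj; apply: ge0_subset_integral => //; first exact: measurable_box.
    apply: (measurable_funS measurable_half_plane (box_hp B0)).
    by apply: measurable_sqr; exact: measurable_funB.
  by move=> z _; exact: sqr_ge0E.
have mz : measurable_fun hp (fun z : plane => z.2).
  exact: (measurable_funS measurableT (@subsetT _ hp) (@measurable_snd _ _ T T)).
have mzf f : measurable_fun hp f -> measurable_fun D (fun z => (z.2 * f z ^+ 2)%:E).
  move=> mf; apply: (measurable_funS measurable_half_plane Dhp).
  by apply/measurable_EFinP; apply: measurable_funM => //; exact: measurable_funX.
have zf0 f z : D z -> (0 <= (z.2 * f z ^+ 2)%:E)%E.
  by move=> /Dhp /ltW z0; rewrite lee_fin mulr_ge0 ?sqr_ge0.
have main : (\int[leb2]_(z in D) (z.2 * d2 (psi j) z ^+ 2)%:E <=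
    (2 * y * e + 2 * ((q - p) * delta))%:E)%E.
  apply: (@le_trans _ _ ((2 * y)%:E * \int[leb2]_(z in D) ((d2 (psi j) z - v1 z) ^+ 2)%:E +
     2%:E * \int[leb2]_(z in D) (z.2 * v1 z ^+ 2)%:E)%E).
    rewrite -ge0_integralZl//; last 2 first.
    - by move=> z _; exact: sqr_ge0E.
    - by rewrite lee_fin mulr_ge0// ltW.
    rewrite -ge0_integralZl//; last 2 first.
    - exact: mzf.
    - by move=> z; exact: zf0.
    rewrite -ge0_integralD//; last 4 first.
    - by move=> z _; rewrite mule_ge0 ?sqr_ge0E// lee_fin mulr_ge0// ltW.
    - exact: measurable_funeM.
    - by move=> z Dz; rewrite mule_ge0// zf0.
    - by apply: measurable_funeM; exact: mzf.
    apply: ge0_le_integral => //.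
    - by move=> z; exact: zf0.
    - exact: mzf.
    - by apply: emeasurable_funD; apply: measurable_funeM => //; exact: mzf.
    move=> [s t] [_]; rewrite /= in_itv /= => /andP[at_ ty].
    rewrite -!EFinM -EFinD lee_fin.
    set A := d2 (psi j) (s, t); set V := v1 (s, t).
    have t0 : 0 < t := lt_le_trans a0 at_.
    have h1 : A ^+ 2 <= 2 * (A - V) ^+ 2 + 2 * V ^+ 2.
      by have := sqr_ge0 (A - 2 * V); nra.
    apply: (le_trans (ler_wpM2l (ltW t0) h1)).
    rewrite mulrDr; apply: lerD; last by rewrite mulrCA.
    by rewrite mulrA; apply: ler_wpM2r; [exact: sqr_ge0|nra].
  rewrite [leRHS]EFinD; apply: leeD.
    by rewrite EFinM; apply: (lee_wpmul2l _ pvD); rewrite lee_fin mulr_ge0// ltW.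
  rewrite EFinM; apply: lee_wpmul2l => //.
  exact: (integral_rect_dominated pq a0 ay mv mF vF hd).
set K := 4 * ((y + y ^+ 3) * (2 * r k + 2 * r j) + (a + a ^+ 3) * C).
have C_ge0 : 0 <= C by rewrite -lee_fin; apply: le_trans (eC j 0 0); apply: integral_ge0 => z _; exact: sqr_ge0E.
have rr0 : 0 <= 2 * r k + 2 * r j.
  by rewrite -lee_fin; apply: le_trans (er k j 0 0); apply: integral_ge0 => z _; exact: sqr_ge0E.
have K0 : 0 <= K by rewrite mulr_ge0// addr_ge0// mulr_ge0 ?(ltW y3)// addr_ge0 ?exprn_ge0// ltW.
have [swp swv] := int_rect_swap (measurable_itv `[p, q]) (measurable_itv `[a, y]) (mzf _ md2) (zf0 _).
have sl0 s : (0 <= \int[mu]_(t in `[a, y]) (t * d2 (psi j) (s, t) ^+ 2)%:E)%E.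
  by apply: integral_ge0 => t /=; rewrite in_itv /= => /andP[at_ _]; rewrite lee_fin mulr_ge0 ?sqr_ge0// (le_trans _ at_)// ltW.
have msl : measurable_fun (`[p, q]%classic : set T)
    (fun s => \int[mu]_(t in `[a, y]) (t * d2 (psi j) (s, t) ^+ 2)%:E)%E.
  have sub : setT `*` `[a, y]%classic `<=` hp.
    by move=> [s t] [_ /=]; rewrite in_itv /= => /andP[at_ _]; apply: lt_le_trans at_.
  apply: (measurable_funS measurableT (@subsetT _ _)).
  apply: (@measurable_vslice_int _ `[a, y]%classic (fun z => (z.2 * d2 (psi j) z ^+ 2)%:E)) => //.
    apply: (measurable_funS measurable_half_plane sub).
    by apply/measurable_EFinP; apply: measurable_funM => //; exact: measurable_funX.
  by move=> z /sub /ltW z0; rewrite lee_fin mulr_ge0 ?sqr_ge0.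
have ptw s : ((psi k (s, y) ^+ 2)%:E <=
    K%:E + (4 * l)%:E * \int[mu]_(t in `[a, y]) (t * d2 (psi j) (s, t) ^+ 2)%:E)%E.
  have h1 : (psi k - psi j) (s, y) ^+ 2 <= (y + y ^+ 3) * (2 * r k + 2 * r j).
    by apply: stream_sup_le => //; [exact: csmoothB|exact: er|exact: er].
  have h2 : psi j (s, a) ^+ 2 <= (a + a ^+ 3) * C.
    by apply: stream_sup_le => //; exact: eC.
  have h3 := @sqrB_le_integral_deriv _ (fun t => psi j (s, t)) (fun t => d2 (psi j) (s, t)) a y
    (fun t => is_derive_vslice s t (cp j).1)
    (continuous_vslice (smooth_continuous (smooth_partial 1 (cp j).1))) a0 ay.
  apply: (@le_trans _ _ (K%:E + 4%:E * ((psi j (s, y) - psi j (s, a)) ^+ 2)%:E)%E).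
    rewrite -EFinM -EFinD lee_fin /K.
    have pE : (psi k - psi j) (s, y) = psi k (s, y) - psi j (s, y) by [].
    move: h1 h2; rewrite pE.
    set A := psi k _; set P := psi j (s, y); set Q := psi j (s, a) => h1 h2.
    have : A ^+ 2 <= 4 * ((A - P) ^+ 2 + Q ^+ 2 + (P - Q) ^+ 2).
      have := sqr_ge0 ((A - P) - Q); have := sqr_ge0 ((A - P) - (P - Q)).
      have := sqr_ge0 (Q - (P - Q)); have := sqr_ge0 (A - P); have := sqr_ge0 Q; have := sqr_ge0 (P - Q).
      lra.
    lra.
  apply: leeD2l; rewrite (EFinM 4 l) -muleA; exact: lee_wpmul2l.
apply: (@le_trans _ _ (\int[mu]_(s in `[p, q]) (K%:E + (4 * l)%:E *
    \int[mu]_(t in `[a, y]) (t * d2 (psi j) (s, t) ^+ 2)%:E))%E).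
  apply: ge0_le_integral => //.
  - by move=> s _; exact: sqr_ge0E.
  - apply: measurable_EFin_continuous => // t; apply: continuous_sqr.
    exact/continuous_hslice/smooth_continuous/(cp k).1.
  - apply: emeasurable_funD => //; exact: measurable_funeM.
rewrite ge0_integralD//; last 2 first.
- by move=> s _; rewrite mule_ge0// lee_fin mulr_ge0// ltW.
- exact: measurable_funeM.
rewrite ge0_integralZl//; last by rewrite lee_fin mulr_ge0// ltW.
rewrite -swv integral_cst//= lebesgue_measure_itv /= lte_fin pq -EFinB -EFinM.
apply: (@le_trans _ _ ((K * (q - p))%:E + (4 * l)%:E * (2 * y * e + 2 * ((q - p) * delta))%:E)%E).
  by apply: leeD2l; apply: (lee_wpmul2l _ main); rewrite lee_fin mulr_ge0// ltW.
rewrite -EFinM -!EFinD lee_fin /K.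
have E1 : 8 * l * y * e = d / 2 by rewrite /e mulrC divfK// gt_eqF// !mulr_gt0.
have E2 : 8 * (q - p) * (y + y ^+ 3) * e' = d / 2 by rewrite /e' mulrC divfK// gt_eqF// !mulr_gt0.
have E3 : 8 * (q - p) * (y + y ^+ 3) * r j <= d / 2.
  by rewrite -E2 ler_wpM2l// !mulr_ge0// ltW.
nra.
Qed.

End Growth.

(** * Convergence in L2, entry by entry *)

Section L2.
Context {R : realType}.

Lemma L2normE m n (D : set (R * R)) (F : R * R -> 'M[R]_(m, n)) :
  L2norm D F = sqrte (\int[leb2]_(z in (D : set (@plane R))) (\sum_i \sum_j F z i j ^+ 2)%:E)%E.
Proof.
rewrite /L2norm unlock poweR12_sqrt; last by apply: integral_ge0 => z _; exact: poweR_ge0.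
congr sqrte; rewrite [RHS]integral_mkcond; apply: eq_integral => z _ /=.
rewrite patchE [RHS]patchE; case: ifPn => _; last by rewrite normr0 powR0.
rewrite powR_mulrn// real_normK ?num_real// sqr_sqrtr//.
by apply: sumr_ge0 => i _; apply: sumr_ge0 => j _; exact: sqr_ge0.
Qed.

Lemma sqrte_lee (x : \bar R) (e : R) : (0 <= x)%E -> 0 <= e ->
  (sqrte x <= e%:E)%E = (x <= (e ^+ 2)%:E)%E.
Proof.
case: x => [r||] //= r0 e0; rewrite !lee_fin in r0 *.
by rewrite -[RHS]ler_sqrt ?sqr_ge0// sqrtr_sqr ger0_norm.
Qed.

Lemma sqrte_lty (x : \bar R) : (sqrte x < +oo)%E = (x < +oo)%E.
Proof. by case: x => [r||] //=; rewrite !ltry. Qed.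

Lemma cvge0P (L : nat -> \bar R) : (forall k, (0 <= L k)%E) ->
  L @ \oo --> 0%E <-> forall e : R, 0 < e -> \forall k \near \oo, (L k <= e%:E)%E.
Proof.
move=> L0; split=> [/fine_cvgP[Lf /cvgrPdist_le Lc] e e0|H].
  apply: filterS2 Lf (Lc e e0) => k kf /=.
  rewrite sub0r normrN => h; rewrite -(fineK kf) lee_fin.
  exact: le_trans (ler_norm _) h.
apply/fine_cvgP; split.
  apply: filterS (H 1 ltr01) => k k1; rewrite ge0_fin_numE//.
  exact: le_lt_trans k1 (ltry _).
apply/cvgrPdist_le => e e0; apply: filterS (H e e0) => k ke /=.
rewrite sub0r normrN ger0_norm ?fine_ge0// -lee_fin fineK// ge0_fin_numE//.
exact: le_lt_trans ke (ltry _).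
Qed.

Section Entries.
Context (m n : nat) (D : set (R * R)).
Hypothesis mD : measurable (D : set (@plane R)).
Implicit Types (F : R * R -> 'M[R]_(m, n)).

Let sum_ge0 F z : 0 <= \sum_i \sum_j F z i j ^+ 2.
Proof. by apply: sumr_ge0 => i _; apply: sumr_ge0 => j _; exact: sqr_ge0. Qed.

Lemma measurable_sum_sqr F :
  (forall i j, measurable_fun (D : set (@plane R)) (fun x => F x i j)) ->
  measurable_fun (D : set (@plane R)) (fun z => (\sum_i \sum_j F z i j ^+ 2)%:E).
Proof.
move=> mF; apply/measurable_EFinP; apply: measurable_sum => i; apply: measurable_sum => j.
exact: measurable_funX.
Qed.

Lemma entry_le_sum F i j :
  (forall i j, measurable_fun (D : set (@plane R)) (fun x => F x i j)) ->
  (\int[leb2]_(z in (D : set (@plane R))) (F z i j ^+ 2)%:E <=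
   \int[leb2]_(z in (D : set (@plane R))) (\sum_i \sum_j F z i j ^+ 2)%:E)%E.
Proof.
move=> mF; apply: ge0_le_integral => //.
- by move=> z _; exact: sqr_ge0E.
- exact: measurable_sqr.
- exact: measurable_sum_sqr.
move=> z _; rewrite lee_fin (bigD1 i)//= (bigD1 j)//= -addrA lerDl addr_ge0//.
  by apply: sumr_ge0 => b _; exact: sqr_ge0.
by apply: sumr_ge0 => a _; apply: sumr_ge0 => b _; exact: sqr_ge0.
Qed.

Lemma integral_sum_sqr F :
  (forall i j, measurable_fun (D : set (@plane R)) (fun x => F x i j)) ->
  (\int[leb2]_(z in (D : set (@plane R))) (\sum_i \sum_j F z i j ^+ 2)%:E =
   \sum_i \sum_j \int[leb2]_(z in (D : set (@plane R))) (F z i j ^+ 2)%:E)%E.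
Proof.
move=> mF.
under eq_integral do rewrite -sumEFin.
rewrite ge0_integral_sum//; last 2 first.
- move=> i; apply/measurable_EFinP; apply: measurable_sum => j; exact: measurable_funX.
- by move=> i z _; rewrite lee_fin; apply: sumr_ge0 => j _; exact: sqr_ge0.
apply: eq_bigr => i _; under eq_integral do rewrite -sumEFin.
rewrite ge0_integral_sum//; last by move=> j z _; exact: sqr_ge0E.
by move=> j; exact: measurable_sqr.
Qed.

Lemma L2_cvg_entries (F_ : nat -> R * R -> 'M[R]_(m, n)) F : L2_cvg D F_ F ->
  [/\ forall i j, measurable_fun (D : set (@plane R)) (fun x => F x i j),
      forall i j, (\int[leb2]_(z in (D : set (@plane R))) (F z i j ^+ 2)%:E < +oo)%E &
      forall e : R, 0 < e -> \forall k \near \oo, forall i j,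
       (\int[leb2]_(z in (D : set (@plane R))) ((F_ k z i j - F z i j) ^+ 2)%:E <= e%:E)%E].
Proof.
move=> [F_2 [mF F2] FF]; split => //.
  move=> i j; apply: le_lt_trans (entry_le_sum i j mF) _.
  by rewrite L2normE sqrte_lty in F2.
move=> e e0; have se0 : 0 < Num.sqrt e by rewrite sqrtr_gt0.
have := (cvge0P (fun k => Lnorm_ge0 _ _ _)).1 FF _ se0; apply: filterS => k.
have [mFk _] := F_2 k.
have mFd i j : measurable_fun (D : set (@plane R)) (fun x => (F_ k x - F x) i j).
  by under eq_fun do rewrite !mxE; exact: measurable_funB.
rewrite -/(L2norm D (fun x => F_ k x - F x)) L2normE sqrte_lee ?sqrtr_ge0//; last first.
  by apply: integral_ge0 => z _; rewrite lee_fin; exact: (sum_ge0 (fun x => F_ k x - F x)).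
rewrite sqr_sqrtr ?(ltW e0)// => h i j.
have := entry_le_sum i j mFd; under eq_integral do rewrite !mxE.
by move/le_trans; apply.
Qed.

Lemma entries_L2_cvg (F_ : nat -> R * R -> 'M[R]_(m, n)) F :
  (forall k i j, measurable_fun (D : set (@plane R)) (fun x => F_ k x i j)) ->
  (forall i j, measurable_fun (D : set (@plane R)) (fun x => F x i j)) ->
  (forall i j, (\int[leb2]_(z in (D : set (@plane R))) (F z i j ^+ 2)%:E < +oo)%E) ->
  (forall k i j,
     (\int[leb2]_(z in (D : set (@plane R))) ((F_ k z i j - F z i j) ^+ 2)%:E < +oo)%E) ->
  (forall i j (e : R), 0 < e -> \forall k \near \oo,
     (\int[leb2]_(z in (D : set (@plane R))) ((F_ k z i j - F z i j) ^+ 2)%:E <= e%:E)%E) ->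
  L2_cvg D F_ F.
Proof.
move=> mF_ mF F2 Fd2 FF.
have mFd k i j : measurable_fun (D : set (@plane R)) (fun x => (F_ k x - F x) i j).
  by under eq_fun do rewrite !mxE; exact: measurable_funB.
have L2F (G : R * R -> 'M[R]_(m, n)) : (forall i j, measurable_fun (D : set (@plane R)) (fun x => G x i j)) ->
    (forall i j, (\int[leb2]_(z in (D : set (@plane R))) (G z i j ^+ 2)%:E < +oo)%E) -> L2 D G.
  move=> mG G2; split => //; rewrite L2normE sqrte_lty integral_sum_sqr//.
  by apply: lte_sum_pinfty => i _; apply: lte_sum_pinfty => j _.
split.
- move=> k; apply: L2F => // i j.
  apply: (@le_lt_trans _ _ (2%:E * \int[leb2]_(z in (D : set (@plane R))) ((F_ k z i j - F z i j) ^+ 2)%:E +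
      2%:E * \int[leb2]_(z in (D : set (@plane R))) (F z i j ^+ 2)%:E)%E); last first.
    by apply: lte_add_pinfty; apply: lte_mul_pinfty.
  have md : measurable_fun (D : set (@plane R)) (fun z => ((F_ k z i j - F z i j) ^+ 2)%:E).
    by apply: measurable_sqr; exact: measurable_funB.
  have mf := measurable_sqr (mF i j).
  rewrite -!ge0_integralZl//; do ?by move=> z _; exact: sqr_ge0E.
  rewrite -ge0_integralD//; do ?[by move=> z _; rewrite mule_ge0 ?sqr_ge0E|exact: measurable_funeM].
  apply: ge0_le_integral => //.
  + by move=> z _; exact: sqr_ge0E.
  + exact: measurable_sqr.
  + by apply: emeasurable_funD; exact: measurable_funeM.
  move=> z _; rewrite -!EFinM -EFinD lee_fin.
  by have := sqr_ge0 (F_ k z i j - 2 * F z i j); lra.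
- exact: L2F.
apply/(cvge0P (fun k => Lnorm_ge0 _ _ _)) => e e0.
pose e' := e ^+ 2 / (m * n).+1%:R.
have e'0 : 0 < e' by rewrite divr_gt0 ?exprn_gt0.
have : \forall k \near \oo, forall i j,
    (\int[leb2]_(z in (D : set (@plane R))) ((F_ k z i j - F z i j) ^+ 2)%:E <= e'%:E)%E.
  by apply: filter_forall => i; apply: filter_forall => j; exact: FF.
apply: filterS => k h.
rewrite -/(L2norm D (fun x => F_ k x - F x)) L2normE sqrte_lee ?(ltW e0)//; last by apply: integral_ge0 => z _; rewrite lee_fin; exact: (sum_ge0 (fun x => F_ k x - F x)).
rewrite integral_sum_sqr//.
apply: (@le_trans _ _ (\sum_(i < m) \sum_(j < n) e'%:E)%E).
  apply: lee_sum => i _; apply: lee_sum => j _.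
  by under eq_integral do rewrite !mxE; exact: h.
rewrite !sumEFin lee_fin !sumr_const !card_ord -mulrnA mulnC -mulr_natr /e'.
by rewrite -mulrA ler_piMr ?sqr_ge0// mulrC ler_pdivrMr// mul1r ler_nat.
Qed.

End Entries.
End L2.

Arguments sqint {R} w%_ring_scope.

(** * Velocity fields and the completion *)

Section Streams.
Context {R : realType}.
Local Notation hp := (@half_plane R : set (@plane R)).
Local Notation d1 := (partial 0%R).
Local Notation d2 := (partial 1%R).
Implicit Types (f w psi : R * R -> R) (z : R * R).

Definition vel psi (i : 'I_2) : R * R -> R := if i == 0 then d2 psi else - d1 psi.

Definition vel_field psi z : 'rV[R]_2 := \row_i vel psi i z.

Lemma coord_vel_field psi i : coord_fun (vel_field psi) i = vel psi i.
Proof. by apply/funext => z; rewrite /coord_fun mxE. Qed.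

Lemma csmoothN f : csmooth f -> csmooth (- f).
Proof.
move=> [sf [B B0 fB]]; split; first exact: smoothN.
by exists B => // z /fB fz; rewrite /GRing.opp /= fz oppr0.
Qed.

Lemma csmooth_vel psi i : csmooth psi -> csmooth (vel psi i).
Proof.
move=> cp; rewrite /vel; case: ifP => _; first exact: csmooth_partial.
exact/csmoothN/csmooth_partial.
Qed.

Lemma partialN i f : smooth f -> partial i (- f) = - partial i f.
Proof. by move=> sf; apply/funext => z; rewrite /partial deriveN//; exact: smooth_derivable. Qed.

Lemma divergenceE (phi : R * R -> 'rV[R]_2) z :
  divergence phi z = d1 (coord_fun phi 0) z + d2 (coord_fun phi 1) z.
Proof.
rewrite /divergence big_ord_recl big_ord1; congr (_ + partial _ (coord_fun phi _) z);
  exact: val_inj.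
Qed.

(** The divergence of a rotated gradient is the commutator of the second derivatives. *)
Lemma stream_Cc_sigma psi : csmooth psi -> d1 (d2 psi) = d2 (d1 psi) -> Cc_sigma (vel_field psi).
Proof.
move=> cp sw; split=> [i|z].
  by apply/test_functionP; rewrite coord_vel_field; exact: csmooth_vel.
rewrite divergenceE !coord_vel_field /vel /= partialN; last exact: smooth_partial cp.1.
by rewrite sw addrN.
Qed.

Lemma Cc_sigma_stream (phi : R * R -> 'rV[R]_2) : Cc_sigma phi ->
  exists psi, [/\ csmooth psi, d1 (d2 psi) = d2 (d1 psi) & phi = vel_field psi].
Proof.
move=> [tphi div0].
have c0 := (test_functionP _).1 (tphi 0); have c1 := (test_functionP _).1 (tphi 1).
have [z|psi [cp p2 p1]] := exists_stream c0 c1; first by rewrite -divergenceE.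
exists psi; split; first exact: cp.
  apply/funext => z; rewrite p1 p2 partialN; last exact: c1.1.
  by have := div0 z; rewrite divergenceE => /eqP; rewrite addr_eq0 => /eqP.
apply/funext => z; apply/rowP => i; rewrite mxE /vel.
by case: (I2P i) => ->; rewrite /= ?p2 ?p1 ?opprK.
Qed.

Lemma integral_sqrB_le f w (A B : R) : measurable_fun hp f -> measurable_fun hp w ->
  (sqint f <= A%:E)%E -> (sqint w <= B%:E)%E -> (sqint (f - w) <= (2 * A + 2 * B)%:E)%E.
Proof.
move=> mf mw fA wB.
apply: (@le_trans _ _ (2%:E * sqint f + 2%:E * sqint w)%E); last first.
  by rewrite [leRHS]EFinD; apply: leeD; rewrite (EFinM 2); apply: lee_wpmul2l.
have h := @measurable_half_plane R.
rewrite /sqint -!ge0_integralZl//; do ?[exact: measurable_sqr|by move=> z _; exact: sqr_ge0E].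
rewrite -ge0_integralD//; do ?[by move=> z _; rewrite mule_ge0 ?sqr_ge0E
                              |by apply: measurable_funeM; exact: measurable_sqr].
apply: ge0_le_integral => //.
- by move=> z _; exact: sqr_ge0E.
- by apply: measurable_sqr; exact: measurable_funB.
- by apply: emeasurable_funD; apply: measurable_funeM; exact: measurable_sqr.
move=> z _; rewrite -!EFinM -EFinD lee_fin.
have -> : (f - w) z = f z - w z by [].
by have := sqr_ge0 (f z + w z); lra.
Qed.

Lemma sqintN f : sqint (- f) = sqint f.
Proof.
apply: eq_integral => z _; have -> : (- f) z = - f z by [].
by rewrite sqrrN.
Qed.

Lemma velB psi f i : smooth psi -> smooth f -> vel (psi - f) i = vel psi i - vel f i.
Proof.
move=> sp sf; rewrite /vel; case: ifP => _; rewrite partialB//.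
by apply/funext => z; rewrite /GRing.add /GRing.opp /= !opprB opprK addrC.
Qed.

Lemma energy_le_vel psi (E : R) : smooth psi ->
  energy_le psi E <-> forall i j, (sqint (partial j (vel psi i)) <= E%:E)%E.
Proof.
move=> sp; split=> H i j; last first.
  case: (I2P i) => ->; last exact: (H 0 j).
  by have := H 1 j; rewrite /vel /= partialN ?sqintN//; exact: smooth_partial.
case: (I2P i) => ->; rewrite /vel /=; first exact: H.
by rewrite partialN ?sqintN; [exact: H|exact: smooth_partial].
Qed.

(** What membership of v in the completion provides: stream functions of the
    approximating fields, with indices chosen so that the gradients converge at the rate
    1/(k+1). The equality of mixed derivatives is part of the data since it is known
    from the divergence of the fields. *)
Record streams (v : R * R -> 'rV[R]_2) (G : R * R -> 'M[R]_2)
    (psi : nat -> R * R -> R) (C : R) : Prop := Streams {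
  streams_grad : weak_jac v G;
  streams_mgrad : forall i j, measurable_fun hp (fun z => G z i j);
  streams_grad_le : forall i j, (sqint (fun z => G z i j) <= C%:E)%E;
  streams_csmooth : forall k, csmooth (psi k);
  streams_schwarz : forall k, d1 (d2 (psi k)) = d2 (d1 (psi k));
  streams_cvg_grad : forall k i j,
    (sqint (partial j (vel (psi k) i) - (fun z => G z i j)) <= (k.+1%:R^-1)%:E)%E;
  streams_meas : forall i, measurable_fun hp (coord_fun v i);
  streams_cvg : forall i, loc_cvg (fun k => vel (psi k) i) (coord_fun v i) }.

Lemma exists_streams (v : R * R -> 'rV[R]_2) : dotH1_0sigma v ->
  exists G (psi : nat -> R * R -> R) C, streams v G psi C.
Proof.
move=> [v1 [phi [phi_sigma [G vG phiG] phiv]]].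
have [mG G2 GC] := L2_cvg_entries (@measurable_half_plane R) phiG.
have /choice[ps psP] : forall k, exists psi, [/\ csmooth psi, d1 (d2 psi) = d2 (d1 psi) & phi k = vel_field psi].
  by move=> k; exact: Cc_sigma_stream.
have /choice[s sP] : forall k : nat, exists n, (k <= n)%N /\ forall i j,
    (\int[leb2]_(z in hp) ((jac (phi n) z i j - G z i j) ^+ 2)%:E <= (k.+1%:R^-1)%:E)%E.
  move=> k; have k0 : (0 : R) < k.+1%:R^-1 by rewrite invr_gt0.
  by have [n _ nP] := GC _ k0; exists (maxn k n); rewrite leq_maxl; split => //; apply: nP; rewrite /= leq_maxr.
have s_le k : (k <= s k)%N by case: (sP k).
pose C : R := \sum_i \sum_j fine (\int[leb2]_(z in hp) (G z i j ^+ 2)%:E).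
exists G, (fun k => ps (s k)), C; split.
- exact: vG.
- exact: mG.
- move=> i j; have I0 a b : (0 <= \int[leb2]_(z in hp) (G z a b ^+ 2)%:E)%E.
    by apply: integral_ge0 => z _; exact: sqr_ge0E.
  rewrite /sqint -[leLHS]fineK ?ge0_fin_numE// lee_fin /C (bigD1 i)//= (bigD1 j)//= -addrA lerDl.
  rewrite addr_ge0//; first by apply: sumr_ge0 => b _; exact: fine_ge0.
  by apply: sumr_ge0 => a _; apply: sumr_ge0 => b _; exact: fine_ge0.
- by move=> k; have [] := psP (s k).
- by move=> k; have [] := psP (s k).
- move=> k i j; have [_ _ phE] := psP (s k).
  have [_ /(_ i j)] := sP k; rewrite /sqint; apply: le_trans; rewrite le_eqVlt; apply/orP; left.
  by apply/eqP; apply: eq_integral => z _; rewrite /jac mxE phE coord_vel_field.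
- by move=> i; have [[]] := v1 i.
- move=> i B e B0 e0.
  have [_ _ H] := L2_cvg_entries (@measurable_box R B) (phiv (box B) (@box_compact R B) (@box_hp R B B0)).
  have [n _ nP] := H e e0; exists n => // k nk.
  have := nP (s k) (leq_trans nk (s_le k)) ord0 i.
  have [_ _ ->] := psP (s k).
  by under eq_integral do rewrite mxE.
Qed.

Section StreamsTheory.
Variables (v : R * R -> 'rV[R]_2) (G : R * R -> 'M[R]_2) (psi : nat -> R * R -> R) (C : R).
Hypothesis H : streams v G psi C.

Let sp k : smooth (psi k). Proof. by have [] := streams_csmooth H k. Qed.

Let mpv k i j : measurable_fun hp (partial j (vel (psi k) i)).
Proof. exact: (csmooth_meas (csmooth_partial j (csmooth_vel i (streams_csmooth H k)))). Qed.

Lemma streams_energy k : energy_le (psi k) (2 * 1 + 2 * C).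
Proof.
apply/energy_le_vel => // i j.
have mG := streams_mgrad H i j.
have -> : partial j (vel (psi k) i) = (partial j (vel (psi k) i) - (fun z => G z i j)) - (- (fun z => G z i j)).
  by rewrite opprK subrK.
apply: integral_sqrB_le.
- exact: measurable_funB.
- exact: measurable_funN.
- by apply: (le_trans (streams_cvg_grad H k i j)); rewrite lee_fin invf_le1 ?ler1n.
- by rewrite sqintN; exact: streams_grad_le H i j.
Qed.

Lemma streams_energyB k l :
  energy_le (psi k - psi l) (2 * k.+1%:R^-1 + 2 * l.+1%:R^-1).
Proof.
apply/energy_le_vel => [|i j]; first exact: smoothB.
have mG := streams_mgrad H i j.
rewrite velB// partialB; last 2 first.
- by have [] := csmooth_vel i (streams_csmooth H k).
- by have [] := csmooth_vel i (streams_csmooth H l).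
have -> : partial j (vel (psi k) i) - partial j (vel (psi l) i) =
  (partial j (vel (psi k) i) - (fun z => G z i j)) - (partial j (vel (psi l) i) - (fun z => G z i j)).
  by rewrite opprB addrA subrK.
apply: integral_sqrB_le.
- exact: measurable_funB.
- exact: measurable_funB.
- exact: (streams_cvg_grad H k i j).
- exact: (streams_cvg_grad H l i j).
Qed.

Lemma streams_approx i :
  approx (2 * 1 + 2 * C) (fun k => vel (psi k) i) (coord_fun v i).
Proof.
split; last exact: streams_cvg H i.
- by move=> k; apply: csmooth_vel; exact: streams_csmooth H k.
- by move=> k; have /(energy_le_vel _ (sp k)) := streams_energy k; apply.
- exact: streams_meas H i.
Qed.

End StreamsTheory.
End Streams.

(** * Integral bounds and dominated convergence *)

Section Bounds.
Context d (X : measurableType d) (R : realType) (m : {measure set X -> \bar R}) (D : set X).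
Hypothesis mD : measurable D.
Implicit Types (f p q : X -> R) (P Q c : R).

(** A nonnegative integrand together with a bound, so that bounds of sums are assembled
    term by term. *)
Definition int_bound p P := [/\ measurable_fun D p, forall z, D z -> 0 <= p z &
  (\int[m]_(z in D) (p z)%:E <= P%:E)%E].

Lemma int_boundD p q P Q : int_bound p P -> int_bound q Q ->
  int_bound (fun z => p z + q z) (P + Q).
Proof.
move=> [mp p0 pP] [mq q0 qQ]; split.
- exact: measurable_funD.
- by move=> z Dz; rewrite addr_ge0 ?p0 ?q0.
under eq_integral do rewrite EFinD.
rewrite ge0_integralD//; do ?[exact/measurable_EFinP|by move=> z Dz; rewrite lee_fin ?p0 ?q0].
by rewrite EFinD; exact: leeD.
Qed.

Lemma int_boundZ p P c : 0 <= c -> int_bound p P -> int_bound (fun z => c * p z) (c * P).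
Proof.
move=> c0 [mp p0 pP]; split.
- exact: measurable_funM.
- by move=> z Dz; rewrite mulr_ge0 ?p0.
under eq_integral do rewrite EFinM.
rewrite ge0_integralZl//; do ?[exact/measurable_EFinP|by move=> z Dz; rewrite lee_fin p0].
by rewrite EFinM; exact: lee_wpmul2l.
Qed.

Lemma int_bound_le f p P : measurable_fun D f -> (forall z, D z -> 0 <= f z <= p z) ->
  int_bound p P -> (\int[m]_(z in D) (f z)%:E <= P%:E)%E.
Proof.
move=> mf fp [mp p0 pP]; apply: le_trans pP; apply: ge0_le_integral => //.
- by move=> z /fp /andP[]; rewrite lee_fin.
- exact/measurable_EFinP.
- exact/measurable_EFinP.
- by move=> z /fp /andP[]; rewrite lee_fin.
Qed.

Lemma integral_cvg0_of_dominated (g : X -> R) P (h : nat -> X -> R) : int_bound g P ->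
  (forall n, measurable_fun D (h n)) -> (forall n z, D z -> 0 <= h n z <= 1) ->
  (forall z, D z -> h ^~ z @ \oo --> (0 : R)) ->
  forall e : R, 0 < e -> \forall n \near \oo, (\int[m]_(z in D) (h n z * g z)%:E <= e%:E)%E.
Proof.
move=> [mg g0 gP] mh h01 hc.
apply/cvge0P.
  by move=> n; apply: integral_ge0 => z Dz; rewrite lee_fin mulr_ge0 ?g0//; case/andP: (h01 n z Dz).
have mhg n : measurable_fun D (fun z => (h n z * g z)%:E).
  by apply/measurable_EFinP; exact: measurable_funM.
have ch : {ae m, forall z, D z -> (h n z * g z)%:E @[n --> \oo] --> 0%E}.
  apply: aeW => z Dz; apply/cvge0P.
    by move=> n; rewrite lee_fin mulr_ge0 ?g0//; case/andP: (h01 n z Dz).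
  move=> e e0; have e1 : 0 < e / (1 + g z) by rewrite divr_gt0// ltr_pwDl ?g0.
  have /cvgrPdist_le /(_ _ e1) := hc z Dz; apply: filterS => n.
  have /andP[hn0 _] := h01 n z Dz; rewrite sub0r normrN ger0_norm// => he.
  rewrite lee_fin (le_trans (ler_wpM2r (g0 _ Dz) he))// mulrAC ler_pdivrMr ?ltr_pwDl ?g0//.
  by rewrite ler_wpM2l ?(ltW e0)// lerDr.
have ig : m.-integrable D (fun z => (g z)%:E).
  apply/integrableP; split; first exact/measurable_EFinP.
  apply: le_lt_trans (ltry P); apply: le_trans gP; rewrite le_eqVlt; apply/orP; left; apply/eqP.
  by apply: eq_integral => z; rewrite inE => zD; rewrite gee0_abs ?lee_fin ?g0.
have dh : {ae m, forall z (n : nat), D z -> (`|(h n z * g z)%:E| <= (g z)%:E)%E}.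
  apply: aeW => z n Dz; have /andP[hn0 hn1] := h01 n z Dz.
  by rewrite gee0_abs lee_fin ?mulr_ge0 ?g0// ler_piMl ?g0.
have [_ _] := dominated_convergence mD mhg (@measurable_cst _ _ _ _ D 0%E) ch ig dh.
by rewrite integral0.
Qed.

End Bounds.

(** * Truncated stream functions *)

Section Truncation.
Context {R : realType}.
Local Notation mu := (@lebesgue_measure R).
Local Notation T := (measurableTypeR R).
Local Notation hp := (@half_plane R : set (@plane R)).
Local Notation pos := (`]0%R, +oo[%classic : set T).
Local Notation d1 := (partial 0%R).
Local Notation d2 := (partial 1%R).
Local Notation bound2 := (int_bound (@leb2 R) hp).
Local Notation bound1 := (int_bound mu pos).
Local Notation K := (@absorb_const R * 8).
Implicit Types (f w psi : R * R -> R) (e x y : R) (z : R * R).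

Lemma K_gt0 : 0 < K :> R. Proof. by rewrite mulr_gt0// absorb_const_gt0. Qed.

Lemma smooth_snd (h : R -> R) : (forall n, Cn1 n h) -> smooth (fun z : R * R => h z.2).
Proof. by move=> Ch; apply/smoothP => n; exact: Cn_snd. Qed.

Lemma partial1_snd (h : R -> R) : d1 (fun z : R * R => h z.2) = fun=> 0.
Proof. by apply/funext => -[x y]; rewrite partial1E /= derive_cst. Qed.

Lemma partial2_snd (h dh : R -> R) : (forall y, is_derive y 1 h (dh y)) ->
  d2 (fun z : R * R => h z.2) = fun z => dh z.2.
Proof. by move=> hd; apply/funext => -[x y]; rewrite partial2E /=; have [_] := hd y. Qed.

Lemma partialM i f w z : smooth f -> smooth w ->
  partial i (f * w) z = f z * partial i w z + w z * partial i f z.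
Proof. by move=> sf sw; rewrite /partial deriveM//; exact: smooth_derivable. Qed.

Lemma partialD i f w z : smooth f -> smooth w ->
  partial i (f + w) z = partial i f z + partial i w z.
Proof. by move=> sf sw; rewrite /partial deriveD//; exact: smooth_derivable. Qed.

(** Truncating the stream function instead of its velocity field preserves the zero
    divergence. *)
Definition trunc e psi : R * R -> R := (fun z => cut e z.2) * psi.

Let scut e : smooth (fun z : R * R => cut e z.2).
Proof. by apply: smooth_snd => n; exact: Cn1_cut. Qed.

Let sdcut e : smooth (fun z : R * R => dcut e z.2).
Proof. by apply: smooth_snd => n; exact: Cn1_dcut. Qed.

Lemma csmooth_trunc e psi : csmooth psi -> csmooth (trunc e psi).
Proof. exact: csmooth_mul. Qed.

Lemma partial1_trunc e psi : smooth psi ->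
  d1 (trunc e psi) = (fun z => cut e z.2) * d1 psi.
Proof.
move=> sp; apply/funext => z; rewrite (partialM _ _ (scut e) sp) partial1_snd mulr0 addr0.
exact: erefl.
Qed.

Lemma partial2_trunc e psi : smooth psi ->
  d2 (trunc e psi) = (fun z => cut e z.2) * d2 psi + (fun z => dcut e z.2) * psi.
Proof.
move=> sp; apply/funext => z.
by rewrite (partialM _ _ (scut e) sp) (partial2_snd (is_derive_cut e)) [psi z * _]mulrC.
Qed.

Lemma trunc_schwarz e psi : smooth psi -> d1 (d2 psi) = d2 (d1 psi) ->
  d1 (d2 (trunc e psi)) = d2 (d1 (trunc e psi)).
Proof.
move=> sp sw; have s1 := smooth_partial 0 sp; have s2 := smooth_partial 1 sp.
apply/funext => z; rewrite (partial1_trunc e sp) (partial2_trunc e sp).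
rewrite (partialD _ _ (smoothM (scut e) s2) (smoothM (sdcut e) sp)).
rewrite (partialM _ _ (scut e) s2) (partialM _ _ (sdcut e) sp) (partialM _ _ (scut e) s1).
rewrite !partial1_snd (partial2_snd (is_derive_cut e)) sw.
by rewrite !mulr0 !addr0 [d1 psi z * _]mulrC.
Qed.

Lemma vel_trunc e psi i z : smooth psi ->
  vel (trunc e psi) i z = cut e z.2 * vel psi i z + (if i == 0 then dcut e z.2 * psi z else 0).
Proof.
move=> sp; rewrite /vel; case: ifP => _; first by rewrite (partial2_trunc e sp).
by rewrite (partial1_trunc e sp) addr0 /GRing.opp /= mulrN.
Qed.

(** In the product rule, each term other than cut times the gradient contains a
    derivative of the cutoff. *)
Lemma partial_vel_trunc e psi i j z : smooth psi ->
  (partial j (vel (trunc e psi) i) z - cut e z.2 * partial j (vel psi i) z) ^+ 2 <=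
    8 * (dcut e z.2 ^+ 2 * d1 psi z ^+ 2 + dcut e z.2 ^+ 2 * d2 psi z ^+ 2)
    + 2 * (ddcut e z.2 ^+ 2 * psi z ^+ 2).
Proof.
move=> sp; have s1 := smooth_partial 0 sp; have s2 := smooth_partial 1 sp.
rewrite -!exprMn.
set A := dcut e z.2 * d1 psi z; set B := dcut e z.2 * d2 psi z; set P := ddcut e z.2 * psi z.
have := sqr_ge0 A; have := sqr_ge0 B; have := sqr_ge0 P; have := sqr_ge0 (2 * B - P) => h1 h2 h3 h4.
case: (I2P i) => ->; rewrite /vel /=.
  rewrite (partial2_trunc e sp) (partialD _ _ (smoothM (scut e) s2) (smoothM (sdcut e) sp)).
  rewrite (partialM _ _ (scut e) s2) (partialM _ _ (sdcut e) sp); case: (I2P j) => ->.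
    rewrite !partial1_snd !mulr0 !addr0 addrAC subrr add0r -/A; lra.
  rewrite (partial2_snd (is_derive_cut e)) (partial2_snd (is_derive_dcut e)).
  rewrite (_ : _ - _ = 2 * B + P); last by rewrite /B /P; ring.
  lra.
rewrite (partial1_trunc e sp) (partialN _ (smoothM (scut e) s1)) (partialN _ s1).
have NE (f : R * R -> R) : (- f) z = - f z by [].
rewrite !NE (partialM _ _ (scut e) s1); case: (I2P j) => ->.
  rewrite partial1_snd (_ : _ - _ = 0); last by ring.
  lra.
rewrite (partial2_snd (is_derive_cut e)) (_ : _ - _ = - A); last by rewrite /A; ring.
by rewrite sqrrN; lra.
Qed.

Lemma measurable_snd_real (g : R -> R) : measurable_fun pos g -> measurable_fun hp (fun z => g z.2).
Proof.
by move=> mg; apply/measurable_EFinP; apply: (@measurable_snd_hp _ (EFin \o g)); exact/measurable_EFinP.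
Qed.

Lemma measurable_weight_sqr (g : R -> R) f : measurable_fun pos g -> measurable_fun hp f ->
  measurable_fun hp (fun z => g z.2 * f z ^+ 2).
Proof. by move=> mg mf; apply: measurable_weight => //; exact: measurable_funX. Qed.

Lemma measurable_sqr_pos (g : R -> R) : measurable_fun pos g -> measurable_fun pos (fun y => g y ^+ 2).
Proof. by move=> mg; exact: measurable_funX. Qed.

Let mcut e : measurable_fun pos (cut e). Proof. exact: (measurable_cts (@continuous_cut R e)). Qed.
Let mdcut e : measurable_fun pos (dcut e). Proof. exact: (measurable_cts (@continuous_dcut R e)). Qed.
Let mddcut e : measurable_fun pos (ddcut e). Proof. exact: (measurable_cts (@continuous_ddcut R e)). Qed.

Lemma bound_dcut e : 0 < e -> bound1 (fun y => y * dcut e y ^+ 2) (K * e).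
Proof.
move=> e0; split; last exact: integral_dcut_sqr.
- by apply: measurable_funM => //; exact: (measurable_sqr_pos (mdcut e)).
- by move=> y; rewrite /= in_itv /= andbT => y0; rewrite mulr_ge0 ?sqr_ge0// ltW.
Qed.

(** W - g is the sum of c (f0 - g), - (1 - c) g and W - c f0. *)
Lemma sqr_sub_le (W c g f0 Y : R) : 0 <= c <= 1 -> (W - c * f0) ^+ 2 <= Y ->
  (W - g) ^+ 2 <= 3 * ((f0 - g) ^+ 2 + (1 - c) ^+ 2 * g ^+ 2 + Y).
Proof.
move=> /andP[c0 c1] h; set P := c * (f0 - g); set Q := (1 - c) * g; set X := W - c * f0 in h *.
have -> : W - g = P - Q + X by rewrite /X /P /Q; ring.
have h2 : P ^+ 2 <= (f0 - g) ^+ 2 by rewrite exprMn ler_piMl ?sqr_ge0// exprn_ile1.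
have -> : (1 - c) ^+ 2 * g ^+ 2 = Q ^+ 2 by rewrite exprMn.
have := sqr_ge0 (P + Q); have := sqr_ge0 (P - X); have := sqr_ge0 (Q + X); lra.
Qed.

(** c W + X - V is the sum of c (W - V), - (1 - c) V and X. *)
Lemma sqr_sub_mul_le (U V W c X Y : R) : X ^+ 2 <= Y ->
  (U * (c * W + X) - U * V) ^+ 2 <=
    3 * (c ^+ 2 * U ^+ 2 * (W - V) ^+ 2 + (1 - c) ^+ 2 * U ^+ 2 * V ^+ 2 + Y * U ^+ 2).
Proof.
move=> XY; set p := c * (W - V); set q := (1 - c) * V.
have -> : U * (c * W + X) - U * V = U * (p - q + X) by rewrite /p /q; ring.
have -> : c ^+ 2 * U ^+ 2 * (W - V) ^+ 2 + (1 - c) ^+ 2 * U ^+ 2 * V ^+ 2 + Y * U ^+ 2 =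
  U ^+ 2 * (p ^+ 2 + q ^+ 2 + Y) by rewrite /p /q; ring.
rewrite [X in X <= _]exprMn [X in _ <= X]mulrCA; apply: ler_wpM2l; first exact: sqr_ge0.
have := sqr_ge0 (p + q); have := sqr_ge0 (p - X); have := sqr_ge0 (q + X); lra.
Qed.

Section Streams.
Variables (v : R * R -> 'rV[R]_2) (G : R * R -> 'M[R]_2) (psi : nat -> R * R -> R) (C : R).
Hypothesis H : streams v G psi C.
Local Notation C' := (2 * 1 + 2 * C).

(** The three errors are that of psi k, the part of G removed by the cutoff, and the
    terms of partial_vel_trunc, which are O(e) because the energy of psi k is bounded in
    k. *)
Lemma trunc_grad_le e k i j (J : R) : 0 < e <= 1 ->
  (\int[leb2]_(z in hp) ((1 - cut e z.2) ^+ 2 * G z i j ^+ 2)%:E <= J%:E)%E ->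
  (\int[leb2]_(z in hp) ((partial j (vel (trunc e (psi k)) i) z - G z i j) ^+ 2)%:E <=
    (3 * (k.+1%:R^-1 + J + (8 * (C' * (K * e) + C' * (K * e)) + 2 * (C' * (K * e)))))%:E)%E.
Proof.
move=> /[dup] e01 /andP[e0 e1] hJ.
have cp := streams_csmooth H k; have sp := cp.1.
have mG := streams_mgrad H i j; have E := streams_energy H k.
set f := partial j (vel (psi k) i).
have cf : csmooth f by apply/csmooth_partial/csmooth_vel.
have md2 : measurable_fun pos (fun y => dcut e y ^+ 2) by exact: (measurable_sqr_pos (mdcut e)).
have mdd2 : measurable_fun pos (fun y => ddcut e y ^+ 2) by exact: (measurable_sqr_pos (mddcut e)).
have m1 : measurable_fun pos (fun y => (1 - cut e y) ^+ 2).
  by apply: measurable_sqr_pos; exact: measurable_funB.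
have b1 : bound2 (fun z => (f z - G z i j) ^+ 2) k.+1%:R^-1.
  split; last exact: (streams_cvg_grad H k i j).
    by apply: measurable_funX; apply: measurable_funB => //; exact: csmooth_meas.
  by move=> z _; exact: sqr_ge0.
have b2 : bound2 (fun z => (1 - cut e z.2) ^+ 2 * G z i j ^+ 2) J.
  split => //; first exact: (@measurable_weight_sqr (fun y => (1 - cut e y) ^+ 2) (fun z => G z i j)).
  by move=> z _; rewrite mulr_ge0 ?sqr_ge0.
have bd l : bound2 (fun z => dcut e z.2 ^+ 2 * partial l (psi k) z ^+ 2) (C' * (K * e)).
  split.
  - apply: (@measurable_weight_sqr (fun y => dcut e y ^+ 2)) => //.
    exact: (csmooth_meas (csmooth_partial l cp)).
  - by move=> z _; rewrite mulr_ge0 ?sqr_ge0.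
  - apply: (@weight_le_csmooth _ _ (fun y => dcut e y ^+ 2)) => //.
    + exact: csmooth_partial.
    + by move=> y _; exact: sqr_ge0.
    + exact: integral_dcut_sqr.
have b4 : bound2 (fun z => ddcut e z.2 ^+ 2 * psi k z ^+ 2) (C' * (K * e)).
  split.
  - apply: (@measurable_weight_sqr (fun y => ddcut e y ^+ 2)) => //.
    exact: (csmooth_meas cp).
  - by move=> z _; rewrite mulr_ge0 ?sqr_ge0.
  - apply: (@weight_le_stream _ _ (fun y => ddcut e y ^+ 2)) => //.
    + by move=> y _; exact: sqr_ge0.
    + under eq_integral do rewrite exprS -mulrA; exact: integral_ddcut_sqr.
have B := int_boundZ (measurable_half_plane) (ler0n R 3) (int_boundD measurable_half_plane
   (int_boundD measurable_half_plane b1 b2)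
   (int_boundD measurable_half_plane
     (int_boundZ measurable_half_plane (ler0n R 8) (int_boundD measurable_half_plane (bd 0) (bd 1)))
     (int_boundZ measurable_half_plane (ler0n R 2) b4))).
apply: (int_bound_le measurable_half_plane _ _ B).
  apply: measurable_funX; apply: measurable_funB => //.
  exact: (csmooth_meas (csmooth_partial j (csmooth_vel i (csmooth_trunc e cp)))).
move=> z _; rewrite sqr_ge0 /=.
apply: sqr_sub_le; first by rewrite cut_le1 ltW// cut_gt0.
exact: (partial_vel_trunc e i j z sp).
Qed.

(** Above the height a this is stream_growth, with ln y <= lg y; below it,
    stream_sup_le. *)
Lemma stream_le (F : R -> R) k (a delta : R) x y :
  measurable_fun pos F -> slice_dominated (coord_fun v 0) F -> 1 <= a ->
  (\int[mu]_(s in `[a, +oo[) (s * F s ^+ 2)%:E <= delta%:E)%E -> 0 < y ->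
  psi k (x, y) ^+ 2 <=
    4 * ((y + y ^+ 3) * (2 * k.+1%:R^-1) + (a + a ^+ 3) * C' + lg y * (2 * delta)).
Proof.
move=> mF vF a1 hd y0; have a0 : 0 < a by apply: lt_le_trans a1.
have E := streams_energy H k; have C'0 := sqint_bound_ge0 (E 0 0).
have d0 : 0 <= delta.
  rewrite -lee_fin; apply: le_trans hd; apply: integral_ge0 => s /=; rewrite in_itv /= andbT => as_.
  by rewrite lee_fin mulr_ge0 ?sqr_ge0// (le_trans (ltW a0)).
have y3 : 0 <= (y + y ^+ 3) * (2 * k.+1%:R^-1).
  apply: mulr_ge0; last by rewrite mulr_ge0// invr_ge0.
  by rewrite addr_ge0 ?exprn_ge0// ltW.
have a3 : 0 <= (a + a ^+ 3) * C' by rewrite mulr_ge0// addr_ge0 ?exprn_ge0// ltW.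
have l0 : 0 <= lg y * (2 * delta) by rewrite mulr_ge0 ?lg_ge0// mulr_ge0.
have [ya|ay] := leP y a.
  have h := stream_sup_le x (streams_csmooth H k) y0 (E 1 1) (E 0 1).
  apply: (le_trans h); apply: (@le_trans _ _ ((a + a ^+ 3) * C')).
    by rewrite ler_wpM2r// lerD// lerXn2r ?nnegrE// ltW.
  by move: y3 a3 l0; move: (_ * (2 * k.+1%:R^-1)) (_ * C') (lg y * _) => A B D ? ? ?; lra.
have := @stream_growth _ psi (coord_fun v 0) F C' delta a (fun n => n.+1%:R^-1) k x y
  (streams_csmooth H) (streams_energy H) (streams_energyB H) (@cvg_harmonic R)
  (streams_meas H 0) (streams_cvg H 0) mF vF a0 ay hd.
move/le_trans; apply; rewrite ler_wpM2l// lerD2l ler_wpM2r ?mulr_ge0//.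
have : 0 <= ln a by exact: ln_ge0.
have : ln y <= lg y.
  rewrite /lg ler_ln ?posrE ?bracket_gt0// /bracket.
  by have := sqr_ge0 (y - 1); have := sqr_ge0 y; lra.
lra.
Qed.

(** The three errors, each multiplied by u, are bounded as follows: cut times the error
    of psi k by weight2_le with weight cut^2, the removed part of v by weight_le with
    weight (1 - cut)^2 F^2, and cut' psi k by weight_le after stream_le has replaced psi
    k by a function of the height. *)
Lemma trunc_tensor_le (F : R -> R) (u : R * R -> R) (w : nat -> R * R -> R)
    (Cu e I J a delta : R) k j :
  measurable_fun pos F -> (forall i, slice_dominated (coord_fun v i) F) ->
  approx Cu w u -> 0 < e <= 1 -> 0 <= I ->
  (\int[mu]_(y in pos) (y ^+ 2 * cut e y ^+ 2)%:E <= I%:E)%E ->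
  (forall y, 0 < y -> y * cut e y ^+ 2 <= I) ->
  (\int[mu]_(y in pos) (y * (dcut e y ^+ 2 * (y + y ^+ 3)))%:E <= I%:E)%E ->
  (\int[mu]_(y in pos) (y * ((1 - cut e y) ^+ 2 * F y ^+ 2))%:E <= J%:E)%E ->
  1 <= a -> (\int[mu]_(s in `[a, +oo[) (s * F s ^+ 2)%:E <= delta%:E)%E ->
  (\int[leb2]_(z in hp)
     ((u z * vel (trunc e (psi k)) j z - u z * coord_fun v j z) ^+ 2)%:E <=
   (3 * (Cu * (2 * k.+1%:R^-1 * I + 2 * k.+1%:R^-1 * I) + Cu * J +
     Cu * (4 * (2 * k.+1%:R^-1 * I + (a + a ^+ 3) * C' * (K * e) + 2 * delta * K))))%:E)%E.
Proof.
move=> mF vF au /andP[e0 e1] I0 hI hM hI3 hJ a1 hd.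
have cp := streams_csmooth H k; have sp := cp.1; have [_ _ muu _] := au.
have mv := streams_meas H j.
have mc2 : measurable_fun pos (fun y => cut e y ^+ 2) by exact: (measurable_sqr_pos (mcut e)).
have md2 : measurable_fun pos (fun y => dcut e y ^+ 2) by exact: (measurable_sqr_pos (mdcut e)).
have m1 : measurable_fun pos (fun y => (1 - cut e y) ^+ 2).
  by apply: measurable_sqr_pos; exact: measurable_funB.
have mF2 := measurable_sqr_pos mF.
set r := k.+1%:R^-1.
have r0 : 0 <= r :> R by rewrite invr_ge0.
have d0 : 0 <= delta.
  rewrite -lee_fin; apply: le_trans hd; apply: integral_ge0 => s /=; rewrite in_itv /= andbT => as_.
  by rewrite lee_fin mulr_ge0 ?sqr_ge0// (le_trans _ as_)// (le_trans _ a1).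
have C'0 := sqint_bound_ge0 (streams_energy H k 0 0).
have cv l : csmooth (vel (psi l) j) by apply: csmooth_vel; exact: streams_csmooth H l.
have bA : bound2 (fun z => cut e z.2 ^+ 2 * u z ^+ 2 * (vel (psi k) j z - coord_fun v j z) ^+ 2)
    (Cu * (2 * r * I + 2 * r * I)).
  have mGA : measurable_fun hp (fun z => cut e z.2 ^+ 2 * u z ^+ 2).
    exact: (@measurable_weight_sqr (fun y => cut e y ^+ 2)).
  have mkv : measurable_fun hp (fun z => vel (psi k) j z - coord_fun v j z).
    by apply: measurable_funB => //; exact: csmooth_meas.
  split.
  - by apply: measurable_funM => //; exact: measurable_funX.
  - by move=> z _; rewrite -!exprMn sqr_ge0.
  (* weight2_le needs a test function, so v is first replaced by the velocity of psi l,
     with l tending to infinity. *)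
  pose c l := Cu * ((2 * r + 2 * l.+1%:R^-1) * I + (2 * r + 2 * l.+1%:R^-1) * I).
  apply: (@integral_le_of_loc_cvg _ _ (fun l => vel (psi k - psi l) j) _ c) => //.
  - by move=> z _; rewrite -exprMn sqr_ge0.
  - move=> l; apply: csmooth_meas; apply: csmooth_vel; apply: csmoothB => //.
    exact: streams_csmooth H l.
  - move=> B b B0 b0; apply: filterS (streams_cvg H j B0 b0) => l.
    apply: le_trans; rewrite le_eqVlt; apply/orP; left; apply/eqP; apply: eq_integral => z _.
    rewrite velB//; last by have [] := streams_csmooth H l.
    have -> : (vel (psi k) j - vel (psi l) j) z = vel (psi k) j z - vel (psi l) j z by [].
    by congr EFin; ring.
  - move=> l; have sl := (streams_csmooth H l).1.
    have EB := (energy_le_vel _ (smoothB sp sl)).1 (streams_energyB H k l).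
    under eq_integral do rewrite mulrAC.
    apply: (@weight2_le _ Cu w u (vel (psi k - psi l) j) (fun y => cut e y ^+ 2)) => //.
    + by apply: csmooth_vel; apply: csmoothB => //; exact: streams_csmooth H l.
    + by move=> y _; exact: sqr_ge0.
  - rewrite /c; apply: cvgM; first exact: cvg_cst.
    have hc : (fun l : nat => 2 * r + 2 * l.+1%:R^-1) @ \oo --> (2 * r : R).
      rewrite -[X in _ --> X]addr0; apply: cvgD; first exact: cvg_cst.
      rewrite -[X in _ --> X](mulr0 2); apply: cvgM; first exact: cvg_cst.
      exact: cvg_harmonic.
    by apply: cvgD; apply: cvgM => //; exact: cvg_cst.
have bB : bound2 (fun z => (1 - cut e z.2) ^+ 2 * u z ^+ 2 * coord_fun v j z ^+ 2) (Cu * J).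
  have mGB : measurable_fun hp (fun z => (1 - cut e z.2) ^+ 2 * u z ^+ 2).
    exact: (@measurable_weight_sqr (fun y => (1 - cut e y) ^+ 2)).
  split.
  - by apply: measurable_funM => //; exact: measurable_funX.
  - by move=> z _; rewrite -!exprMn sqr_ge0.
  apply: (le_trans (integral_slice_dominated mGB _ mv mF (vF j))).
    by move=> z _; rewrite -exprMn sqr_ge0.
  under eq_integral do rewrite mulrAC.
  apply: (@weight_le _ Cu w u (fun y => (1 - cut e y) ^+ 2 * F y ^+ 2)) => //.
  - exact: measurable_funM.
  - by move=> y _; rewrite -exprMn sqr_ge0.
pose P y := 4 * ((y + y ^+ 3) * (2 * r) + (a + a ^+ 3) * C' + lg y * (2 * delta)).
have mP : measurable_fun pos P.
  apply: measurable_cts => y; apply: cvgM; first exact: cvg_cst.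
  apply: cvgD; last by apply: cvgM; [exact: Cn1_continuous (Cn1_lg 0) y|exact: cvg_cst].
  apply: cvgD; last exact: cvg_cst.
  apply: cvgM; last exact: cvg_cst.
  by apply: cvgD; [exact: cvg_id|apply: cvgM; [exact: cvg_id|apply: cvgM; exact: cvg_id]].
have P0 y : 0 < y -> 0 <= P y.
  by move=> y0; apply: le_trans (stream_le k 0 mF (vF 0) a1 hd y0); exact: sqr_ge0.
have bC : bound2 (fun z => (dcut e z.2 ^+ 2 * P z.2) * u z ^+ 2)
    (Cu * (4 * (2 * r * I + (a + a ^+ 3) * C' * (K * e) + 2 * delta * K))).
  have mdP : measurable_fun pos (fun y => dcut e y ^+ 2 * P y) by exact: measurable_funM.
  split.
  - exact: (@measurable_weight_sqr (fun y => dcut e y ^+ 2 * P y)).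
  - by move=> z z0; rewrite mulr_ge0 ?sqr_ge0// mulr_ge0 ?sqr_ge0 ?P0.
  apply: (@weight_le _ Cu w u (fun y => dcut e y ^+ 2 * P y)) => //.
    by move=> y y0; rewrite mulr_ge0 ?sqr_ge0 ?P0.
  have mpos : measurable pos by [].
  have c1 : bound1 (fun y => y * (dcut e y ^+ 2 * (y + y ^+ 3))) I.
    split => //.
    - apply: measurable_funM => //; apply: measurable_funM => //.
      by apply: measurable_funD => //; exact: measurable_funX.
    - move=> y /=; rewrite in_itv /= andbT => y0.
      have y0' : 0 <= y by exact: ltW.
      by rewrite mulr_ge0// mulr_ge0 ?sqr_ge0// addr_ge0 ?exprn_ge0.
  have c2 := bound_dcut e0.
  have c3 : bound1 (fun y => y * (dcut e y ^+ 2 * lg y)) K.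
    split; last exact: integral_dcut_sqr_lg.
    - apply: measurable_funM => //; apply: measurable_funM => //.
      exact: (measurable_cts (Cn1_continuous (Cn1_lg 0))).
    - move=> y /=; rewrite in_itv /= andbT => y0.
      by rewrite mulr_ge0 ?(ltW y0)// mulr_ge0 ?sqr_ge0 ?lg_ge0.
  have r2 : 0 <= 2 * r by rewrite mulr_ge0.
  have aC : 0 <= (a + a ^+ 3) * C'.
    have a0 : 0 <= a by apply: le_trans a1.
    by rewrite mulr_ge0// addr_ge0 ?exprn_ge0.
  have dd : 0 <= 2 * delta by rewrite mulr_ge0.
  have [_ _] := int_boundZ mpos (ler0n R 4) (int_boundD mpos (int_boundD mpos (int_boundZ mpos r2 c1) (int_boundZ mpos aC c2)) (int_boundZ mpos dd c3)).
  apply: le_trans; rewrite le_eqVlt; apply/orP; left; apply/eqP; apply: eq_integral => y _.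
  by congr EFin; rewrite /P; ring.
have B := int_boundZ measurable_half_plane (ler0n R 3)
  (int_boundD measurable_half_plane (int_boundD measurable_half_plane bA bB) bC).
apply: (int_bound_le measurable_half_plane _ _ B).
  apply: measurable_funX; apply: measurable_funB; apply: measurable_funM => //.
  exact: (csmooth_meas (csmooth_vel j (csmooth_trunc e cp))).
move=> z z0; rewrite sqr_ge0 /= (vel_trunc e j z sp).
have hP : psi k z ^+ 2 <= P z.2.
  by case: z z0 => x y y0; exact: stream_le mF (vF 0) a1 hd y0.
apply: sqr_sub_mul_le; case: ifP => _; first by rewrite exprMn ler_wpM2l ?sqr_ge0.
by rewrite expr0n /= mulr_ge0 ?sqr_ge0 ?P0.
Qed.

End Streams.

End Truncation.

(** * The diagonal sequence *)

Section Diagonal.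
Context {R : realType}.
Local Notation mu := (@lebesgue_measure R).
Local Notation T := (measurableTypeR R).
Local Notation hp := (@half_plane R : set (@plane R)).
Local Notation pos := (`]0%R, +oo[%classic : set T).
Local Notation K := (@absorb_const R * 8).
Local Notation e_ n := (n.+1%:R^-1 : R).

Lemma e_itv n : 0 < e_ n <= 1. Proof. by rewrite invr_gt0 ltr0n invf_le1 ?ler1n ?ltr0n. Qed.

Lemma cut_cvg (y : R) : (fun n => (1 - cut (e_ n) y) ^+ 2) @ \oo --> (0 : R).
Proof.
have ec : (fun n => (e_ n * lg y) ^+ 2) @ \oo --> (0 : R).
  rewrite -[X in _ --> X](mulr0 (0 * lg y)) -{2}(mul0r (lg y)).
  by apply: cvgM; apply: cvgM; [exact: cvg_harmonic|exact: cvg_cst|exact: cvg_harmonic|exact: cvg_cst].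
apply: (@squeeze_cvgr _ _ _ _ (fun=> 0) (fun n => (e_ n * lg y) ^+ 2)) => //; last exact: cvg_cst.
near=> n; rewrite sqr_ge0 /=; apply: le_trans (one_sub_cut_le (e_ n) y).
have c0 := cut_gt0 (e_ n) y; have c1 := cut_le1 (e_ n) y.
by rewrite expr2 ler_piMl; lra.
Unshelve. all: by end_near. Qed.

Lemma one_sub_cut_itv e (y : R) : 0 <= (1 - cut e y) ^+ 2 <= 1.
Proof. by have c0 := cut_gt0 e y; have c1 := cut_le1 e y; rewrite sqr_ge0 exprn_ile1//; lra. Qed.

Lemma near_inv_mul_le (M e : R) : 0 < e -> \forall n \near \oo, M * e_ n <= e.
Proof.
move=> e0; have : (fun n => M * e_ n) @ \oo --> (0 : R).
  by rewrite -[X in _ --> X](mulr0 M); apply: cvgM; [exact: cvg_cst|exact: cvg_harmonic].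
move/cvgrPdist_le => /(_ _ e0); apply: filterS => n; rewrite sub0r normrN.
exact/le_trans/ler_norm.
Qed.

Let m1 e : measurable_fun pos (fun y => (1 - cut e y) ^+ 2).
Proof.
by apply: measurable_sqr_pos; apply: measurable_funB => //; exact: (measurable_cts (@continuous_cut R e)).
Qed.

Variables (v : R * R -> 'rV[R]_2) (G : R * R -> 'M[R]_2) (psi : nat -> R * R -> R) (C : R).
Hypothesis H : streams v G psi C.
Variables (F : R -> R) (S : R).
Hypothesis mF : measurable_fun pos F.
Hypothesis FS : (\int[mu]_(y in pos) (y * F y ^+ 2)%:E <= S%:E)%E.
Hypothesis vF : forall i, slice_dominated (coord_fun v i) F.
Variables (I : nat -> R) (kap : nat -> nat).
Hypothesis I0 : forall n, 0 <= I n.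
Hypothesis hI : forall n, [/\ (\int[mu]_(y in pos) (y ^+ 2 * cut (e_ n) y ^+ 2)%:E <= (I n)%:E)%E,
      forall y, 0 < y -> y * cut (e_ n) y ^+ 2 <= I n &
      (\int[mu]_(y in pos) (y * (dcut (e_ n) y ^+ 2 * (y + y ^+ 3)))%:E <= (I n)%:E)%E].
Hypothesis kapI : forall n, e_ (kap n) * I n <= e_ n.
Hypothesis le_kap : forall n, e_ (kap n) <= e_ n.
Local Notation C' := (2 * 1 + 2 * C).
Local Notation tr n := (trunc (e_ n) (psi (kap n))).

Let mpos : measurable pos. Proof. exact: measurable_itv. Qed.

Let bF : int_bound mu pos (fun y => y * F y ^+ 2) S.
Proof.
split => //; first by apply: measurable_funM => //; exact: measurable_funX.
by move=> y /=; rewrite in_itv /= andbT => y0; rewrite mulr_ge0 ?sqr_ge0// ltW.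
Qed.

Let bG i j : int_bound (@leb2 R) hp (fun z => G z i j ^+ 2) C.
Proof.
split; last exact: (streams_grad_le H i j).
- by apply: measurable_funX; exact: (streams_mgrad H i j).
- by move=> z _; exact: sqr_ge0.
Qed.

(** The height a of stream_le above which v contributes little to the norm of X. *)
Lemma tail_small (d : R) : 0 < d -> exists2 a : R, 1 <= a &
  (\int[mu]_(s in `[a, +oo[) (s * F s ^+ 2)%:E <= d%:E)%E.
Proof.
move=> d0; pose h n : R -> R := \1_(`[n.+1%:R, +oo[%classic : set R).
have mh n : measurable_fun pos (h n) by apply: measurable_indic; exact: measurable_itv.
have h01 n (y : T) : pos y -> 0 <= h n y <= 1 by move=> _; rewrite /h indicE; case: (_ \in _); rewrite ?lexx ?ler01.
have hc (y : T) : pos y -> h ^~ y @ \oo --> (0 : R).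
  move=> _; apply: cvg_near_cst; apply: filterS (nbhs_infty_gtr y) => n yn.
  rewrite /h indicE memNset// /= in_itv /= andbT; apply/negP; rewrite -ltNge (lt_trans yn)// ltr_nat//.
have [n _ /(_ n (leqnn n)) nP] := integral_cvg0_of_dominated mpos bF mh h01 hc d0.
exists n.+1%:R; first by rewrite ler1n.
have [mp p0 _] := bF.
apply: le_trans nP.
have -> : (\int[mu]_(s in `[n.+1%:R, +oo[) (s * F s ^+ 2)%:E =
    \int[mu]_(s in `[n.+1%:R, +oo[) (h n s * (s * F s ^+ 2))%:E)%E.
  by apply: eq_integral => y yn; rewrite /h indicE yn mul1r.
apply: ge0_subset_integral => //.
- by apply/measurable_EFinP; exact: measurable_funM.
- by move=> y y0; rewrite lee_fin mulr_ge0 ?p0//; case/andP: (h01 n y y0).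
- by move=> y /=; rewrite !in_itv /= !andbT; exact: lt_le_trans.
Qed.

Lemma trunc_small_hp i j (d : R) : 0 < d -> \forall n \near \oo,
  (\int[leb2]_(z in hp) ((1 - cut (e_ n) z.2) ^+ 2 * G z i j ^+ 2)%:E <= d%:E)%E.
Proof.
apply: (integral_cvg0_of_dominated (@measurable_half_plane R) (bG i j)
  (h := fun n z => (1 - cut (e_ n) z.2) ^+ 2)).
- by move=> n; exact: (measurable_snd_real (m1 (e_ n))).
- by move=> n z _; exact: one_sub_cut_itv.
- by move=> z _; exact: cut_cvg.
Qed.

Lemma trunc_small_pos (d : R) : 0 < d -> \forall n \near \oo,
  (\int[mu]_(y in pos) (y * ((1 - cut (e_ n) y) ^+ 2 * F y ^+ 2))%:E <= d%:E)%E.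
Proof.
move=> d0; have := @integral_cvg0_of_dominated _ _ _ _ _ mpos _ _
  (fun n y => (1 - cut (e_ n) y) ^+ 2) bF _ _ _ d d0.
move=> P; apply: filterS (P _ _ _) => //.
- by move=> n; under eq_integral do rewrite mulrCA.
- by move=> n y _; exact: one_sub_cut_itv.
- by move=> y _; exact: cut_cvg.
Qed.

Lemma grad_cvg i j (d : R) : 0 < d -> \forall n \near \oo,
  (\int[leb2]_(z in hp) ((partial j (vel (tr n) i) z - G z i j) ^+ 2)%:E <= d%:E)%E.
Proof.
move=> d0; have d6 : 0 < d / 6 by rewrite divr_gt0.
apply: filterS2 (trunc_small_hp i j d6) (near_inv_mul_le (1 + 18 * (C' * K)) d6) => n hJ hn.
apply: (le_trans (trunc_grad_le H (kap n) (e_itv n) hJ)); rewrite lee_fin.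
have := le_kap n; move: hn; rewrite mulrDl mul1r.
rewrite (_ : 8 * _ + 2 * _ = 18 * (C' * K) * e_ n); last by ring.
have arith (A E X : R) : E + X <= d / 6 -> A <= E -> 3 * (A + d / 6 + X) <= d by move=> ? ?; lra.
exact: arith.
Qed.

Lemma grad_lty i j n :
  (\int[leb2]_(z in hp) ((partial j (vel (tr n) i) z - G z i j) ^+ 2)%:E < +oo)%E.
Proof.
apply: (le_lt_trans (trunc_grad_le H (kap n) (e_itv n) (J := C) _)); last exact: ltry.
apply: (int_bound_le (@measurable_half_plane R) _ _ (bG i j)).
- exact: (measurable_weight_sqr (m1 (e_ n)) (streams_mgrad H i j)).
- move=> z _; have /andP[h0 h1] := one_sub_cut_itv (e_ n) z.2.
  by rewrite mulr_ge0 ?sqr_ge0//= ler_piMl ?sqr_ge0.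
Qed.

Section Tensor.
Variables (u : R * R -> R) (w : nat -> R * R -> R) (Cu : R).
Hypothesis au : approx Cu w u.

Let Cu0 : 0 <= Cu. Proof. by have [_ /(_ 0) /sqint_bound_ge0] := au. Qed.

(** trunc_tensor_le for the diagonal sequence. The term with delta does not tend to 0
    with n, but it is small when a is large. *)
Lemma tensor_le n j (J a delta : R) :
  (\int[mu]_(y in pos) (y * ((1 - cut (e_ n) y) ^+ 2 * F y ^+ 2))%:E <= J%:E)%E ->
  1 <= a -> (\int[mu]_(s in `[a, +oo[) (s * F s ^+ 2)%:E <= delta%:E)%E ->
  (\int[leb2]_(z in hp) ((u z * vel (tr n) j z - u z * coord_fun v j z) ^+ 2)%:E <=
    (3 * Cu * J + 24 * (Cu * K) * delta +
     (36 * Cu + 12 * (Cu * ((a + a ^+ 3) * C' * K))) * e_ n)%:E)%E.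
Proof.
move=> hJ a1 hd; have [h1 h2 h3] := hI n.
apply: (le_trans (trunc_tensor_le H (kap n) j mF vF au (e_itv n) (I0 n) h1 h2 h3 hJ a1 hd)).
rewrite lee_fin.
rewrite (_ : 3 * (_ + _ + _) = 3 * Cu * J + 24 * (Cu * K) * delta +
  (36 * (Cu * (e_ (kap n) * I n)) + 12 * (Cu * ((a + a ^+ 3) * C' * K)) * e_ n)); last by ring.
by rewrite lerD2l [leRHS]mulrDl lerD2r -mulrA ler_pM2l// ler_wpM2l.
Qed.

Lemma tensor_cvg j (d : R) : 0 < d -> \forall n \near \oo,
  (\int[leb2]_(z in hp) ((u z * vel (tr n) j z - u z * coord_fun v j z) ^+ 2)%:E <= d%:E)%E.
Proof.
move=> d0; have d3 : 0 < d / 3 by rewrite divr_gt0.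
have small (M : R) : 0 <= M -> exists2 t : R, 0 < t & M * t <= d / 3.
  move=> M0; exists (d / 3 / (M + 1)); first by rewrite divr_gt0// ltr_wpDl.
  by rewrite mulrA ler_pdivrMr ?ltr_wpDl// mulrC ler_pM2l// lerDl.
have K0 := @K_gt0 R.
have [J J0 hJ] := small (3 * Cu) (mulr_ge0 (ler0n R 3) Cu0).
have [t t0 ht] := small (24 * (Cu * K)) (mulr_ge0 (ler0n R 24) (mulr_ge0 Cu0 (ltW K0))).
have [a a1 ha] := tail_small t0.
apply: filterS2 (trunc_small_pos J0) (near_inv_mul_le (36 * Cu + 12 * (Cu * ((a + a ^+ 3) * C' * K))) d3) => n hn hn2.
apply: (le_trans (tensor_le j hn a1 ha)); rewrite lee_fin.
apply: (le_trans (lerD (lerD hJ ht) hn2)).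
by rewrite (_ : d / 3 + d / 3 + d / 3 = d)//; field.
Qed.

Lemma tensor_lty j n :
  (\int[leb2]_(z in hp) ((u z * vel (tr n) j z - u z * coord_fun v j z) ^+ 2)%:E < +oo)%E.
Proof.
have [mp p0 _] := bF.
apply: (le_lt_trans (tensor_le (J := S) (a := 1) (delta := S) j _ _ _)); last exact: ltry.
- apply: (int_bound_le mpos _ _ bF).
  + apply: measurable_funM => //; apply: measurable_funM => //; exact: measurable_funX.
  + move=> y y0; rewrite mulrCA; have /andP[h0 h1] := one_sub_cut_itv (e_ n) y.
    by rewrite mulr_ge0 ?p0//= ler_piMl ?p0.
- exact: lexx.
- apply: le_trans FS; apply: ge0_subset_integral => //.
  + exact/measurable_EFinP.
  + by move=> y /=; rewrite !in_itv /= !andbT; exact: lt_le_trans.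
Qed.

Lemma tensor_limit_lty j : (\int[leb2]_(z in hp) ((u z * coord_fun v j z) ^+ 2)%:E < +oo)%E.
Proof.
have [_ _ mu_ _] := au.
under eq_integral do rewrite exprMn.
apply: (@le_lt_trans _ _ (Cu * S)%:E); last exact: ltry.
apply: (le_trans (integral_slice_dominated _ _ (streams_meas H j) mF (vF j))).
- exact: measurable_funX.
- by move=> z _; exact: sqr_ge0.
under eq_integral do rewrite mulrC.
apply: (weight_le au (g := fun y => F y ^+ 2)) => //.
- exact: measurable_funX.
- by move=> y _; exact: sqr_ge0.
Qed.

End Tensor.
End Diagonal.

Theorem lemma2p8 (R : realType) (v : R * R -> 'rV[R]_2)
    (hv : (dotH1_0sigma `&` space_X) v) :
  exists v_ : nat -> R * R -> 'rV[R]_2,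
    [/\ forall n, Cc_sigma (v_ n),
        dotH1_cvg v_ v &
        forall u : R * R -> 'rV[R]_2, dotH1_0sigma u ->
          L2_cvg half_plane (fun n => tensor u (v_ n)) (tensor u v)].
Proof.
have [vs [_ vX]] := hv.
have [G [psi [C H]]] := exists_streams vs.
have [F [mF [S FS] vF]] := exists_slice_bound (streams_meas H) vX.
have e0 n : (0 : R) < n.+1%:R^-1 by rewrite invr_gt0.
have /choice[I hI] : forall n, exists I : R, 0 <= I /\ [/\
      (\int[lebesgue_measure]_(y in `]0%R, +oo[) (y ^+ 2 * cut n.+1%:R^-1 y ^+ 2)%:E <= I%:E)%E,
      forall y, 0 < y -> y * cut n.+1%:R^-1 y ^+ 2 <= I &
      (\int[lebesgue_measure]_(y in `]0%R, +oo[)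
         (y * (dcut n.+1%:R^-1 y ^+ 2 * (y + y ^+ 3)))%:E <= I%:E)%E].
  by move=> n; have [I I0 hI] := cut_tail (e0 n); exists I.
have I0 n : 0 <= I n by case: (hI n).
have hI' n := proj2 (hI n).
(* The constant I n may grow with n without control: the index kap n makes the error of
   the stream function small compared with it. *)
have /choice[kap kapP] : forall n, exists k : nat,
    k.+1%:R^-1 * I n <= n.+1%:R^-1 /\ k.+1%:R^-1 <= n.+1%:R^-1 :> R.
  move=> n; have [k0 _ k0P] := near_inv_mul_le (I n) (e0 n).
  exists (maxn k0 n); split; first by rewrite mulrC; apply: k0P; rewrite /= leq_maxl.
  by rewrite lef_pV2 ?posrE ?ltr0n// ler_nat ltnS leq_maxr.
have kapI n := proj1 (kapP n); have le_kap n := proj2 (kapP n).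
pose t n := trunc (n.+1%:R^-1) (psi (kap n)).
have ct n : csmooth (t n) by apply: csmooth_trunc; exact: streams_csmooth H _.
have mt n i : measurable_fun (half_plane : set (@plane R)) (vel (t n) i).
  exact: (csmooth_meas (csmooth_vel i (ct n))).
exists (fun n => vel_field (t n)); split.
- move=> n; apply: stream_Cc_sigma (ct n) _; apply: trunc_schwarz.
    by have [] := streams_csmooth H (kap n).
  exact: streams_schwarz H _.
- exists G; first exact: streams_grad H.
  have jE n z i j : jac (vel_field (t n)) z i j = partial j (vel (t n) i) z.
    by rewrite mxE coord_vel_field.
  apply: (entries_L2_cvg (@measurable_half_plane R)).
  + move=> n i j; under eq_fun do rewrite jE.
    exact: (csmooth_meas (csmooth_partial j (csmooth_vel i (ct n)))).
  + exact: streams_mgrad H.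
  + by move=> i j; apply: (le_lt_trans (streams_grad_le H i j)); exact: ltry.
  + by move=> n i j; under eq_integral do rewrite jE; exact: (grad_lty H).
  + move=> i j d d0; apply: filterS (grad_cvg H le_kap i j d0) => n.
    by move=> nd; under eq_integral do rewrite jE.
move=> u us.
have [Gu [psiu [Cu Hu]]] := exists_streams us.
have au := streams_approx Hu.
have tE (n : nat) z i j : tensor u (vel_field (t n)) z i j = coord_fun u i z * vel (t n) j z.
  by rewrite mxE coord_vel_field.
have tE' z i j : tensor u v z i j = coord_fun u i z * coord_fun v j z by rewrite mxE.
apply: (entries_L2_cvg (@measurable_half_plane R)).
- move=> n i j; under eq_fun do rewrite tE; apply: measurable_funM => //.
  exact: (streams_meas Hu i).
- move=> i j; under eq_fun do rewrite tE'; apply: measurable_funM.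
    exact: (streams_meas Hu i).
  exact: (streams_meas H j).
- by move=> i j; under eq_integral do rewrite tE'; exact: (tensor_limit_lty H mF FS vF (au i)).
- by move=> n i j; under eq_integral do rewrite tE tE'; exact: (tensor_lty H mF FS vF I0 hI' kapI (au i)).
- move=> i j d d0; apply: filterS (tensor_cvg H mF FS vF I0 hI' kapI (au i) j d0) => n.
  by move=> nd; under eq_integral do rewrite tE tE'.
Qed.
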